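(* The class of $N$-dimensional flat torsionless submanifolds in $(N+L)$-dimensional pseudo-Euclidean spaces is described (locally, in flat coordinates) by the system of nonlinear equations $$\sum_{\alpha=1}^L\sum_{\beta=1}^L \mu^{\alpha\beta}\left(\frac{\partial^2\psi_\alpha}{\partial u^i\partial u^k}\frac{\partial^2\psi_\beta}{\partial u^j\partial u^l}-\frac{\partial^2\psi_\alpha}{\partial u^i\partial u^l}\frac{\partial^2\psi_\beta}{\partial u^j\partial u^k}\right)=0,\qquad 1\le i,j,k,l\le N,$$ $$\sum_{i=1}^N\sum_{j=1}^N \eta^{ij}\left(\frac{\partial^2\psi_\alpha}{\partial u^i\partial u^k}\frac{\partial^2\psi_\beta}{\partial u^j\partial u^l}-\frac{\partial^2\psi_\alpha}{\partial u^i\partial u^l}\frac{\partial^2\psi_\beta}{\partial u^j\partial u^k}\right)=0,\qquad 1\le k,l\le N,\ 1\le\alpha,\beta\le L,$$ for functions $\psi_\alpha(u)$, $1\le\alpha\le L$, $u=(u^1,\dots,u^N)$. Here $\eta^{ij}$ and $\mu^{\alpha\beta}$ are arbitrary constant nondegenerate symmetric matrices; the signature of the ambient $(N+L)$-dimensional pseudo-Euclidean space is the sum of the signatures of the metrics $\eta^{ij}$ and $\mu^{\alpha\beta}$; $\mathbf{I}=ds^2=\eta_{ij}\,du^i\,du^j$ is the first fundamental form, where $\eta_{ij}$ is the inverse of $\eta^{ij}$; and $\mathbf{II}_\alpha=\frac{\partial^2\psi_\alpha}{\partial u^i\partial u^j}\,du^i\,du^j$, $1\le\alpha\le L$, are the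 second fundamental forms of the corresponding flat torsionless submanifold. That is: locally, for every such submanifold, in flat coordinates with $\mathbf I=\eta_{ij}du^idu^j$ and with normal Gram matrix inverse to $\mu^{\alpha\beta}$, there are functions $\psi_\alpha$ satisfying this system whose Hessians are the second fundamental forms; and conversely every solution $\psi_\alpha$ of the system locally arises in this way from some such submanifold.
   Context: All objects are smooth; repeated upper and lower indices are summed. An $(N+L)$-dimensional pseudo-Euclidean space is a real vector space with a constant nondegenerate symmetric bilinear form $(\cdot,\cdot)$ of arbitrary signature. An $N$-dimensional submanifold given locally by $r(u^1,\dots,u^N)$ is assumed totally nonisotropic, i.e. its first fundamental form (induced metric) $g_{ij}=(r_{u^i},r_{u^j})$ is nondegenerate. In the normal spaces one uses bases $n_1(u),\dots,n_L(u)$ with constant Gram matrix $\mu_{\alpha\beta}=(n_\alpha,n_\beta)$, $\det(\mu_{\alpha\beta})\ne0$, with inverse $\mu^{\alpha\beta}$. The second fundamental forms are $\omega_{\alpha,ij}\,du^i\,du^j$ with $\omega_{\alpha,ij}=(n_\alpha,r_{u^iu^j})$, and the torsion forms are $\varkappa_{\alpha\beta,i}\,du^i$ with $\varkappa_{\alpha\beta,i}=(n_{\alpha,u^i},n_\beta)$. The submanifold is torsionless if (for a suitable such basis, which is then the one used) all torsion forms vanish. It is flat if $g_{ij}$ is a flat metric; flat coordinates are coordinates in which $g_{ij}=\eta_{ij}$ is a constant matrix. *)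

(* Defs.v *)
From HB Require Import structures.
From mathcomp Require Import all_boot all_order all_algebra.
From mathcomp Require Import all_classical all_reals all_analysis.

Set Implicit Arguments.
Unset Strict Implicit.
Unset Printing Implicit Defensive.

Import Order.TTheory GRing.Theory Num.Theory.
Import numFieldNormedType.Exports.

Local Open Scope classical_set_scope.
Local Open Scope ring_scope.

Definition partial (R : realType) (N : nat) (V : normedModType R) (i : 'I_N)
    (f : 'rV[R]_N -> V) : 'rV[R]_N -> V :=
  'D_(delta_mx 0 i) f.

Definition iter_partial (R : realType) (N : nat) (V : normedModType R)
    (s : seq 'I_N) (f : 'rV[R]_N -> V) : 'rV[R]_N -> V :=
  foldr (@partial R N V) f s.

(* C^oo on U, for U open: every iterated partial derivative is (Frechet)
   differentiable, hence in particular continuous, at each point of U. *)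
Definition smooth_on (R : realType) (N : nat) (V : normedModType R)
    (U : set 'rV[R]_N) (f : 'rV[R]_N -> V) : Prop :=
  forall (s : seq 'I_N) (x : 'rV[R]_N), U x ->
    differentiable (iter_partial s f) x.

(* A constant nondegenerate symmetric matrix, of arbitrary signature. *)
Definition nondeg_sym (R : realType) (m : nat) (A : 'M[R]_m) : Prop :=
  A^T = A /\ A \in unitmx.

(* The pseudo-Euclidean space of dimension m is R^m with the bilinear form whose
   Gram matrix in the standard basis is G, for G satisfying nondeg_sym. *)
Definition bform (R : realType) (m : nat) (G : 'M[R]_m) (x y : 'rV[R]_m) : R :=
  (x *m G *m y^T) 0 0.

(* A is congruent to the diagonal matrix with p entries 1 and q entries -1; by
   Sylvester's law the pair (p, q) exists and is unique when nondeg_sym A. *)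
Definition has_signature (R : realType) (m : nat) (A : 'M[R]_m) (p q : nat) :
    Prop :=
  (p + q)%N = m /\
  exists2 P : 'M[R]_m, P \in unitmx &
    P *m A *m P^T = diag_mx (\row_(i < m) (if (i < p)%N then 1 else -1)).

Definition signature_is_sum (R : realType) (m1 m2 m : nat)
    (A : 'M[R]_m1) (B : 'M[R]_m2) (G : 'M[R]_m) : Prop :=
  forall p1 q1 p2 q2 : nat,
    has_signature A p1 q1 -> has_signature B p2 q2 ->
    has_signature G (p1 + p2) (q1 + q2).

Section Submanifold.
Context {R : realType} {N L : nat}.
Implicit Types (G : 'M[R]_(N + L)) (r : 'rV[R]_N -> 'rV[R]_(N + L)).
Implicit Types (n : 'I_L -> 'rV[R]_N -> 'rV[R]_(N + L)).
Implicit Types (U W : set 'rV[R]_N) (g : 'rV[R]_N -> 'M[R]_N).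

Definition first_form G r (u : 'rV[R]_N) : 'M[R]_N :=
  \matrix_(i, j) bform G (partial i r u) (partial j r u).

Definition second_form G r n (a : 'I_L) (u : 'rV[R]_N) : 'M[R]_N :=
  \matrix_(i, j) bform G (n a u) (partial j (partial i r) u).

Definition torsion_form G n (a b : 'I_L) (i : 'I_N) (u : 'rV[R]_N) : R :=
  bform G (partial i (n a) u) (n b u).

(* Nondegeneracy of the first fundamental form forces r to be an immersion. *)
Definition nonisotropic_submanifold G U r : Prop :=
  [/\ open U, smooth_on U r &
      forall u, U u -> first_form G r u \in unitmx].

(* For a nonisotropic submanifold the normal spaces have dimension L, so L normal
   vectors with nondegenerate Gram matrix form a basis of the normal space. *)
Definition normal_frame G U r (mu : 'M[R]_L) n : Prop :=
  [/\ mu \in unitmx,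
      forall a, smooth_on U (n a),
      forall a i u, U u -> bform G (n a u) (partial i r u) = 0 &
      forall a b u, U u -> bform G (n a u) (n b u) = mu a b].

(* The submanifold is torsionless when such mu and n exist. *)
Definition torsionless_frame G U r (mu : 'M[R]_L) n : Prop :=
  normal_frame G U r mu n /\
  forall a b i u, U u -> torsion_form G n a b i u = 0.

(* christoffel g k i j is Gamma^k_{ij}. *)
Definition christoffel g (k i j : 'I_N) (u : 'rV[R]_N) : R :=
  2^-1 * \sum_(l < N) invmx (g u) k l *
    (partial i (fun v => g v j l) u + partial j (fun v => g v i l) u
     - partial l (fun v => g v i j) u).

(* riemann g k l i j is R^k_{l i j}. *)
Definition riemann g (k l i j : 'I_N) (u : 'rV[R]_N) : R :=
  partial i (christoffel g k j l) u - partial j (christoffel g k i l) u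
  + \sum_(m < N) (christoffel g k i m u * christoffel g m j l u
                  - christoffel g k j m u * christoffel g m i l u).

Definition flat_metric U g : Prop :=
  forall k l i j u, U u -> riemann g k l i j u = 0.

Definition flat_submanifold G U r : Prop :=
  nonisotropic_submanifold G U r /\ flat_metric U (first_form G r).

(* phi is a diffeomorphism of W onto an open subset of U; it is written from the
   new coordinates w in W to the old ones, so that in the new coordinates the
   submanifold r is given by r \o phi. *)
Definition coordinate_change W U (phi : 'rV[R]_N -> 'rV[R]_N) : Prop :=
  [/\ open W, smooth_on W phi, open (phi @` W), phi @` W `<=` U &
      exists2 chi : 'rV[R]_N -> 'rV[R]_N,
        smooth_on (phi @` W) chi & forall w, W w -> chi (phi w) = w].

(* eta is the matrix with lower indices. *)
Definition flat_coordinates G U r W (phi : 'rV[R]_N -> 'rV[R]_N)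
    (eta : 'M[R]_N) : Prop :=
  coordinate_change W U phi /\
  forall w, W w -> first_form G (r \o phi) w = eta.

Definition hessian (f : 'rV[R]_N -> R) (u : 'rV[R]_N) : 'M[R]_N :=
  \matrix_(i, j) partial j (partial i f) u.

(* etaU and muU are the matrices with upper indices, eta^{ij} and mu^{ab}. *)
Definition psi_system (etaU : 'M[R]_N) (muU : 'M[R]_L) U
    (psi : 'I_L -> 'rV[R]_N -> R) : Prop :=
  forall u, U u ->
    (forall i j k l : 'I_N,
       \sum_(a < L) \sum_(b < L) muU a b *
         (hessian (psi a) u i k * hessian (psi b) u j l
          - hessian (psi a) u i l * hessian (psi b) u j k) = 0) /\
    (forall (k l : 'I_N) (a b : 'I_L),
       \sum_(i < N) \sum_(j < N) etaU i j *
         (hessian (psi a) u i k * hessian (psi b) u j l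
          - hessian (psi a) u i l * hessian (psi b) u j k) = 0).

End Submanifold.

(* Main.v *)
(* In flat coordinates, with parallel normals, all Christoffel symbols and torsion
   forms vanish, so r_{ij} is normal and the derivatives of the normals are tangent.
   Differentiating (r_{ik}, r_j) = 0 and ((n_a)_k, n_b) = 0 once more gives the two
   families of equations, and differentiating (n_a, r_{ij}) shows that
   d_k omega_{a,ij} is totally symmetric, so two applications of the Poincare lemma
   produce psi_a.  Conversely, the two families of equations are exactly the
   compatibility conditions of the Gauss-Weingarten system for the frame (r_i, n_a).
   Flat coordinates are the primitives of a parallel coframe.

   All three constructions rest on one analytic fact: a linear total differential
   system d_j y_a = sum_b c_{j,ab} y_b with flat coefficients is locally solvable with
   prescribed value at a point.  The solution is transported along rays, where it
   solves a linear differential equation with small coefficients; flatness makes the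
   result Frechet differentiable with the prescribed derivatives, and smoothness then
   follows from the equations themselves. *)

From HB Require Import structures.
Require Import Defs.
From mathcomp Require Import all_boot all_order all_algebra.
From mathcomp Require Import all_classical all_reals all_analysis.
From mathcomp Require Import perm ring lra.
Import Order.TTheory GRing.Theory Num.Theory.
Import numFieldNormedType.Exports.
Set Implicit Arguments.
Unset Strict Implicit.
Unset Printing Implicit Defensive.
Local Open Scope classical_set_scope.
Local Open Scope ring_scope.

(** * Differential calculus of smooth functions *)

(** The transport fact has a uniqueness half that the overview leaves out, and it does as much work
    as existence. Twice a bilinear form must be preserved: the Gram matrix of the moving frame has
    to stay constant, and the metric has to become constant in the coordinates given by the coframe.
    In both cases two covariant 2-tensors are parallel for one connection and agree at a point, so
    uniqueness for the linear system on pairs of indices identifies them.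

    The obstacle in existence is that a differential equation along rays controls only the radial
    derivative. The derivative in direction [k] is obtained by comparing the solutions along two
    neighbouring rays with the candidate predicted by the coefficients; flatness removes the
    first-order terms from the error, which is then quadratic in [k]. Balls are shrunk until all
    coefficient rows have absolute sum at most 1/4: this one condition makes the Picard series
    converge and replaces the exponential in the Gronwall estimate. *)

Section Calculus.
Context {R : realType} {N : nat}.
Implicit Types (U : set 'rV[R]_N) (f g : 'rV[R]_N -> R) (x : 'rV[R]_N).

Lemma rV_coord_norm m (v : 'rV[R]_m) (i : 'I_m) : `|v 0 i| <= `|v|.
Proof.
rewrite [leRHS]/Num.Def.normr/= mx_normrE.
exact: (le_bigmax _ (fun ij : 'I_1 * 'I_m => `|v ij.1 ij.2|) (0, i)).
Qed.

Lemma rV_norm_le m (v : 'rV[R]_m) (e : R) :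
  0 <= e -> (forall i, `|v 0 i| <= e) -> `|v| <= e.
Proof.
move=> e0 ve; rewrite [leLHS]/Num.Def.normr/= mx_normrE.
by apply: bigmax_le => // -[i j] _ /=; rewrite ord1.
Qed.

Lemma norm_delta_le m (i : 'I_m) : `|delta_mx 0 i : 'rV[R]_m| <= 1.
Proof.
by apply: rV_norm_le => // j; rewrite mxE; case: (_ && _); rewrite ?normr1 ?normr0.
Qed.

Lemma cvg_sum_fin (I : finType) (T : Type) (F : set_system T) (FF : Filter F)
    (g : I -> T -> R) (l : I -> R) :
  (forall i, g i t @[t --> F] --> l i) ->
  \sum_i g i t @[t --> F] --> \sum_i l i.
Proof.
move=> gl; apply: cvg_big => // p; exact: add_continuous.
Qed.

Lemma derive_partial f x (v : 'rV[R]_N) : differentiable f x ->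
  'D_v f x = \sum_i v 0 i * partial i f x.
Proof.
move=> df; rewrite deriveE// {1}(row_sum_delta v) linear_sum.
by apply: eq_bigr => i _; rewrite linearZ /= /partial deriveE.
Qed.

Lemma differentiable_of_linear (V W : normedModType R) (f : V -> W)
    (dL : {linear V -> W}) (x : V) :
  continuous dL ->
  (forall e, 0 < e -> exists2 d, 0 < d & forall k, `|k| < d ->
     `|f (x + k) - f x - dL k| <= e * `|k|) ->
  differentiable f x /\ 'd f x = dL :> (V -> W).
Proof.
move=> dc H.
have E : f \o shift x = cst (f x) + dL +o_ 0 id.
  apply/eqaddoP => _/posnumP[e].
  have [r r0 Hr] := H _ (gt0 e).
  near=> k.
  rewrite -[(_ - _) k]/(f (k + x) - (f x + dL k)) opprD addrA (addrC k).
  apply: Hr.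
  near: k; apply/nbhs_ballP; exists r => // k /=.
  by rewrite -ball_normE /= sub0r normrN.
have dfx : 'd f x = dL :> (_ -> _) by apply: diff_unique.
by split=> //; apply/diff_locallyP; rewrite dfx.
Unshelve. all: by end_near. Qed.

(** The entry point from explicit estimates to differentiability: transported solutions and the
    local inverse come with candidate partials [l] and an error bound, not with a formula to
    differentiate. *)
Lemma frechet_criterion f x (l : 'I_N -> R) :
  (forall e, 0 < e -> exists2 d, 0 < d & forall k, `|k| < d ->
     `|f (x + k) - f x - \sum_i k 0 i * l i| <= e * `|k|) ->
  differentiable f x /\ forall i, partial i f x = l i.
Proof.
move=> H; pose d (k : 'rV[R]_N) : R^o := \sum_i k 0 i * l i.
have lind : linear d.
  move=> a u w; rewrite /d scaler_sumr -big_split /=; apply: eq_bigr => i _.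
  by rewrite !mxE mulrDl -mulrA.
pose dlM := GRing.isLinear.Build _ _ _ _ _ lind.
pose dL : {linear 'rV[R]_N -> R^o} := HB.pack d dlM.
have dc : continuous dL.
  move=> u; rewrite /= /d.
  apply: (@cvg_sum_fin _ _ (nbhs u) _) => i.
  by apply: cvgM; [exact: coord_continuous|exact: cvg_cst].
have [df dfx] := @differentiable_of_linear _ _ (f : _ -> R^o) _ x dc H.
split=> // i; rewrite /partial deriveE// dfx /= /d (bigD1 i)//= mxE !eqxx mul1r.
by rewrite big1 ?addr0// => j ji; rewrite mxE (negbTE ji) andbF mul0r.
Qed.
End Calculus.

(** * Differentiability of finite order and its closure properties *)

Section CkFunctions.
Context {R : realType} {N : nat}.
Implicit Types (U : set 'rV[R]_N) (f g : 'rV[R]_N -> R) (x : 'rV[R]_N).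

Lemma eq_on_partial (V : normedModType R) U (f g : 'rV[R]_N -> V) i x :
  open U -> U x -> (forall y, U y -> f y = g y) -> partial i f x = partial i g x.
Proof.
move=> oU Ux fg; apply: near_eq_derive.
by apply: filterS fg _; apply: open_nbhs_nbhs.
Qed.

Lemma eq_on_differentiable (V : normedModType R) U (f g : 'rV[R]_N -> V) x :
  open U -> U x -> (forall y, U y -> f y = g y) ->
  differentiable f x -> differentiable g x.
Proof.
move=> oU Ux fg df.
have [] // := @differentiable_of_linear R _ _ g ('d f x) x (diff_continuous df).
move=> e e0.
have /diff_locallyxC/= H := df.
have /nbhs_ballP[d1 /= d10 Ud1] : nbhs x U by apply: open_nbhs_nbhs.
have /eqaddoP/(_ e e0)/nbhs_ballP[d2 /= d20 Hd2] := diff_locally df.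
exists (Num.min d1 d2); first by rewrite lt_min d10.
move=> k; rewrite lt_min => /andP[k1 k2].
rewrite -!fg//; last first.
  by apply: Ud1; rewrite -ball_normE /= opprD addNKr normrN.
have /= := Hd2 k; rewrite -ball_normE /= sub0r normrN => /(_ k2).
by rewrite -[(_ - _) k]/(f (k + x) - (f x + 'd f x k)) opprD addrA (addrC k).
Qed.

Lemma partialD f g i x : differentiable f x -> differentiable g x ->
  partial i (fun y => f y + g y) x = partial i f x + partial i g x.
Proof. by move=> df dg; apply: deriveD; apply: diff_derivable. Qed.

Lemma partialN f i x : differentiable f x ->
  partial i (fun y => - f y) x = - partial i f x.
Proof. by move=> df; apply: deriveN; apply: diff_derivable. Qed.

Lemma partialB f g i x : differentiable f x -> differentiable g x ->
  partial i (fun y => f y - g y) x = partial i f x - partial i g x.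
Proof. by move=> df dg; apply: deriveB; apply: diff_derivable. Qed.

Lemma partialM f g i x : differentiable f x -> differentiable g x ->
  partial i (fun y => f y * g y) x = partial i f x * g x + f x * partial i g x.
Proof.
move=> df dg; rewrite /partial [LHS]deriveM; try exact: diff_derivable.
by rewrite addrC [_ *: 'D_ _ f x]mulrC.
Qed.

Lemma partial_cst (V : normedModType R) (c : V) i x :
  partial i (fun=> c) x = 0.
Proof. exact: derive_cst. Qed.

Lemma partialMl f c i x : differentiable f x ->
  partial i (fun y => c * f y) x = c * partial i f x.
Proof.
by move=> df; rewrite partialM ?partial_cst ?mul0r ?add0r//; apply: differentiable_cst.
Qed.

Lemma partialMr f c i x : differentiable f x ->
  partial i (fun y => f y * c) x = partial i f x * c.
Proof.
by move=> df; rewrite partialM ?partial_cst ?mulr0 ?addr0//; apply: differentiable_cst.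
Qed.

Lemma partialV f i x : differentiable f x -> f x != 0 ->
  partial i (fun y => (f y)^-1) x = - ((f x)^-1 * (f x)^-1) * partial i f x.
Proof.
move=> df fx0; rewrite /partial [LHS]deriveV//; last exact: diff_derivable.
by rewrite expr2 invfM.
Qed.

Lemma differentiable_sum_fin (I : Type) (r : seq I) (P : pred I)
    (F : I -> 'rV[R]_N -> R) x :
  (forall j, P j -> differentiable (F j) x) ->
  differentiable (fun y => \sum_(j <- r | P j) F j y) x.
Proof.
move=> dF; elim: r => [|j r IH].
  rewrite (_ : (fun _ => _) = cst 0); first exact: differentiable_cst.
  by apply/funext => y; rewrite big_nil.
rewrite (_ : (fun _ => _) =
   if P j then (fun y => F j y + \sum_(j <- r | P j) F j y)
   else (fun y => \sum_(j <- r | P j) F j y)); last first.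
  by apply/funext => y; rewrite big_cons; case: ifP.
by case: ifP => // Pj; apply: differentiableD => //; apply: dF.
Qed.

Lemma partial_sum (I : Type) (r : seq I) (P : pred I)
    (F : I -> 'rV[R]_N -> R) i x :
  (forall j, P j -> differentiable (F j) x) ->
  partial i (fun y => \sum_(j <- r | P j) F j y) x =
  \sum_(j <- r | P j) partial i (F j) x.
Proof.
move=> dF; elim: r => [|j r IH].
  rewrite big_nil -[RHS](@partial_cst _ (0 : R) i x); congr (partial i _ x).
  by apply/funext => y; rewrite big_nil.
rewrite (_ : (fun _ => _) =
   if P j then (fun y => F j y + \sum_(j <- r | P j) F j y)
   else (fun y => \sum_(j <- r | P j) F j y)); last first.
  by apply/funext => y; rewrite big_cons; case: ifP.
rewrite big_cons; case: ifP => // Pj.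
by rewrite partialD ?IH//; [exact: dF|exact: differentiable_sum_fin].
Qed.

(** Level 0 already means Frechet differentiable, so every level supplies what the derivative rules
    need. A finite order is what allows bootstrapping: an equation expressing the partials through
    the function itself raises the order by one. *)
Fixpoint Ck (k : nat) U f : Prop :=
  (forall x, U x -> differentiable f x) /\
  (if k is k'.+1 then forall i, Ck k' U (partial i f) else True).

Lemma Ck_diff k U f x : Ck k U f -> U x -> differentiable f x.
Proof. by case: k => [|k] [+ _]; exact. Qed.

Lemma Ck_partial k U f i : Ck k.+1 U f -> Ck k U (partial i f).
Proof. by case=> _; exact. Qed.

Lemma CkW k U f : Ck k.+1 U f -> Ck k U f.
Proof.
elim: k f => [|k IH] f; first by case.
by move=> [df pf]; split=> // i; apply: IH; exact: pf.
Qed.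

Lemma Ck_eq k U f g : open U -> (forall y, U y -> f y = g y) ->
  Ck k U f -> Ck k U g.
Proof.
move=> oU; elim: k f g => [|k IH] f g fg [df pf]; split=> //;
  try (by move=> x Ux; apply: (eq_on_differentiable oU Ux fg); exact: df); move=> i.
by apply: IH (pf i) => y Uy; exact: (eq_on_partial _ oU).
Qed.

Lemma Ck_sub k U U' f : U' `<=` U -> Ck k U f -> Ck k U' f.
Proof.
move=> UU; elim: k f => [|k IH] f [df pf]; split=> //;
  try (by move=> x /UU; exact: df); move=> i.
exact: IH (pf i).
Qed.

Lemma Ck_cst k U (c : R) : Ck k U (fun=> c).
Proof.
elim: k c => [|k IH] c; split=> //;
  try (by move=> x _; exact: differentiable_cst); move=> i.
by rewrite (_ : partial _ _ = fun=> 0)//; apply/funext => x; rewrite partial_cst.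
Qed.

Lemma CkD k U f g : open U -> Ck k U f -> Ck k U g -> Ck k U (fun y => f y + g y).
Proof.
move=> oU; elim: k f g => [|k IH] f g [df pf] [dg pg]; split=> //;
  try (by move=> x Ux; apply: differentiableD; [exact: df|exact: dg]); move=> i.
apply: Ck_eq (IH _ _ (pf i) (pg i)) => // y Uy.
by rewrite partialD//; [exact: df|exact: dg].
Qed.

Lemma CkM k U f g : open U -> Ck k U f -> Ck k U g -> Ck k U (fun y => f y * g y).
Proof.
move=> oU; elim: k f g => [|k IH] f g Cf Cg; split=> //;
  try (by move=> x Ux; apply: differentiableM;
    [exact: Ck_diff Cf _|exact: Ck_diff Cg _]); move=> i.
have C1 := IH _ _ (Ck_partial i Cf) (CkW Cg).
have C2 := IH _ _ (CkW Cf) (Ck_partial i Cg).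
apply: Ck_eq (CkD oU C1 C2) => // y Uy.
by rewrite partialM//; [exact: Ck_diff Cf _|exact: Ck_diff Cg _].
Qed.

Lemma CkN k U f : open U -> Ck k U f -> Ck k U (fun y => - f y).
Proof.
move=> oU Cf; apply: Ck_eq (CkM oU (Ck_cst k U (-1)) Cf) => // y _.
by rewrite mulN1r.
Qed.

Lemma CkB k U f g : open U -> Ck k U f -> Ck k U g -> Ck k U (fun y => f y - g y).
Proof. by move=> oU Cf Cg; apply: CkD => //; apply: CkN. Qed.

Lemma CkV k U f : open U -> (forall x, U x -> f x != 0) ->
  Ck k U f -> Ck k U (fun y => (f y)^-1).
Proof.
move=> oU f0; elim: k f f0 => [|k IH] f f0 Cf; split=> //;
  try (by move=> x Ux; apply: differentiableV;
    [exact: Ck_diff Cf _|exact: f0]); move=> i.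
have Ci := IH _ f0 (CkW Cf).
apply: Ck_eq (CkM oU (CkN oU (CkM oU Ci Ci)) (Ck_partial i Cf)) => // y Uy.
by rewrite partialV//; [exact: Ck_diff Cf _|exact: f0].
Qed.

Lemma Ck_sum k U (I : Type) (r : seq I) (P : pred I) (F : I -> 'rV[R]_N -> R) :
  open U -> (forall j, P j -> Ck k U (F j)) ->
  Ck k U (fun y => \sum_(j <- r | P j) F j y).
Proof.
move=> oU CF; elim: r => [|j r IH].
  by apply: Ck_eq (Ck_cst k U 0) => // y _; rewrite big_nil.
case Pj: (P j).
  by apply: Ck_eq (CkD oU (CF j Pj) IH) => // y _; rewrite big_cons Pj.
by apply: Ck_eq IH => // y _; rewrite big_cons Pj.
Qed.

Lemma Ck_prod k U (I : Type) (r : seq I) (P : pred I) (F : I -> 'rV[R]_N -> R) :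
  open U -> (forall j, P j -> Ck k U (F j)) ->
  Ck k U (fun y => \prod_(j <- r | P j) F j y).
Proof.
move=> oU CF; elim: r => [|j r IH].
  by apply: Ck_eq (Ck_cst k U 1) => // y _; rewrite big_nil.
case Pj: (P j).
  by apply: Ck_eq (CkM oU (CF j Pj) IH) => // y _; rewrite big_cons Pj.
by apply: Ck_eq IH => // y _; rewrite big_cons Pj.
Qed.

Lemma Ck_det k U m (A : 'rV[R]_N -> 'M[R]_m) : open U ->
  (forall i j, Ck k U (fun y => A y i j)) -> Ck k U (fun y => \det (A y)).
Proof.
move=> oU CA; apply: Ck_sum => // s _; apply: CkM => //; first exact: Ck_cst.
by apply: Ck_prod.
Qed.

(** Cramer's rule: an entry of the inverse is a cofactor, polynomial in the entries of [A], times
    the inverse of a nonvanishing determinant. *)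
Lemma Ck_invmx k U m (A : 'rV[R]_N -> 'M[R]_m) i j : open U ->
  (forall y, U y -> A y \in unitmx) ->
  (forall i j, Ck k U (fun y => A y i j)) -> Ck k U (fun y => invmx (A y) i j).
Proof.
move=> oU uA CA.
apply: (@Ck_eq _ _ (fun y => (\det (A y))^-1 * ((-1) ^+ (j + i) *
    \det (row' j (col' i (A y)))))) => //.
  by move=> y Uy; rewrite /invmx (uA y Uy) !mxE.
apply: CkM => //.
  apply: CkV => //; last exact: Ck_det.
  by move=> x /uA; rewrite unitmxE unitfE.
apply: CkM => //; first exact: Ck_cst.
apply: Ck_det => // a b.
by apply: Ck_eq (CA (lift j a) (lift i b)) => // y _; rewrite !mxE.
Qed.

Definition smooth U f := forall k, Ck k U f.

Lemma smooth_diff U f x : smooth U f -> U x -> differentiable f x.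
Proof. by move=> /(_ 0%N); exact: Ck_diff. Qed.

Lemma smooth_partial U f i : smooth U f -> smooth U (partial i f).
Proof. by move=> sf k; exact: Ck_partial (sf k.+1). Qed.

Lemma iter_partial_rcons (V : normedModType R) s i (f : 'rV[R]_N -> V) :
  iter_partial (rcons s i) f = iter_partial s (partial i f).
Proof. by rewrite /iter_partial foldr_rcons. Qed.

(** The list of indices is taken apart from its last element, which is the derivative applied first,
    because that is the one [Ck] peels off. *)
Lemma smooth_onP U f : smooth_on U f <-> smooth U f.
Proof.
split=> [sf k|sf s].
  elim: k f sf => [|k IH] f sf; split=> //; try (by move=> x Ux; exact: (sf [::])); move=> i.
  by apply: IH => s x Ux; rewrite -iter_partial_rcons; exact: sf.
elim/last_ind: s f sf => [|s i IH] f sf x Ux; first exact: smooth_diff sf Ux.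
by rewrite iter_partial_rcons; apply: IH => //; exact: smooth_partial.
Qed.

End CkFunctions.

(** * Vector-valued maps, chain rule and mean value estimates *)

Section VectorValued.
Context {R : realType} {N : nat}.
Implicit Types (U : set 'rV[R]_N) (f : 'rV[R]_N -> R) (x : 'rV[R]_N).

Lemma differentiable_coordP M (phi : 'rV[R]_N -> 'rV[R]_M) x :
  differentiable phi x <-> forall j, differentiable (fun y => phi y 0 j) x.
Proof.
split=> [dphi j|dphi].
  exact: (@differentiable_comp _ _ _ _ phi (fun w : 'rV[R]_M => w 0 j : R^o) x
    dphi (@differentiable_coord R _ _ _ 0 j)).
rewrite (_ : phi = \sum_j (fun y => phi y 0 j *: (delta_mx 0 j : 'rV[R]_M))).
  by apply: differentiable_sum => j; exact: differentiableZl.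
by apply/funext => y; rewrite {1}(row_sum_delta (phi y)) fct_sumE.
Qed.

Lemma partial_coord M (phi : 'rV[R]_N -> 'rV[R]_M) i j x :
  differentiable phi x ->
  (partial i phi x) 0 j = partial i (fun y => phi y 0 j) x.
Proof.
by move=> dphi; rewrite /partial derive_mx ?mxE//; exact: diff_derivable.
Qed.

Lemma smooth_on_diff (V : normedModType R) U (f : 'rV[R]_N -> V) x :
  smooth_on U f -> U x -> differentiable f x.
Proof. by move=> /(_ [::]); exact. Qed.

Lemma smooth_on_partial (V : normedModType R) U (f : 'rV[R]_N -> V) i :
  smooth_on U f -> smooth_on U (partial i f).
Proof. by move=> sf s x Ux; rewrite -iter_partial_rcons; exact: sf. Qed.

Lemma smooth_on_coordP M U (phi : 'rV[R]_N -> 'rV[R]_M) : open U ->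
  smooth_on U phi <-> forall j, smooth U (fun y => phi y 0 j).
Proof.
move=> oU; split=> [sphi j k|sphi s].
  elim: k phi sphi => [|k IH] phi sphi; split=> //;
    try (by move=> x Ux; have /differentiable_coordP := smooth_on_diff sphi Ux; apply);
    move=> i.
  have C := IH _ (smooth_on_partial i sphi).
  apply: (Ck_eq oU _ C) => y Uy.
  by apply: partial_coord; exact: smooth_on_diff Uy.
elim/last_ind: s phi sphi => [|s i IH] phi sphi x Ux.
  by apply/differentiable_coordP => j; exact: smooth_diff (sphi j) Ux.
rewrite iter_partial_rcons; apply: IH => // j k.
apply: Ck_eq (smooth_partial i (sphi j) k) => // y Uy.
rewrite partial_coord//; apply/differentiable_coordP => l.
exact: smooth_diff (sphi l) Uy.
Qed.

Lemma partial_comp M (f : 'rV[R]_M -> R) (phi : 'rV[R]_N -> 'rV[R]_M) i x :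
  differentiable phi x -> differentiable f (phi x) ->
  partial i (f \o phi) x =
  \sum_j partial i (fun y => phi y 0 j) x * partial j f (phi x).
Proof.
move=> dphi df; rewrite /partial deriveE; last exact: differentiable_comp.
rewrite diff_comp//= -(deriveE _ dphi) -(deriveE _ df).
rewrite (derive_partial _ df); apply: eq_bigr => j _.
by rewrite partial_coord.
Qed.

Lemma Ck_comp M k U V (f : 'rV[R]_M -> R) (phi : 'rV[R]_N -> 'rV[R]_M) :
  open U -> (forall x, U x -> V (phi x)) -> Ck k V f ->
  (forall j, Ck k U (fun y => phi y 0 j)) -> Ck k U (f \o phi).
Proof.
move=> oU UV; elim: k f => [|k IH] f Cf Cphi.
  split=> // x Ux; apply: differentiable_comp.
    by apply/differentiable_coordP => j; exact: Ck_diff (Cphi j) Ux.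
  by apply: Ck_diff Cf _; exact: UV.
have dphi x : U x -> differentiable phi x.
  by move=> Ux; apply/differentiable_coordP => j; exact: Ck_diff (Cphi j) Ux.
have df x : U x -> differentiable f (phi x).
  by move=> Ux; apply: Ck_diff Cf _; exact: UV.
split=> [x Ux|i]; first by apply: differentiable_comp; [exact: dphi|exact: df].
apply: (@Ck_eq _ _ _ _ (fun y => \sum_j partial i (fun y => phi y 0 j) y *
    (partial j f \o phi) y)) => // [y Uy|].
  by rewrite partial_comp//; [exact: dphi|exact: df].
apply: Ck_sum => // j _; apply: CkM => //; first exact: Ck_partial.
apply: IH; first exact: Ck_partial.
by move=> l; apply: CkW.
Qed.

Lemma is_derive_segment f x (v : 'rV[R]_N) (t : R) :
  differentiable f (x + t *: v) ->
  is_derive t 1 (fun s => f (x + s *: v))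
    (\sum_i v 0 i * partial i f (x + t *: v)).
Proof.
move=> df.
have dg : is_diff t (fun s : R^o => x + s *: v) (fun s => s *: v).
  have := is_diffD (is_diff_cst x (t : R^o)) (is_diff_scalel t v).
  by rewrite add0r.
have dc : differentiable (fun s : R => f (x + s *: v)) t.
  exact: (@differentiable_comp _ _ _ _ (fun s : R => x + s *: v) f).
apply: DeriveDef; first exact/derivable1_diffP.
rewrite deriveE// -(derive_partial v df) (deriveE v df).
rewrite (@diff_comp _ _ _ _ (fun s : R => x + s *: v) f t)//=.
by rewrite diff_val scale1r.
Qed.

Lemma segment_MVT f x (v : 'rV[R]_N) :
  (forall t : R, 0 <= t <= 1 -> differentiable f (x + t *: v)) ->
  exists2 t : R, 0 <= t <= 1 &
    f (x + v) - f x = \sum_i v 0 i * partial i f (x + t *: v).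
Proof.
move=> df.
have D (t : R) : 0 <= t <= 1 -> is_derive t 1 (fun s => f (x + s *: v))
    (\sum_i v 0 i * partial i f (x + t *: v)).
  by move=> t01; apply: is_derive_segment; exact: df.
have [|||c c01] := @MVT_segment R (fun s => f (x + s *: v))
    (fun t => \sum_i v 0 i * partial i f (x + t *: v)) 0 1.
- exact: ler01.
- by move=> t; rewrite in_itv /= => /andP[t0 t1]; apply: D; rewrite !ltW.
- apply: (@derivable_within_continuous R R^o _ `[0, 1]) => t; rewrite in_itv /= => t01.
  by have [] := D t t01.
rewrite scale1r scale0r addr0 subr0 mulr1 => ->.
by exists c => //; rewrite in_itv /= in c01.
Qed.

Lemma ball_segment (q x v : 'rV[R]_N) (e t : R) :
  ball q e x -> ball q e (x + v) -> 0 <= t <= 1 -> ball q e (x + t *: v).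
Proof.
rewrite -ball_normE /= => xe ve /andP[t0 t1].
have -> : q - (x + t *: v) = (1 - t) *: (q - x) + t *: (q - (x + v)).
  rewrite !scalerBr !scalerDr scalerBl !scale1r scalerBl scale1r.
  by apply/rowP => i; rewrite !mxE; ring.
rewrite (le_lt_trans (ler_normD _ _))// !normrZ !ger0_norm ?subr_ge0//.
have [->|tn0] := eqVneq t 0; first by rewrite subr0 mul0r mul1r addr0.
rewrite [ltRHS](_ : e = (1 - t) * e + t * e); last by ring.
rewrite ler_ltD//; first by rewrite ler_wpM2l ?subr_ge0// ltW.
by rewrite ltr_pM2l// lt_neqAle eq_sym tn0.
Qed.

(** The norm of row vectors is the maximum norm; this is the origin of every factor [N] in the
    constants below. *)
Lemma norm_sum_coord_le (v : 'rV[R]_N) (c : 'I_N -> R) (B : R) :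
  (forall i, `|c i| <= B) -> `|\sum_i v 0 i * c i| <= N%:R * B * `|v|.
Proof.
move=> cB; rewrite (le_trans (ler_norm_sum _ _ _))//.
rewrite (@le_trans _ _ (\sum_(i < N) B * `|v|))//; last first.
  by rewrite sumr_const card_ord -mulrA mulr_natl.
apply: ler_sum => i _; rewrite normrM mulrC ler_pM//; exact: rV_coord_norm.
Qed.

Lemma ball_lipschitz f (q x v : 'rV[R]_N) (e B : R) :
  (forall y, ball q e y -> differentiable f y) ->
  (forall i y, ball q e y -> `|partial i f y| <= B) ->
  ball q e x -> ball q e (x + v) -> `|f (x + v) - f x| <= N%:R * B * `|v|.
Proof.
move=> df fB qx qxv.
have [|t t01 ->] := @segment_MVT f x v.
  by move=> t t01; apply: df; exact: ball_segment.
by apply: norm_sum_coord_le => i; apply: fB; exact: ball_segment.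
Qed.

(** The mean value theorem gives the partials at an intermediate point, and their Lipschitz bound
    pays for moving back to [x]. The constant is not sharp; only the quadratic order matters. *)
Lemma ball_taylor2 f (q x v : 'rV[R]_N) (e B : R) : 0 <= B ->
  Ck 1 (ball q e) f ->
  (forall i j y, ball q e y -> `|partial j (partial i f) y| <= B) ->
  ball q e x -> ball q e (x + v) ->
  `|f (x + v) - f x - \sum_i v 0 i * partial i f x|
    <= N%:R * (N%:R * B) * `|v| ^+ 2.
Proof.
move=> B0 [df pf] fB qx qxv.
have [|t t01 ->] := @segment_MVT f x v.
  by move=> t t01; apply: df; exact: ball_segment.
rewrite -sumrB.
under eq_bigr do rewrite -mulrBr.
apply: (@le_trans _ _ (N%:R * (N%:R * B * `|v|) * `|v|)); last first.
  by rewrite expr2 !mulrA.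
apply: (@norm_sum_coord_le v
  (fun i => partial i f (x + t *: v) - partial i f x)) => i.
have qt : ball q e (x + t *: v) by exact: ball_segment.
apply: le_trans (ball_lipschitz (pf i).1 (fB i) qx qt) _.
rewrite normrZ ler_wpM2l ?mulr_ge0//; case/andP: t01 => t0 t1.
by rewrite ger0_norm// ler_piMl.
Qed.

Lemma partial_shift f (w : 'rV[R]_N) i x :
  partial i (fun y => f (y + w)) x = partial i f (x + w).
Proof.
rewrite /partial /derive.
set d := (fun _ : R => _); set d' := (fun _ : R => _).
by suff -> : d = d' by []; apply/funext => h; rewrite /d /d' /= addrA.
Qed.

Lemma differentiable_shift f (w : 'rV[R]_N) x :
  differentiable f (x + w) -> differentiable (fun y => f (y + w)) x.
Proof.
by move=> df; exact: (@differentiable_comp _ _ _ _ (fun y => y + w) f).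
Qed.

Lemma sum_delta_coord (c : 'I_N -> R) (h : R) a :
  \sum_i (h *: delta_mx 0 a : 'rV[R]_N) 0 i * c i = h * c a.
Proof.
rewrite (bigD1 a)//= !mxE !eqxx mulr1 big1 ?addr0// => i ia.
by rewrite !mxE (negbTE ia) andbF mulr0 mul0r.
Qed.

(** The mean value theorem, applied twice in either order, writes the second difference over a
    square of side [h] as [h * h] times a mixed partial at some point of the square. So the two
    mixed partials take a common value near [x], and both are continuous at [x] because [Ck 2] makes
    them differentiable. *)
Lemma partial_comm f U i j x : open U -> Ck 2 U f -> U x ->
  partial i (partial j f) x = partial j (partial i f) x.
Proof.
move=> oU Cf Ux; apply/eqP; rewrite -subr_eq0 -normr_eq0 eq_le normr_ge0 andbT.
apply/ler_addgt0Pr => e e0; rewrite add0r.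
have e20 : 0 < e / 2 by rewrite divr_gt0.
have cont a b : {for x, continuous (partial a (partial b f))}.
  apply: differentiable_continuous.
  exact: Ck_diff (Ck_partial a (Ck_partial b Cf)) Ux.
have /nbhs_ballP[d /= d0 Hd] : nbhs x (U `&`
    [set y | `|partial i (partial j f) x - partial i (partial j f) y| < e / 2] `&`
    [set y | `|partial j (partial i f) x - partial j (partial i f) y| < e / 2]).
  apply: filterI; first apply: filterI.
  - exact: open_nbhs_nbhs.
  - by have /cvgrPdist_lt/(_ _ e20) := cont i j.
  - by have /cvgrPdist_lt/(_ _ e20) := cont j i.
(* A point of the square is reached by two displacements of norm at most [h], hence the condition
   [h + h < d]. *)
have [h h0 hh] : exists2 h : R, 0 < h & h + h < d by exists (d / 4); lra.
have near_x a b (s t : R) : 0 <= s <= 1 -> 0 <= t <= 1 ->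
    ball x d (x + (s * h) *: delta_mx 0 a + (t * h) *: delta_mx 0 b).
  move=> /andP[s0 s1] /andP[t0 t1].
  rewrite -ball_normE /= -addrA opprD addNKr normrN.
  rewrite (le_lt_trans (ler_normD _ _))//.
  apply: le_lt_trans hh.
  have hd (r : R) c : 0 <= r -> r <= 1 -> `|r * h| * `|delta_mx 0 c : 'rV[R]_N| <= h.
    move=> r0 r1; rewrite ger0_norm; last by rewrite mulr_ge0// ltW.
    rewrite -[leRHS]mulr1; apply: ler_pM => //.
    - by rewrite mulr_ge0// ltW.
    - by rewrite ler_piMl// ltW.
    - exact: norm_delta_le.
  by apply: lerD; rewrite normrZ; apply: hd.
(* The second difference of f is symmetric in the two directions. *)
have key : forall ia ib : 'I_N, exists s t : R, [/\ 0 <= s <= 1, 0 <= t <= 1 &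
    f (x + h *: delta_mx 0 ia + h *: delta_mx 0 ib) - f (x + h *: delta_mx 0 ia)
    - (f (x + h *: delta_mx 0 ib) - f x) = h * (h * partial ib (partial ia f)
      (x + (s * h) *: delta_mx 0 ia + (t * h) *: delta_mx 0 ib))].
  move=> ia ib.
  pose w : 'rV[R]_N := h *: delta_mx 0 ib.
  have UN (s t : R) : 0 <= s <= 1 -> 0 <= t <= 1 ->
      U (x + s *: (h *: delta_mx 0 ia) + t *: w).
    by move=> s01 t01; rewrite !scalerA; have [[]] := Hd _ (near_x ia ib _ _ s01 t01).
  have i01 : 0 <= (1 : R) <= 1 by rewrite ler01 lexx.
  have i00 : 0 <= (0 : R) <= 1 by rewrite lexx ler01.
  have dfU (s t : R) : 0 <= s <= 1 -> 0 <= t <= 1 ->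
      differentiable f (x + s *: (h *: delta_mx 0 ia) + t *: w).
    by move=> s01 t01; apply: Ck_diff Cf _; exact: UN.
  have d1 (s : R) : 0 <= s <= 1 -> differentiable f (x + s *: (h *: delta_mx 0 ia) + w).
    by move=> s01; have := dfU s 1 s01 i01; rewrite scale1r.
  have d0' (s : R) : 0 <= s <= 1 -> differentiable f (x + s *: (h *: delta_mx 0 ia)).
    by move=> s01; have := dfU s 0 s01 i00; rewrite scale0r addr0.
  have [|s s01] := @segment_MVT (fun y => f (y + w) - f y) x (h *: delta_mx 0 ia).
    move=> s s01; apply: differentiableB; last exact: d0'.
    by apply: differentiable_shift; exact: d1.
  rewrite sum_delta_coord partialB; last 2 first.
  - by apply: differentiable_shift; exact: d1.
  - exact: d0'.
  rewrite partial_shift.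
  have [|t t01] := @segment_MVT (partial ia f) (x + s *: (h *: delta_mx 0 ia)) w.
    by move=> t t01; apply: (Ck_diff (Ck_partial ia Cf)); exact: UN.
  rewrite /w sum_delta_coord => Et Es; exists s, t; split=> //.
  by rewrite Es Et !scalerA.
have [s1 [t1 [s101 t101 E1]]] := key i j.
have [s2 [t2 [s201 t201 E2]]] := key j i.
have [[_ _] H1] := Hd _ (near_x i j _ _ s101 t101).
have [[_ H2] _] := Hd _ (near_x j i _ _ s201 t201).
have E : partial j (partial i f) (x + (s1 * h) *: delta_mx 0 i + (t1 * h) *: delta_mx 0 j)
    = partial i (partial j f) (x + (s2 * h) *: delta_mx 0 j + (t2 * h) *: delta_mx 0 i).
  apply: (mulfI (lt0r_neq0 h0)); apply: (mulfI (lt0r_neq0 h0)).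
  apply: (etrans (esym E1)); apply: (etrans _ E2).
  rewrite (addrAC x (h *: delta_mx 0 j)).
  move: (f (x + _ + _)) (f (x + h *: delta_mx 0 i)) (f (x + h *: delta_mx 0 j)) (f x).
  by move=> A B C D; ring.
apply: le_trans (ler_distD (partial i (partial j f)
  (x + (s2 * h) *: delta_mx 0 j + (t2 * h) *: delta_mx 0 i)) _ _) _.
rewrite [leRHS]splitr; apply: lerD; apply: ltW; first exact: H2.
by rewrite -E distrC; exact: H1.
Qed.
End VectorValued.

(** * Linear differential equations *)

Section LinearODE.
Context {R : realType}.

Lemma geometric_small (B e : R) : 0 < e -> exists n, B / 2 ^+ n < e.
Proof.
move=> e0; have [n Bn] : exists n, B / e < n%:R.
  exists (Num.bound `|B / e|); exact: le_lt_trans (ler_norm _) (archi_boundP (normr_ge0 _)).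
exists n; rewrite ltr_pdivrMr ?exprn_gt0// mulrC -ltr_pdivrMr//.
by rewrite (lt_trans Bn)// -natrX ltr_nat ltn_expl.
Qed.

Lemma le_of_geometric (x c B : R) : (forall n, x <= c + B / 2 ^+ n) -> x <= c.
Proof.
move=> H; apply/ler_addgt0Pr => e e0.
have [n Bn] := geometric_small B e0.
by apply: le_trans (H n) _; rewrite lerD2l ltW.
Qed.

(** The tail of the series from rank [n] is at most [d n = 2 * K / 2 ^+ n], so the intervals of
    center [S n] and radius [d n] are nested. The supremum of their left ends lies in all of them,
    which yields the limit together with its rate. *)
Lemma geometric_limit (S : nat -> R) (K : R) :
  (forall n, `|S n.+1 - S n| <= K / 2 ^+ n) ->
  exists y, forall n, `|S n - y| <= 2 * K / 2 ^+ n.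
Proof.
move=> HS; pose d n : R := 2 * K / 2 ^+ n.
have dS n : d n.+1 = K / 2 ^+ n.
  by rewrite /d exprS invfM; field; rewrite expf_neq0.
have dD n : d n = K / 2 ^+ n + d n.+1 by rewrite dS /d; field; rewrite expf_neq0.
have K0 : 0 <= K by have := HS 0%N; rewrite expr0 divr1; exact: le_trans.
have d0 n : 0 <= d n by rewrite /d divr_ge0 ?mulr_ge0.
have lo n m : S n - d n <= S (n + m)%N - d (n + m)%N.
  elim: m => [|m IH]; first by rewrite addn0.
  apply: le_trans IH _; rewrite addnS; have := HS (n + m)%N; rewrite ler_norml dD.
  by move=> /andP[+ _]; lra.
have hi n m : S (n + m)%N + d (n + m)%N <= S n + d n.
  elim: m => [|m IH]; first by rewrite addn0.
  apply: le_trans _ IH; rewrite addnS; have := HS (n + m)%N; rewrite ler_norml (dD (n + m)%N).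
  by move=> /andP[_ +]; lra.
have lohi n m : S n - d n <= S m + d m.
  case: (leqP n m) => nm.
    by apply: le_trans (lo n (m - n)%N) _; rewrite subnKC//; have := d0 m; lra.
  apply: le_trans (hi m (n - m)%N); rewrite subnKC; last exact: ltnW.
  by have := d0 n; lra.
pose A := range (fun n => S n - d n).
have supA : has_sup A.
  split; first by exists (S 0%N - d 0%N), 0%N.
  by exists (S 0%N + d 0%N) => _ [n _ <-].
exists (sup A) => n; rewrite ler_norml; apply/andP; split.
  have : sup A <= S n + d n by apply: sup_le_ub; [exact: supA.1|move=> _ [m _ <-]].
  by rewrite -/(d n); lra.
have : S n - d n <= sup A by apply: (ub_le_sup supA.2); exists n.
by rewrite -/(d n); lra.
Qed.

Lemma deriv_bound (F dF : R -> R) (r B : R) :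
  (forall t : R, 0 <= t <= r -> is_derive t 1 F (dF t)) ->
  (forall t : R, 0 <= t <= r -> `|dF t| <= B) ->
  forall t : R, 0 <= t <= r -> `|F t - F 0| <= B * t.
Proof.
move=> FdF dFB t /andP[t0 tr].
have H (s : R) : s \in `[0, t] -> 0 <= s <= r.
  by rewrite in_itv /= => /andP[-> st]; exact: le_trans tr.
have [|||c ct ->] := @MVT_segment R F dF 0 t.
- exact: t0.
- by move=> s st; apply/FdF/H; apply: subset_itv_oo_cc.
- apply: (@derivable_within_continuous R R^o _ `[0, t]) => s st.
  by have [] := FdF _ (H _ st).
by rewrite subr0 normrM (ger0_norm t0) ler_wpM2r// dFB// H.
Qed.

Lemma deriv_bound_sym (F dF : R -> R) (r B : R) :
  (forall t : R, - r <= t <= r -> is_derive t 1 F (dF t)) ->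
  (forall t : R, - r <= t <= r -> `|dF t| <= B) ->
  forall t : R, - r <= t <= r -> `|F t - F 0| <= B * `|t|.
Proof.
move=> FdF dFB t tr; case: (leP 0 t) => t0.
  rewrite (ger0_norm t0); apply: (@deriv_bound F dF r) => //; last lra.
  - by move=> s sr; apply: FdF; lra.
  - by move=> s sr; apply: dFB; lra.
rewrite (ltr0_norm t0) -[X in F X]opprK -[X in _ - F X]oppr0.
apply: (@deriv_bound (fun u => F (- u)) (fun u => - dF (- u)) r); last lra.
- move=> u ur; have dFu : is_derive (- u) 1 F (dF (- u)) by apply: FdF; lra.
  have := is_derive1_comp dFu (is_deriveNid u 1).
  by rewrite mulrN1.
- by move=> u ur; rewrite normrN; apply: dFB; lra.
Qed.

(* Clamped coefficients are continuous and bounded on all of R, which removes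
   every domain condition from the Picard iteration. *)
Definition clamp (t : R) := Num.max (- 2) (Num.min 2 t).

Lemma clamp_continuous : continuous clamp.
Proof.
move=> t; apply: (@continuous_max R R (cst (- 2)) (fun t => Num.min 2 t)).
  exact: cvg_cst.
by apply: (@continuous_min R R (cst 2) id); [exact: cvg_cst|exact: cvg_id].
Qed.

Lemma clamp_bounds t : - 2 <= clamp t <= 2.
Proof. by rewrite /clamp le_max lexx ge_max ge_min lexx andbT; lra. Qed.

Lemma clamp_id t : - 2 <= t <= 2 -> clamp t = t.
Proof. by move=> /andP[h1 h2]; rewrite /clamp min_r// max_r. Qed.

(** An integral composed with [clamp]: clamping freezes the primitive outside [[-2, 2]], which makes
    it continuous and bounded on the whole line and leaves its derivative intact on the open
    interval. *)
Lemma antiderivative (f : R -> R) : continuous f ->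
  exists F : R -> R, [/\ continuous F, F 0 = 0,
    forall t : R, - 2 < t < 2 -> is_derive t 1 F (f t) &
    forall B, (forall t, `|f t| <= B) -> forall t, `|F t| <= 2 * B].
Proof.
move=> cf.
(* The base point -3 and the range up to 3 make the endpoints -2 and 2, which [clamp] attains,
   interior points. *)
pose G x := (\int[lebesgue_measure]_(t in `[(- 3), x]) (f t))%R.
have dG (x : R) : - 3 < x < 3 -> is_derive x 1 G (f x).
  move=> /andP[x1 x2].
  have [|dGx GE] := @continuous_FTC1_closed R f (- 3) x 3 x2 _ x1 (cf x).
    apply: continuous_compact_integrable; first exact: segment_compact.
    by apply: continuous_subspaceT.
  apply: DeriveDef; first exact: dGx.
  by rewrite -derive1E; exact: GE.
pose F t := G (clamp t) - G 0.
have F0 : F 0 = 0 by rewrite /F clamp_id ?subrr//; lra.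
have dF (t : R) : - 2 < t < 2 -> is_derive t 1 F (f t).
  move=> t2; have t3 : - 3 < t < 3 by lra.
  apply: (@near_eq_is_derive _ _ _ (fun t => G t - G 0)).
    have : nbhs t `]- 2, 2[%classic by apply: near_in_itvoo; rewrite in_itv.
    apply: filterS => s /=; rewrite in_itv /= => s2.
    by rewrite /F clamp_id//; lra.
  rewrite -[f t]subr0; have := dG t t3 => ?; exact: is_deriveB.
exists F; split=> //.
  move=> t; apply: cvgB; last exact: cvg_cst.
  apply: (@continuous_comp _ _ _ clamp G); first exact: clamp_continuous.
  have [|dGt _] := dG (clamp t); first by have := clamp_bounds t; lra.
  by apply: differentiable_continuous; apply/derivable1_diffP.
move=> B fB t.
have B0 : 0 <= B by apply: le_trans (fB 0).
have dGb : `|F t| <= B * `|clamp t|.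
  apply: (@deriv_bound_sym G f 2) => // [s s2|]; last exact: clamp_bounds.
  by apply: dG; lra.
apply: le_trans dGb _; rewrite mulrC ler_wpM2r//.
by rewrite ler_norml clamp_bounds.
Qed.


Lemma continuous_lincomb (T : finType) (M y : T -> R -> R) :
  (forall b, continuous (M b)) -> (forall b, continuous (y b)) ->
  continuous (fun t => \sum_b M b t * y b t).
Proof.
move=> cM cy t.
apply: (@cvg_sum_fin _ _ _ (nbhs t) _ (fun b t => M b t * y b t)) => b.
by apply: cvgM; [exact: cM|exact: cy].
Qed.

Lemma lincomb_le (T : finType) (M y : T -> R) (m K : R) :
  \sum_b `|M b| <= m -> (forall b, `|y b| <= K) -> 0 <= K ->
  `|\sum_b M b * y b| <= m * K.
Proof.
move=> Mm yK K0; apply: le_trans (ler_norm_sum _ _ _) _.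
apply: le_trans (_ : \sum_b `|M b| * K <= _); last first.
  by rewrite -mulr_suml ler_wpM2r.
by apply: ler_sum => b _; rewrite normrM ler_wpM2l.
Qed.

(* Row sums at most 1/4 make the Picard operator 1/2-contracting on ]-2, 2[. *)
Section Picard.
Variables (T : finType) (M : T -> T -> R -> R) (y0 : T -> R) (K : R).
Hypothesis cM : forall a b, continuous (M a b).
Hypothesis bM : forall a t, \sum_b `|M a b t| <= 4^-1.
Hypothesis y0K : forall a, `|y0 a| <= K.

Local Definition primitive (f : R -> R) : R -> R :=
  get [set F | [/\ continuous F, F 0 = 0,
    forall t : R, - 2 < t < 2 -> is_derive t 1 F (f t) &
    forall B, (forall t, `|f t| <= B) -> forall t, `|F t| <= 2 * B]].

Local Lemma primitiveP f : continuous f ->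
  [/\ continuous (primitive f), primitive f 0 = 0,
    forall t : R, - 2 < t < 2 -> is_derive t 1 (primitive f) (f t) &
    forall B, (forall t, `|f t| <= B) -> forall t, `|primitive f t| <= 2 * B].
Proof. by move=> /antiderivative H; exact: (getPex H). Qed.

Local Definition apply_M (y : T -> R -> R) a t := \sum_b M a b t * y b t.

(** These are the terms of the Neumann series and not the successive approximations: only the zeroth
    one carries the initial value. The approximations are the partial sums [picard_sum]. *)
Local Definition picard n : T -> R -> R := iter n (fun y a => primitive (apply_M y a))
  (fun a => cst (y0 a)).

Local Lemma picardS n a : picard n.+1 a = primitive (apply_M (picard n) a).
Proof. by []. Qed.

Local Lemma picard_continuous n a : continuous (picard n a).
Proof.
elim: n a => [|n IH] a; first by move=> t; exact: cvg_cst.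
by rewrite picardS; have [] := primitiveP (@continuous_lincomb _ _ _ (fun b => @cM a b) IH).
Qed.

Local Lemma apply_M_continuous y a : (forall b, continuous (y b)) ->
  continuous (apply_M y a).
Proof. by move=> cy; apply: continuous_lincomb => // b; exact: cM. Qed.

Local Lemma picard_bound n a t : `|picard n a t| <= K / 2 ^+ n.
Proof.
elim: n a t => [|n IH] a t; first by rewrite expr0 divr1; exact: y0K.
rewrite picardS.
have [_ _ _ H] := primitiveP (apply_M_continuous (a := a) (@picard_continuous n)).
have K0 : 0 <= K / 2 ^+ n by apply: le_trans (IH a t).
have -> : K / 2 ^+ n.+1 = 2 * (4^-1 * (K / 2 ^+ n)).
  by rewrite exprS; field; rewrite expf_neq0.
by apply: H => s; apply: lincomb_le.
Qed.

Local Definition picard_sum n a t := \sum_(k < n) picard k a t.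

Local Lemma picard_sum_continuous n a : continuous (picard_sum n a).
Proof.
move=> t.
by apply: (@cvg_sum_fin _ _ _ (nbhs t) _ (fun k : 'I_n => picard k a)) => k;
  exact: picard_continuous.
Qed.

Lemma linear_ode : exists y : T -> R -> R,
  [/\ forall a, y a 0 = y0 a,
    forall a (t : R), - 2 < t < 2 ->
      is_derive t 1 (y a) (\sum_b M a b t * y b t) &
    forall a t, - 2 < t < 2 -> `|y a t| <= 2 * K].
Proof.
have limS a t : exists l, forall n, `|picard_sum n a t - l| <= 2 * K / 2 ^+ n.
  apply: geometric_limit => n; rewrite /picard_sum big_ord_recr /= addrAC subrr.
  by rewrite add0r; exact: picard_bound.
pose y a t := get [set l | forall n, `|picard_sum n a t - l| <= 2 * K / 2 ^+ n].
have yP a t n : `|picard_sum n a t - y a t| <= 2 * K / 2 ^+ n.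
  by have := getPex (limS a t); apply.
have cy a : continuous (y a).
  move=> t; apply/cvgrPdist_lt => e e0.
  have [n Kn] := geometric_small (2 * K) (divr_gt0 e0 (ltr0Sn _ 2)).
  have /cvgrPdist_lt/(_ _ (divr_gt0 e0 (ltr0Sn _ 2))) := @picard_sum_continuous n a t.
  apply: filterS => s Hs.
  have h1 := yP a t n; have h2 := yP a s n.
  have -> : y a t - y a s = (picard_sum n a t - picard_sum n a s) -
    (picard_sum n a t - y a t) + (picard_sum n a s - y a s) by ring.
  rewrite (le_lt_trans (ler_normD _ _))// [ltRHS](_ : e = e / 3 + e / 3 + e / 3).
    rewrite ltrD// ?(le_lt_trans h2)//.
    rewrite (le_lt_trans (ler_normB _ _))// ltrD//.
    by rewrite (le_lt_trans h1).
  by field.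
pose F a := primitive (apply_M y a).
have PF a := primitiveP (apply_M_continuous (a := a) cy).
(* The integral equation is obtained without exchanging limit and integral:
   [picard_sum n.+1 a - F a] equals [y0 a] at 0, and its derivative is [M] applied to
   [picard_sum n - y], which is geometrically small. *)
have cauchy_eq a t : - 2 < t < 2 -> y a t = y0 a + F a t.
  move=> t2; have [_ F0 dF _] := PF a.
  have dS n (s : R) : - 2 < s < 2 ->
      is_derive s 1 (picard_sum n.+1 a) (apply_M (picard_sum n) a s).
    move=> s2; have -> : picard_sum n.+1 a =
        cst (y0 a) + \sum_(k < n) picard k.+1 a.
      apply/funext => u; rewrite /picard_sum big_ord_recl /=.
      by rewrite -[RHS]/(_ + (\sum_(k < n) picard k.+1 a) u) fct_sumE.
    have dk (k : 'I_n) : is_derive s 1 (picard k.+1 a) (apply_M (picard k) a s).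
      have [_ _ + _] := primitiveP
        (apply_M_continuous (a := a) (@picard_continuous k)).
      exact.
    have -> : apply_M (picard_sum n) a s = 0 + \sum_(k < n) apply_M (picard k) a s.
      rewrite add0r exchange_big /=; apply: eq_bigr => b _.
      by rewrite /picard_sum mulr_sumr.
    by apply: is_deriveD; exact: is_derive_sum.
  have D n : `|picard_sum n.+1 a t - F a t - y0 a| <= 4^-1 * (2 * K / 2 ^+ n) * `|t|.
    have tr : - `|t| <= t <= `|t| by rewrite -ler_norml.
    have t2' : `|t| < 2 by rewrite ltr_norml.
    have := @deriv_bound_sym (fun s => picard_sum n.+1 a s - F a s)
      (fun s => apply_M (picard_sum n) a s - apply_M y a s) `|t| (4^-1 * (2 * K / 2 ^+ n))
      _ _ t tr.
    have -> : picard_sum n.+1 a 0 - F a 0 = y0 a.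
      rewrite [F a 0]F0 subr0 /picard_sum big_ord_recl /= big1 ?addr0// => k _.
      have [_ P0 _ _] := primitiveP
        (apply_M_continuous (a := a) (@picard_continuous k)).
      exact: P0.
    apply=> s sr.
      have s2 : - 2 < s < 2 by lra.
      have := dS n s s2; have := dF s s2 => ? ?; exact: is_deriveB.
    rewrite /apply_M -sumrB (eq_bigr (fun b => M a b s * (picard_sum n b s - y b s))).
      apply: (@lincomb_le _ (fun b => M a b s) (fun b => picard_sum n b s - y b s)).
      - exact: bM.
      - by move=> b; exact: yP.
      - exact: le_trans (yP a s n).
    by move=> b _; rewrite mulrBr.
  apply/eqP; rewrite -subr_eq0 -normr_le0.
  apply: (@le_of_geometric _ 0 (2 * K)) => n; rewrite add0r.
  have K0 : 0 <= 2 * K / 2 ^+ n by apply: le_trans (yP a t n).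
  have -> : y a t - (y0 a + F a t) = (picard_sum n.+1 a t - F a t - y0 a) -
    (picard_sum n.+1 a t - y a t) by ring.
  apply: le_trans (ler_normB _ _) _.
  apply: le_trans (lerD (D n) (yP a t n.+1)) _.
  have -> : 2 * K / 2 ^+ n.+1 = 2 * K / 2 ^+ n / 2.
    by rewrite exprS; field; rewrite expf_neq0.
  have : `|t| <= 2 by rewrite ltW// ltr_norml.
  move: K0; move: (2 * K / 2 ^+ n) `|t| => x u; nra.
(* The witness agrees with the limit [y] on []-2, 2[], but the derivative of [F] is known by
   construction, whereas [y] is only a pointwise limit. *)
exists (fun a t => y0 a + F a t); split=> [a|a t t2|a t t2].
- by have [_ F0 _ _] := PF a; rewrite [F a 0]F0 addr0.
- have [_ _ dF _] := PF a.
  rewrite (eq_bigr (fun b => M a b t * y b t)); last first.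
    by move=> b _; rewrite cauchy_eq.
  rewrite -[X in is_derive _ _ _ X]add0r; have := dF t t2 => ?.
  exact: is_deriveD.
- rewrite -cauchy_eq// -normrN -sub0r; have := yP a t 0%N.
  by rewrite /picard_sum big_ord0 expr0 divr1.
Qed.
End Picard.

End LinearODE.

(** * Gronwall estimate and the algebra of the transport *)

Section Gronwall.
Context {R : realType}.

Lemma is_derive_bigsum (I : Type) (r : seq I) (f : I -> R -> R) (df : I -> R) (t : R) :
  (forall i, is_derive t 1 (f i) (df i)) ->
  is_derive t 1 (fun s => \sum_(i <- r) f i s) (\sum_(i <- r) df i).
Proof.
move=> H; elim: r => [|i r IH].
  rewrite big_nil (_ : (fun _ => _) = cst 0); first exact: is_derive_cst.
  by apply/funext => s; rewrite big_nil.
rewrite big_cons (_ : (fun _ => _) = f i + (fun s => \sum_(i <- r) f i s)).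
  by have := H i => ?; exact: is_deriveD.
by apply/funext => s; rewrite big_cons.
Qed.

Lemma is_derive_mul (f g : R -> R) (df dg t : R) :
  is_derive t 1 f df -> is_derive t 1 g dg ->
  is_derive t 1 (fun s => f s * g s) (df * g t + f t * dg).
Proof.
move=> Hf Hg; have := @is_deriveM _ _ f g t 1 df dg Hf Hg.
by rewrite addrC [_ *: df]mulrC.
Qed.

(** If [|w| <= 2 * C + D] on [[0, 1]], then the derivative is at most [3 / 2 * C + D / 4], and
    integrating from 0 improves the bound to [2 * C + D / 2]. Starting from the a priori bound [B],
    the excess is halved for ever. *)
Lemma small_gronwall (T : finType) (w dw : T -> R -> R) (B C : R) : 0 <= C ->
  (forall a, w a 0 = 0) ->
  (forall a (t : R), 0 <= t <= 1 -> is_derive t 1 (w a) (dw a t)) ->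
  (forall a t, 0 <= t <= 1 -> `|w a t| <= B) ->
  (forall t D, 0 <= t <= 1 -> 0 <= D -> (forall b, `|w b t| <= D) ->
     forall a, `|dw a t| <= 4^-1 * D + C) ->
  forall a t, 0 <= t <= 1 -> `|w a t| <= 2 * C.
Proof.
move=> C0 w0 wdw wB dwC a t t01.
have B0 : 0 <= B by apply: le_trans (wB a t t01).
apply: (@le_of_geometric _ _ _ B) => n.
elim: n a t t01 => [|n IH] a t t01.
  by rewrite expr0 divr1 (le_trans (wB a t t01))// lerDr mulr_ge0.
have D0 : 0 <= B / 2 ^+ n by rewrite divr_ge0.
have := @deriv_bound _ (w a) (dw a) 1 (4^-1 * (2 * C + B / 2 ^+ n) + C) (wdw a) _ t t01.
rewrite w0 subr0 => H; apply: le_trans (H _) _ => {H}.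
  by move=> s s01; apply: dwC => //; [lra|move=> b; exact: IH].
have -> : B / 2 ^+ n.+1 = B / 2 ^+ n / 2 by rewrite exprS; field; rewrite expf_neq0.
move: D0 t01; move: (B / _) => x x0; clear -C0 x0 => /andP[t0 t1].
have : 0 <= (4^-1 * (2 * C + x) + C) * (1 - t) by apply: mulr_ge0; lra.
nra.
Qed.

(** [M] and [M'] are the coefficients along two neighbouring rays, [P] those of the displacement,
    [dP] the derivative of [P] along the ray and [Q] that of the ray coefficients along the
    displacement. Flatness trades [dP + P M] for [Q + M P]; the right side is then [M'] applied to
    the defect plus terms of second order. *)
Lemma transport_identity (T : finType) (M M' P dP Q : T -> T -> R) (y z : T -> R)
    (t : R) (a : T) :
  (forall b, dP a b - Q a b + \sum_d (P a d * M d b - M a d * P d b) = 0) ->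
  \sum_b M' a b * z b - \sum_b M a b * y b -
  (\sum_b P a b * y b + t * \sum_b (dP a b * y b + P a b * \sum_d M b d * y d)) =
  \sum_b M' a b * (z b - y b - t * \sum_d P b d * y d) +
  \sum_b (M' a b - M a b - P a b - t * Q a b) * y b +
  t * \sum_b (M' a b - M a b) * \sum_d P b d * y d.
Proof.
move=> flat.
have -> : \sum_b (dP a b * y b + P a b * \sum_d M b d * y d) =
    \sum_b (Q a b * y b + M a b * \sum_d P b d * y d).
  apply/eqP; rewrite -subr_eq0 -sumrB.
  rewrite (eq_bigr (fun b => (dP a b - Q a b) * y b +
    \sum_d (P a b * M b d - M a b * P b d) * y d)); last first.
    move=> b _; rewrite !mulr_sumr.
    have -> : \sum_d (P a b * M b d - M a b * P b d) * y d =
        \sum_d P a b * (M b d * y d) - \sum_d M a b * (P b d * y d).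
      by rewrite -sumrB; apply: eq_bigr => d _; ring.
    ring.
  rewrite big_split /= exchange_big /= -big_split /= big1// => b _.
  by rewrite -mulr_suml -mulrDl flat mul0r.
rewrite [t * \sum_b (Q a b * _ + _)]mulr_sumr [t * \sum_b ((M' a b - _) * _)]mulr_sumr.
by rewrite -big_split -!sumrB -!big_split /=; apply: eq_bigr => b _; ring.
Qed.

End Gronwall.

(** * Linear total differential systems *)

Section RadialTransport.
Context {R : realType} {N : nat} {T : finType}.
Variables (q : 'rV[R]_N) (e B : R) (c : 'I_N -> T -> T -> 'rV[R]_N -> R).
(** Rays have direction of norm below [e] and are followed for [|t| <= 2], the range of [clamp],
    hence stay in the ball of radius [3 * e]. *)
Let V := ball q (3 * e).
Hypotheses (e0 : 0 < e) (B0 : 0 <= B).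
Hypothesis c_smooth : forall i a b, smooth V (c i a b).
Hypothesis c_le : forall i a b y, V y -> `|c i a b y| <= B.
Hypothesis dc_le : forall i j a b y, V y -> `|partial j (c i a b) y| <= B.
Hypothesis ddc_le : forall i j l a b y, V y ->
  `|partial l (partial j (c i a b)) y| <= B.
Hypothesis small : #|T|%:R * (N%:R * B * e) <= 4^-1.
Hypothesis flat : forall i j a b x, V x ->
  partial i (c j a b) x - partial j (c i a b) x
  + \sum_d (c j a d x * c i d b x - c i a d x * c j d b x) = 0.

Local Definition coef (h : 'rV[R]_N) a b x : R := \sum_i h 0 i * c i a b x.

Local Lemma in_V (h : 'rV[R]_N) (t : R) : `|h| < e -> `|t| <= 2 -> V (q + t *: h).
Proof.
move=> he t2; rewrite /V -ball_normE /= opprD addNKr normrN normrZ.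
apply: le_lt_trans (ler_wpM2r (normr_ge0 h) t2) _.
apply: (@lt_trans _ _ (2 * e)); first by rewrite ltr_pM2l.
by rewrite ltr_pM2r// ltr_nat.
Qed.

Local Lemma coef_le h a b x : V x -> `|coef h a b x| <= N%:R * B * `|h|.
Proof. by move=> Vx; apply: norm_sum_coord_le => i; exact: c_le. Qed.

Local Lemma coef_row_le h a x : `|h| < e -> V x -> \sum_b `|coef h a b x| <= 4^-1.
Proof.
move=> he Vx; apply: le_trans small.
apply: (@le_trans _ _ (\sum_(b : T) N%:R * B * e)).
  apply: ler_sum => b _; apply: le_trans (coef_le h a b Vx) _.
  by rewrite ler_wpM2l ?mulr_ge0// ltW.
by rewrite sumr_const [leRHS]mulr_natl.
Qed.

Lemma radial_solution (y0 : T -> R) (K : R) : (forall a, `|y0 a| <= K) ->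
  forall h : 'rV[R]_N, `|h| < e -> exists y : T -> R -> R,
  [/\ forall a, y a 0 = y0 a,
    forall a (t : R), 0 <= t <= 1 ->
      is_derive t 1 (y a) (\sum_b coef h a b (q + t *: h) * y b t) &
    forall a t, 0 <= t <= 1 -> `|y a t| <= 2 * K].
Proof.
move=> y0K h he.
have Vcl t : V (q + clamp t *: h).
  by apply: in_V => //; rewrite ler_norml; exact: clamp_bounds.
have [|a t||y [y_0 dy yK]] :=
    @linear_ode R T (fun a b t => coef h a b (q + clamp t *: h)) y0 K.
- move=> a b t.
  apply: (@cvg_sum_fin _ _ _ (nbhs t) _ (fun i t => h 0 i * c i a b (q + clamp t *: h))) => i.
  apply: cvgM; first exact: cvg_cst.
  apply: (@continuous_comp _ _ _ (fun t => q + clamp t *: h) (c i a b)).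
    apply: cvgD; first exact: cvg_cst.
    by apply: cvgZr_tmp; exact: clamp_continuous.
  by apply: differentiable_continuous; exact: smooth_diff (c_smooth i a b) (Vcl t).
- exact: coef_row_le.
- exact: y0K.
exists y; split=> // [a t t01|a t t01].
  have t2 : - 2 < t < 2 by lra.
  by have := dy a t t2; rewrite clamp_id//; lra.
by apply: yK; lra.
Qed.

Local Lemma sum_card_le (A y : T -> R) (u v : R) :
  (forall b, `|A b| <= u) -> (forall b, `|y b| <= v) ->
  `|\sum_b A b * y b| <= #|T|%:R * (u * v).
Proof.
move=> Au yv; apply: le_trans (ler_norm_sum _ _ _) _.
apply: (@le_trans _ _ (\sum_(b : T) u * v)).
  by apply: ler_sum => b _; rewrite normrM ler_pM.
by rewrite sumr_const [leRHS]mulr_natl.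
Qed.

(** [C1] bounds the second-order error of the ray coefficients and [C2] their first-order variation.
    In each, the summand with [e] comes from the moved base point paired with [h], the other from
    the extra direction [k]. *)
Let C1 := N%:R * (N%:R * (N%:R * B)) * e + N%:R * (N%:R * B).
Let C2 := N%:R * (N%:R * B) * e + N%:R * B.

Section Increment.
Variables (h k : 'rV[R]_N) (t : R).
Hypotheses (he : `|h| < e) (hke : `|h + k| < e) (t01 : 0 <= t <= 1).
Let x := q + t *: h.
Let x' := q + t *: (h + k).

Let t2 : `|t| <= 2. Proof. by rewrite ler_norml; move: t01; lra. Qed.
Let Vx : V x. Proof. exact: in_V. Qed.
Let Vx' : V x'. Proof. exact: in_V. Qed.
Let x'E : x' = x + t *: k. Proof. by rewrite /x' /x scalerDr addrA. Qed.
Let tk : `|t *: k| <= `|k|.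
Proof. by rewrite normrZ; case/andP: t01 => ? ?; rewrite ger0_norm// ler_piMl. Qed.
Let Vx'' : V (x + t *: k). Proof. by rewrite -x'E. Qed.

Let dc1 i a b : `|c i a b x' - c i a b x| <= N%:R * B * `|k|.
Proof.
rewrite x'E; apply: le_trans (ball_lipschitz (B := B) _ _ Vx Vx'') _.
- by move=> y Vy; exact: smooth_diff (c_smooth i a b) Vy.
- by move=> j y Vy; exact: dc_le.
- by rewrite ler_wpM2l ?mulr_ge0.
Qed.

Let dc2 i a b :
  `|c i a b x' - c i a b x - t * \sum_j k 0 j * partial j (c i a b) x|
  <= N%:R * (N%:R * B) * `|k| ^+ 2.
Proof.
have -> : t * (\sum_j k 0 j * partial j (c i a b) x) =
    \sum_j (t *: k) 0 j * partial j (c i a b) x.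
  by rewrite mulr_sumr; apply: eq_bigr => j _; rewrite mxE mulrA.
rewrite x'E; apply: le_trans (ball_taylor2 B0 (c_smooth i a b 1%N) _ Vx Vx'') _.
- by move=> j l y Vy; exact: ddc_le.
- by rewrite ler_wpM2l ?mulr_ge0// lerXn2r ?nnegrE.
Qed.

Lemma coef_increment1 a b : `|coef (h + k) a b x' - coef h a b x| <= C2 * `|k|.
Proof.
have -> : coef (h + k) a b x' - coef h a b x =
    \sum_i h 0 i * (c i a b x' - c i a b x) + coef k a b x'.
  by rewrite /coef -big_split -sumrB /=; apply: eq_bigr => i _; rewrite mxE; ring.
apply: le_trans (ler_normD _ _) _; rewrite /C2 mulrDl; apply: lerD; last exact: coef_le.
apply: le_trans (norm_sum_coord_le h (fun i => dc1 i a b)) _.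
rewrite mulrA -mulrA -[leRHS]mulrA ler_wpM2l ?mulr_ge0// mulrC ler_wpM2r// ltW//.
Qed.

Lemma coef_increment2 a b : `|coef (h + k) a b x' - coef h a b x - coef k a b x
   - t * \sum_i \sum_j h 0 i * k 0 j * partial j (c i a b) x| <= C1 * `|k| ^+ 2.
Proof.
have -> : coef (h + k) a b x' - coef h a b x - coef k a b x
   - t * (\sum_i \sum_j h 0 i * k 0 j * partial j (c i a b) x) =
    \sum_i h 0 i * (c i a b x' - c i a b x - t * \sum_j k 0 j * partial j (c i a b) x)
    + \sum_i k 0 i * (c i a b x' - c i a b x).
  rewrite /coef [t * _]mulr_sumr -big_split -!sumrB /=; apply: eq_bigr => i _.
  rewrite mxE.
  have -> : \sum_j h 0 i * k 0 j * partial j (c i a b) x =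
      h 0 i * \sum_j k 0 j * partial j (c i a b) x.
    by rewrite mulr_sumr; apply: eq_bigr => j _; rewrite mulrA.
  by move: (c i a b x) (c i a b x') (\sum_j _) => u v w; ring.
apply: le_trans (ler_normD _ _) _; rewrite /C1 mulrDl; apply: lerD.
  apply: le_trans (norm_sum_coord_le h (fun i => dc2 i a b)) _.
  have -> : N%:R * (N%:R * (N%:R * B) * `|k| ^+ 2) * `|h| =
    N%:R * (N%:R * (N%:R * B)) * `|h| * `|k| ^+ 2 by ring.
  by rewrite ler_wpM2r ?exprn_ge0// ler_wpM2l ?mulr_ge0// ltW.
apply: le_trans (norm_sum_coord_le k (fun i => dc1 i a b)) _.
by rewrite le_eqVlt; apply/orP; left; apply/eqP; ring.
Qed.

(** This is the flatness hypothesis contracted with [h] in the index [i] and with [k] in the index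
    [j], the form that [transport_identity] consumes. *)
Lemma coef_flat a b :
  \sum_i \sum_j h 0 i * k 0 j * partial i (c j a b) x -
  \sum_i \sum_j h 0 i * k 0 j * partial j (c i a b) x
  + \sum_d (coef k a d x * coef h d b x - coef h a d x * coef k d b x) = 0.
Proof.
have -> : \sum_d (coef k a d x * coef h d b x - coef h a d x * coef k d b x) =
   \sum_i \sum_j h 0 i * k 0 j *
     \sum_d (c j a d x * c i d b x - c i a d x * c j d b x).
  transitivity (\sum_d \sum_i \sum_j h 0 i * k 0 j *
     (c j a d x * c i d b x - c i a d x * c j d b x)); last first.
    rewrite exchange_big; apply: eq_bigr => i _ /=.
    by rewrite exchange_big; apply: eq_bigr => j _ /=; rewrite mulr_sumr.
  apply: eq_bigr => d _; rewrite [coef k a d x * _]mulrC /coef !big_distrlr /=.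
  rewrite -sumrB; apply: eq_bigr => i _; rewrite -sumrB; apply: eq_bigr => j _.
  by move: (c j a d x) (c i d b x) (c i a d x) (c j d b x) => *; ring.
rewrite -sumrB -big_split big1//= => i _; rewrite -sumrB -big_split big1//= => j _.
rewrite -[RHS](mulr0 (h 0 i * k 0 j)) -[in RHS](flat i j a b Vx).
by move: (partial _ _ _) (partial _ _ _) (\sum_d _) => *; ring.
Qed.

End Increment.

Lemma coef_segment (h k : 'rV[R]_N) a b (t : R) :
  `|h| < e -> 0 <= t <= 1 ->
  is_derive t 1 (fun s => coef k a b (q + s *: h))
    (\sum_i \sum_j h 0 i * k 0 j * partial i (c j a b) (q + t *: h)).
Proof.
move=> he t01.
have Vt : V (q + t *: h) by apply: in_V => //; rewrite ler_norml; lra.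
rewrite exchange_big /=.
apply: is_derive_bigsum => j.
have dj := is_derive_segment (smooth_diff (c_smooth j a b) Vt).
have := is_derive_mul (@is_derive_cst _ _ _ (k 0 j) t 1) dj.
rewrite mul0r add0r mulr_sumr.
rewrite (eq_bigr (fun i => h 0 i * k 0 j * partial i (c j a b) (q + t *: h)))//.
by move=> i _; rewrite mulrA [k 0 j * _]mulrC.
Qed.

(* With z, y the radial solutions in the directions h + k and h, flatness makes
   w := z - y - t (k . c) y satisfy w' = M w + O(|k|^2), so that w(1) = O(|k|^2). *)
Lemma transport_increment (K : R) : exists C : R, 0 <= C /\
  forall (h k : 'rV[R]_N) (y z : T -> R -> R), `|h| < e -> `|h + k| < e ->
  (forall a, y a 0 = z a 0) ->
  (forall a (t : R), 0 <= t <= 1 ->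
      is_derive t 1 (y a) (\sum_b coef h a b (q + t *: h) * y b t)) ->
  (forall a (t : R), 0 <= t <= 1 ->
      is_derive t 1 (z a) (\sum_b coef (h + k) a b (q + t *: (h + k)) * z b t)) ->
  (forall a t, 0 <= t <= 1 -> `|y a t| <= K) ->
  (forall a t, 0 <= t <= 1 -> `|z a t| <= K) ->
  forall a, `|z a 1 - y a 1 - \sum_b coef k a b (q + h) * y b 1| <= C * `|k| ^+ 2.
Proof.
(* The two summands bound the two error terms of [transport_identity]: the second-order defect of
   the coefficients against [y], and the product of two first-order variations. *)
pose C3 := #|T|%:R * (C1 * `|K|) + #|T|%:R * (C2 * (#|T|%:R * (N%:R * B * `|K|))).
have C10 : 0 <= C1 by rewrite /C1 addr_ge0 ?mulr_ge0// ltW.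
have C20 : 0 <= C2 by rewrite /C2 addr_ge0 ?mulr_ge0// ltW.
have C30 : 0 <= C3 by rewrite /C3 addr_ge0 ?mulr_ge0.
exists (2 * C3); split; first by rewrite mulr_ge0.
move=> h k y z he hke yz0 dy dz yK zK a.
have yK' b t : 0 <= t <= 1 -> `|y b t| <= `|K|.
  by move=> t01; apply: le_trans (yK b t t01) (ler_norm _).
have zK' b t : 0 <= t <= 1 -> `|z b t| <= `|K|.
  by move=> t01; apply: le_trans (zK b t t01) (ler_norm _).
pose P a b t := coef k a b (q + t *: h).
pose w a t := z a t - y a t - t * \sum_b P a b t * y b t.
pose dP a b t := \sum_i \sum_j h 0 i * k 0 j * partial i (c j a b) (q + t *: h).
pose M a b t := coef h a b (q + t *: h).
pose M' a b t := coef (h + k) a b (q + t *: (h + k)).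
pose Q a b t := \sum_i \sum_j h 0 i * k 0 j * partial j (c i a b) (q + t *: h).
have Vt (t : R) : 0 <= t <= 1 -> V (q + t *: h).
  by move=> t01; apply: in_V => //; rewrite ler_norml; lra.
have Vt' (t : R) : 0 <= t <= 1 -> V (q + t *: (h + k)).
  by move=> t01; apply: in_V => //; rewrite ler_norml; lra.
have Pk b d t : 0 <= t <= 1 -> `|P b d t| <= N%:R * B * `|k|.
  by move=> t01; apply: coef_le; exact: Vt.
have Py b t : 0 <= t <= 1 ->
    `|\sum_d P b d t * y d t| <= #|T|%:R * (N%:R * B * `|k| * `|K|).
  by move=> t01; apply: (@sum_card_le (fun d => P b d t) (fun d => y d t)) => d;
    [exact: Pk|exact: yK'].
pose dw a t := \sum_b M' a b t * z b t - \sum_b M a b t * y b t -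
  (\sum_b P a b t * y b t + t * \sum_b (dP a b t * y b t + P a b t * \sum_d M b d t * y d t)).
have dwE b t : 0 <= t <= 1 -> dw b t = \sum_d M' b d t * w d t +
    \sum_d (M' b d t - M b d t - P b d t - t * Q b d t) * y d t +
    t * \sum_d (M' b d t - M b d t) * \sum_r P d r t * y r t.
  move=> t01.
  apply: (@transport_identity R T (fun a b => M a b t) (fun a b => M' a b t)
    (fun a b => P a b t) (fun a b => dP a b t) (fun a b => Q a b t)
    (fun b => y b t) (fun b => z b t) t b) => d.
  exact: coef_flat.
have wE : w a 1 = z a 1 - y a 1 - \sum_b coef k a b (q + h) * y b 1.
  by rewrite /w mul1r /P scale1r.
rewrite -wE -mulrA.
have i01 : 0 <= (1 : R) <= 1 by rewrite ler01 lexx.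
apply: (@small_gronwall R T w dw (`|K| + `|K| + #|T|%:R * (N%:R * B * `|k| * `|K|))) => //.
- by rewrite mulr_ge0// exprn_ge0.
- by move=> b; rewrite /w yz0 mul0r subr0 subrr.
- move=> b t t01; have Hz := dz b t t01; have Hy := dy b t t01.
  apply: is_deriveB.
  have -> : \sum_b0 P b b0 t * y b0 t + t *
      \sum_b0 (dP b b0 t * y b0 t + P b b0 t * (\sum_d M b0 d t * y d t)) =
      1 * (\sum_b0 P b b0 t * y b0 t) + t *
      \sum_b0 (dP b b0 t * y b0 t + P b b0 t * (\sum_d M b0 d t * y d t)).
    by rewrite mul1r.
  apply: (@is_derive_mul R id).
  apply: is_derive_bigsum => d; apply: is_derive_mul; first exact: coef_segment.
  exact: dy.
- move=> b t t01; apply: le_trans (ler_normB _ _) _; apply: lerD.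
    by apply: le_trans (ler_normB _ _) _; apply: lerD; [exact: zK'|exact: yK'].
  rewrite normrM; case/andP: (t01) => t0 t1; rewrite (ger0_norm t0).
  rewrite -[leRHS]mul1r; apply: ler_pM => //; exact: Py.
- move=> t D t01 D0 wD b; rewrite dwE// -addrA; apply: le_trans (ler_normD _ _) _.
  apply: lerD.
    apply: (@lincomb_le R T (fun d => M' b d t) (fun d => w d t)) => //.
    by apply: coef_row_le => //; exact: Vt'.
  have -> : C3 * `|k| ^+ 2 = #|T|%:R * (C1 * `|k| ^+ 2 * `|K|) +
     #|T|%:R * (C2 * `|k| * (#|T|%:R * (N%:R * B * `|k| * `|K|))) by rewrite /C3; ring.
  apply: le_trans (ler_normD _ _) _; apply: lerD.
    apply: (@sum_card_le (fun d => M' b d t - M b d t - P b d t - t * Q b d t)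
      (fun d => y d t)) => d; last exact: yK'.
    exact: coef_increment2.
  rewrite normrM; case/andP: (t01) => t0 t1; rewrite (ger0_norm t0).
  rewrite -[leRHS]mul1r; apply: ler_pM => //.
  apply: (@sum_card_le (fun d => M' b d t - M b d t)
    (fun d => \sum_r P d r t * y r t)) => d; first exact: coef_increment1.
  exact: Py.
Qed.

Lemma frechet_quadratic (f : 'rV[R]_N -> R) x (l : 'I_N -> R) (C d : R) : 0 < d ->
  (forall k, `|k| < d ->
     `|f (x + k) - f x - \sum_i k 0 i * l i| <= C * `|k| ^+ 2) ->
  differentiable f x /\ forall i, partial i f x = l i.
Proof.
move=> d0 H; apply: frechet_criterion => r r0.
have C0 : 0 < `|C| + 1 by rewrite ltr_wpDl.
exists (Num.min d (r / (`|C| + 1))); first by rewrite lt_min d0 divr_gt0.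
move=> k; rewrite lt_min => /andP[kd kr]; apply: le_trans (H k kd) _.
rewrite expr2 mulrA ler_wpM2r//; apply: (@le_trans _ _ ((`|C| + 1) * `|k|)).
  by rewrite ler_wpM2r// (le_trans (ler_norm C))// lerDl.
by rewrite mulrC -ler_pdivlMr// ltW.
Qed.

Lemma transport_exists (y0 : T -> R) : exists y : T -> 'rV[R]_N -> R,
  (forall a, y a q = y0 a) /\
  forall x, ball q e x -> forall a, differentiable (y a) x /\
    forall j, partial j (y a) x = \sum_b c j a b x * y b x.
Proof.
pose K := \sum_a `|y0 a|.
have y0K a : `|y0 a| <= K by rewrite /K (bigD1 a)//= lerDl sumr_ge0.
pose S (h : 'rV[R]_N) := [set y : T -> R -> R |
  [/\ forall a, y a 0 = y0 a,
    forall a (t : R), 0 <= t <= 1 ->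
      is_derive t 1 (y a) (\sum_b coef h a b (q + t *: h) * y b t) &
    forall a t, 0 <= t <= 1 -> `|y a t| <= 2 * K]].
pose Y h := get (S h).
have YP h : `|h| < e -> S h (Y h).
  by move=> he; have H := radial_solution y0K he; exact: (getPex H).
have norm_ball x : ball q e x -> `|x - q| < e.
  by rewrite -ball_normE /= distrC.
exists (fun a x => Y (x - q) a 1); split=> [a|x qx a].
  (* At the centre the ray is a point and its equation has zero coefficients, so the value at time 1
     is still the initial value. *)
  have h0 : `|0 : 'rV[R]_N| < e by rewrite normr0.
  rewrite subrr; have [Y0 dY _] := YP 0 h0.
  have i01 : 0 <= (1 : R) <= 1 by rewrite ler01 lexx.
  have := @deriv_bound R (Y 0 a) _ 1 0 (dY a) _ 1 i01.
  rewrite mul0r normr_le0 Y0 subr_eq0 => H; apply/eqP; apply: H => t _.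
  rewrite big1 ?normr0// => b _; rewrite /coef big1 ?mul0r// => i _.
  by rewrite mxE mul0r.
have [C [C0 HC]] := transport_increment (2 * K).
have he := norm_ball x qx.
have [||dy py] := @frechet_quadratic (fun x => Y (x - q) a 1) x
   (fun j => \sum_b c j a b x * Y (x - q) b 1) C (e - `|x - q|).
- by rewrite subr_gt0.
- move=> k ke.
  have hke : `|x - q + k| < e.
    by rewrite (le_lt_trans (ler_normD _ _))// addrC -ltrBrDr.
  have [Y0 dY YK] := YP _ he; have [Z0 dZ ZK] := YP _ hke.
  have YZ b : Y (x - q) b 0 = Y (x - q + k) b 0 by rewrite Y0 Z0.
  have := HC (x - q) k _ _ he hke YZ dY dZ YK ZK a.
  rewrite (addrC q) subrK (addrAC x k).
  set L := (X in _ -> `|_ - X| <= _); set L' := (X in `|_ - X| <= _ -> _).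
  suff -> : L = L' by [].
  rewrite /L /L' /coef.
  under [RHS]eq_bigr do rewrite mulr_suml.
  rewrite exchange_big; apply: eq_bigr => j _.
  by rewrite mulr_sumr; apply: eq_bigr => b _; rewrite mulrA.
- by [].
Qed.

(** Along a ray the difference solves the homogeneous equation and vanishes at time 0;
    [small_gronwall] with [C = 0] forces it to be zero. The a priori bound it asks for comes from
    the extreme value theorem. *)
Lemma transport_unique (y z : T -> 'rV[R]_N -> R) :
  (forall x, ball q e x -> forall a, differentiable (y a) x /\
    forall j, partial j (y a) x = \sum_b c j a b x * y b x) ->
  (forall x, ball q e x -> forall a, differentiable (z a) x /\
    forall j, partial j (z a) x = \sum_b c j a b x * z b x) ->
  (forall a, y a q = z a q) ->
  forall x, ball q e x -> forall a, y a x = z a x.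
Proof.
move=> Hy Hz yz x qx a; pose h := x - q.
have he : `|h| < e by move: qx; rewrite -ball_normE /= distrC.
pose w b t := y b (q + t *: h) - z b (q + t *: h).
have bt (t : R) : 0 <= t <= 1 -> ball q e (q + t *: h).
  move=> t01; apply: ball_segment => //; first exact: ballxx.
  by rewrite /h addrC subrK.
have dw (u : T -> 'rV[R]_N -> R) : (forall x, ball q e x -> forall a, differentiable (u a) x /\
    forall j, partial j (u a) x = \sum_b c j a b x * u b x) ->
    forall b (t : R), 0 <= t <= 1 -> is_derive t 1 (fun s => u b (q + s *: h))
      (\sum_d coef h b d (q + t *: h) * u d (q + t *: h)).
  move=> Hu b t t01; have [du pu] := Hu _ (bt t t01) b.
  apply: is_derive_eq (is_derive_segment du) _.
  under eq_bigr do rewrite pu mulr_sumr.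
  rewrite exchange_big; apply: eq_bigr => d _ /=; rewrite /coef mulr_suml.
  by apply: eq_bigr => i _; rewrite mulrA.
have dwt b (t : R) : 0 <= t <= 1 ->
    is_derive t 1 (w b) (\sum_d coef h b d (q + t *: h) * w d t).
  move=> t01; have D1 := dw y Hy b t t01; have D2 := dw z Hz b t t01.
  rewrite (_ : \sum_d _ = \sum_d coef h b d (q + t *: h) * y d (q + t *: h) -
    \sum_d coef h b d (q + t *: h) * z d (q + t *: h)); first exact: is_deriveB.
  by rewrite -sumrB; apply: eq_bigr => d _; rewrite mulrBr.
have mP b : exists m, forall t, 0 <= t <= 1 -> `|w b t| <= m.
  have [||s _ Hs] := @EVT_max R (fun t => `|w b t|) 0 1; first exact: ler01.
    have cw : {within `[0, 1], continuous (w b)}.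
      apply: (@derivable_within_continuous R R^o _ `[0, 1]) => t t01.
      by have [|] := dwt b t; rewrite // -[0 <= t <= 1]in_itv.
    by move=> t; exact: cvg_norm (cw t).
  exists `|w b s| => t t01; apply: Hs; by rewrite in_itv.
pose m b := sval (cid (mP b)); have wm b : forall t, 0 <= t <= 1 -> `|w b t| <= m b := svalP (cid (mP b)).
have i01 : 0 <= (1 : R) <= 1 by rewrite ler01 lexx.
have qh : q + 1 *: h = x by rewrite scale1r /h addrC subrK.
suff : `|w a 1| <= 2 * 0 by rewrite mulr0 normr_le0 /w qh subr_eq0 => /eqP.
apply: (@small_gronwall R T w _ (\sum_b `|m b|) 0 (lexx 0) _ dwt _ _ a 1 i01).
- by move=> b; rewrite /w scale0r addr0 yz subrr.
- move=> b t t01; apply: le_trans (wm b t t01) _; apply: le_trans (ler_norm _) _.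
  by rewrite (bigD1 b)//= lerDl sumr_ge0.
- move=> t D t01 D0 wD b; rewrite addr0.
  apply: (@lincomb_le R T (fun d => coef h b d (q + t *: h)) (fun d => w d t)) => //.
  by apply: coef_row_le => //; apply: in_V => //; rewrite ler_norml; lra.
Qed.

End RadialTransport.

(** * Local solvability and uniqueness of linear systems *)

Section Frobenius.
Context {R : realType} {N : nat} {T : finType}.
Implicit Types (U : set 'rV[R]_N) (c : 'I_N -> T -> T -> 'rV[R]_N -> R).

Lemma locally_bounded (I : finType) (F : I -> 'rV[R]_N -> R) (q : 'rV[R]_N) :
  (forall i, {for q, continuous (F i)}) ->
  exists B d : R, [/\ 0 <= B, 0 < d &
    forall y, ball q d y -> forall i, `|F i y| <= B].
Proof.
move=> cF.
have /nbhs_ballP[d /= d0 Hd] : \forall y \near q, forall i, `|F i q - F i y| < 1.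
  have H i : \forall y \near q, `|F i q - F i y| < 1.
    by have /cvgrPdist_lt/(_ 1 ltr01) := cF i.
  exact: (@filter_forall _ _ _ (nbhs q) _ H).
exists (\sum_i `|F i q| + 1), d; split=> //; first by rewrite addr_ge0 ?sumr_ge0.
move=> y /Hd Hy i; have := Hy i; rewrite distrC => /ltW Hi.
rewrite -[F i y](subrK (F i q)) addrC (le_trans (ler_normD _ _))// lerD//.
by rewrite (bigD1 i)//= lerDl sumr_ge0.
Qed.

Definition linear_solution U c (y : T -> 'rV[R]_N -> R) :=
  forall x, U x -> forall a, differentiable (y a) x /\
    forall j, partial j (y a) x = \sum_b c j a b x * y b x.

Definition flat_coefficients U c := forall i j a b x, U x ->
  partial i (c j a b) x - partial j (c i a b) x
  + \sum_d (c j a d x * c i d b x - c i a d x * c j d b x) = 0.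

(** All small radii are allowed, so that several systems can be treated on a common ball. Flatness
    is a premise of the existence clause itself, which leaves uniqueness directly available to the
    system of 2-tensors. *)
Theorem linear_frobenius U c (q : 'rV[R]_N) : open U -> U q ->
  (forall i a b, smooth U (c i a b)) ->
  exists2 e0 : R, 0 < e0 & forall e, 0 < e -> e <= e0 -> [/\ ball q e `<=` U,
    flat_coefficients U c -> forall y0 : T -> R,
      exists2 y, linear_solution (ball q e) c y & forall a, y a q = y0 a &
    forall y z, linear_solution (ball q e) c y -> linear_solution (ball q e) c z ->
      (forall a, y a q = z a q) -> forall x, ball q e x -> forall a, y a x = z a x].
Proof.
move=> oU Uq sc.
have cont f : smooth U f -> {for q, continuous f}.
  by move=> sf; apply: differentiable_continuous; exact: smooth_diff sf Uq.
have [B1 [d1 [B10 d10 H1]]] := @locally_bounded ('I_N * T * T)%type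
  (fun p => c p.1.1 p.1.2 p.2) q (fun p => cont _ (sc _ _ _)).
have [B2 [d2 [B20 d20 H2]]] := @locally_bounded ('I_N * 'I_N * T * T)%type
  (fun p => partial p.1.1.2 (c p.1.1.1 p.1.2 p.2)) q
  (fun p => cont _ (smooth_partial _ (sc _ _ _))).
have [B3 [d3 [B30 d30 H3]]] := @locally_bounded ('I_N * 'I_N * 'I_N * T * T)%type
  (fun p => partial p.1.1.2 (partial p.1.1.1.2 (c p.1.1.1.1 p.1.2 p.2))) q
  (fun p => cont _ (smooth_partial _ (smooth_partial _ (sc _ _ _)))).
have /nbhs_ballP[d4 /= d40 H4] : nbhs q U by exact: open_nbhs_nbhs.
pose B := B1 + B2 + B3.
have B0 : 0 <= B by rewrite !addr_ge0.
pose m := #|T|%:R * (N%:R * B).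
have m0 : 0 <= m by rewrite !mulr_ge0.
pose d := Num.min (Num.min d1 d2) (Num.min d3 d4).
have d0 : 0 < d by rewrite !lt_min d10 d20 d30.
(* The first term keeps the ball of radius [3 * e] inside the region where the bounds hold; the
   second makes the coefficient rows sum to at most 1/4, with [m + 1] in place of [m] to divide by a
   positive number. *)
pose e1 := Num.min (d / 3) (4^-1 / (m + 1)).
have m1 : 0 < m + 1 by rewrite ltr_wpDl.
exists e1; first by rewrite lt_min !divr_gt0// invr_gt0.
move=> e e0 ee1.
have ed : 3 * e <= d.
  by rewrite mulrC -ler_pdivlMr// (le_trans ee1)// ge_min lexx.
have sub r : d <= r -> ball q (3 * e) `<=` ball q r.
  by move=> dr; apply: le_ball; exact: le_trans ed dr.
have U3 : ball q (3 * e) `<=` U.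
  by apply: subset_trans H4; apply: sub; rewrite /d !ge_min lexx !orbT.
have U1 : ball q e `<=` ball q (3 * e).
  by apply: le_ball; rewrite ler_peMl ?ler1n// ltW.
have sc3 i a b : smooth (ball q (3 * e)) (c i a b) by move=> k; exact: Ck_sub (sc i a b k).
have b1 i a b y : ball q (3 * e) y -> `|c i a b y| <= B.
  move=> /(sub d1) Hy; apply: (@le_trans _ _ B1); last by rewrite /B -addrA lerDl addr_ge0.
  by apply: (H1 y _ (i, a, b)); apply: Hy; rewrite /d !ge_min lexx.
have b2 i j a b y : ball q (3 * e) y -> `|partial j (c i a b) y| <= B.
  move=> /(sub d2) Hy; apply: (@le_trans _ _ B2).
    by apply: (H2 y _ (i, j, a, b)); apply: Hy; rewrite /d !ge_min lexx !orbT.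
  by rewrite /B addrAC lerDr addr_ge0.
have b3 i j l a b y : ball q (3 * e) y -> `|partial l (partial j (c i a b)) y| <= B.
  move=> /(sub d3) Hy; apply: (@le_trans _ _ B3); last by rewrite /B lerDr addr_ge0.
  by apply: (H3 y _ (i, j, l, a, b)); apply: Hy; rewrite /d !ge_min lexx !orbT.
have small : #|T|%:R * (N%:R * B * e) <= 4^-1.
  rewrite mulrA -/m; apply: (@le_trans _ _ ((m + 1) * e)).
    by rewrite ler_wpM2r ?lerDl// ltW.
  by rewrite mulrC -ler_pdivlMr// (le_trans ee1)// ge_min lexx orbT.
split; first exact: subset_trans U3.
- move=> fc y0.
  have fl i j a b x : ball q (3 * e) x -> partial i (c j a b) x - partial j (c i a b) x
      + \sum_d (c j a d x * c i d b x - c i a d x * c j d b x) = 0.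
    by move=> /U3; exact: fc.
  have [y [yq Hy]] := transport_exists e0 B0 sc3 b1 b2 b3 small fl y0.
  by exists y.
- by move=> y z; apply: (@transport_unique R N T q e B c).
Qed.

Lemma linear_solution_smooth U c (y : T -> 'rV[R]_N -> R) : open U ->
  (forall i a b, smooth U (c i a b)) -> linear_solution U c y ->
  forall a, smooth U (y a).
Proof.
move=> oU sc Hy a k; elim: k a => [|k IH] a; split=> //;
  try (by move=> x Ux; have [] := Hy x Ux a); move=> i.
apply: (@Ck_eq _ _ _ _ (fun x => \sum_b c i a b x * y b x)) => // [x Ux|].
  by have [_ ->] := Hy x Ux a.
by apply: Ck_sum => // b _; apply: CkM => //; exact: sc.
Qed.

End Frobenius.

(* A primitive f of a closed form v is the first component of the solution
   (f, 1) of the flat linear system  d f = v * 1,  d 1 = 0. *)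
Lemma poincare (R : realType) (N : nat) (U : set 'rV[R]_N) (I : finType)
    (v : I -> 'I_N -> 'rV[R]_N -> R) (q : 'rV[R]_N) (f0 : I -> R) :
  open U -> U q -> (forall s i, smooth U (v s i)) ->
  (forall s i j x, U x -> partial i (v s j) x = partial j (v s i) x) ->
  exists (e : R) (f : I -> 'rV[R]_N -> R), [/\ 0 < e, ball q e `<=` U,
    forall s, smooth (ball q e) (f s), forall s, f s q = f0 s &
    forall s i x, ball q e x -> partial i (f s) x = v s i x].
Proof.
move=> oU Uq sv cv.
pose c (i : 'I_N) (a b : option I) : 'rV[R]_N -> R :=
  if a is Some s then (if b is None then v s i else fun=> 0) else fun=> 0.
have sc i a b : smooth U (c i a b).
  by case: a b => [s|] [t|] k; [exact: Ck_cst|exact: sv|exact: Ck_cst|exact: Ck_cst].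
have fc : flat_coefficients U c.
  move=> i j a b x Ux; rewrite big1 ?addr0.
    case: a b => [s|] [t|]; rewrite /c ?partial_cst ?subr0//.
    by rewrite cv// subrr.
  by move=> d _; case: a d b => [s|] [d|] [t|]; rewrite /c ?mul0r ?mulr0 ?subr0.
have [e e0 /(_ e e0 (lexx e))[eU ex _]] := linear_frobenius oU Uq sc.
have [y Hy yq] := ex fc (fun a => if a is Some s then f0 s else 1).
have sy := linear_solution_smooth (ball_open q e) (fun i a b k => Ck_sub eU (sc i a b k)) Hy.
(* The component indexed by [None] has zero partials, so the Lipschitz estimate with constant 0
   makes it constant. *)
have y1 x : ball q e x -> y None x = 1.
  move=> qx; have xE : x = q + (x - q) by rewrite addrC subrK.
  have := @ball_lipschitz _ _ (y None) q q (x - q) e 0 _ _ (ballxx q e0).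
  rewrite -xE mulr0 mul0r normr_le0 subr_eq0 yq => H; apply/eqP/H => //.
    by move=> z qz; have [] := Hy z qz None.
  move=> i z qz; have [_ ->] := Hy z qz None.
  by rewrite big1 ?normr0// => b _; rewrite mul0r.
exists e, (fun s => y (Some s)); split=> //; first by move=> s; rewrite yq.
move=> s i x qx; have [_ ->] := Hy x qx (Some s).
rewrite (bigD1 None)//= y1// mulr1 big1 ?addr0//.
by case=> // t _; rewrite mul0r.
Qed.

(** * The inverse function theorem *)

Section InverseFunction.
Context {R : realType} {N : nat}.

Lemma contraction_fixpoint (A : set 'rV[R]_N) (f : 'rV[R]_N -> 'rV[R]_N) :
  closed A -> A !=set0 -> (forall x, A x -> A (f x)) ->
  (forall x y, A x -> A y -> `|f x - f y| <= 2^-1 * `|x - y|) ->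
  exists2 p, A p & f p = p.
Proof.
move=> cA A0 fA fl.
pose X : completeNormedModType R := HB.pack 'rV[R]_N.
have fs : set_fun (A : set X) A f by move=> x Ax; exact: fA.
have [|||p Ap pE] := @banach_fixed_point R X A (mkfun fs).
- exists (2^-1)%:nng; split; first by rewrite /= invf_lt1 ?ltr1n.
  by move=> [x y] [/= Ax Ay]; exact: fl.
- exact: cA.
- exact: A0.
by exists p.
Qed.

(** The Jacobian is normalised to the identity at [q], so [g x = x - F x] is 1/2-Lipschitz nearby
    and the fixed point of [x |-> g x + w] solves [F x = w]. The coframe to which this is applied
    has that normalisation. *)
Lemma inverse_function (f : 'I_N -> 'rV[R]_N -> R) (U : set 'rV[R]_N) (q : 'rV[R]_N) :
  open U -> U q -> (forall a, smooth U (f a)) ->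
  (forall a i, partial i (f a) q = (i == a)%:R) ->
  (forall x, U x -> (\matrix_(i, a) partial i (f a) x) \in unitmx) ->
  exists (W : set 'rV[R]_N) (phi : 'rV[R]_N -> 'rV[R]_N),
    [/\ [/\ open W, smooth_on W phi, open (phi @` W) & phi @` W `<=` U],
      W (\row_a f a q), phi (\row_a f a q) = q,
      forall w, W w -> \row_a f a (phi w) = w &
      forall w, W w -> forall i a, partial a (fun w => phi w 0 i) w =
        invmx (\matrix_(i, a) partial i (f a) (phi w)) a i].
Proof.
move=> oU Uq sf dfq Ju.
have cont g : smooth U g -> {for q, continuous g}.
  by move=> sg; apply: differentiable_continuous; exact: smooth_diff sg Uq.
have [B [d1 [B0 d10 H1]]] := @locally_bounded R N ('I_N * 'I_N * 'I_N)%type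
  (fun p => partial p.1.1 (partial p.1.2 (f p.2))) q
  (fun p => cont _ (smooth_partial _ (smooth_partial _ (sf _)))).
(* Summing [N] partials, each within [m] of its value at [q], costs at most 1/2; [N.+1] covers the
   case [N = 0]. *)
pose m : R := (2 * N.+1%:R)^-1.
have m0 : 0 < m by rewrite invr_gt0 mulr_gt0.
have /nbhs_ballP[d2 /= d20 H2] : \forall y \near q,
    forall p : 'I_N * 'I_N, `|partial p.1 (f p.2) q - partial p.1 (f p.2) y| < m.
  have H (p : 'I_N * 'I_N) : \forall y \near q,
      `|partial p.1 (f p.2) q - partial p.1 (f p.2) y| < m.
    by have /cvgrPdist_lt/(_ m m0) := cont _ (smooth_partial p.1 (sf p.2)).
  exact: (@filter_forall _ _ _ (nbhs q) _ H).
have /nbhs_ballP[d3 /= d30 H3] : nbhs q U by exact: open_nbhs_nbhs.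
pose rho := Num.min d1 (Num.min d2 d3).
have rho0 : 0 < rho by rewrite !lt_min d10 d20 d30.
have sub d : rho <= d -> ball q rho `<=` ball q d by move=> ?; exact: le_ball.
have rU : ball q rho `<=` U.
  by apply: subset_trans H3; apply: sub; rewrite /rho !ge_min lexx !orbT.
have bdd i j a y : ball q rho y -> `|partial j (partial i (f a)) y| <= B.
  move=> /(sub d1) Hy; apply: (H1 y _ (j, i, a)).
  by apply: Hy; rewrite /rho !ge_min lexx.
have bd i a y : ball q rho y -> `|partial i (f a) q - partial i (f a) y| <= m.
  move=> /(sub d2) Hy; apply: ltW; apply: (H2 y _ (i, a)).
  by apply: Hy; rewrite /rho !ge_min lexx !orbT.
pose F x : 'rV[R]_N := \row_a f a x.
pose g x : 'rV[R]_N := x - F x.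
have glip x y : ball q rho x -> ball q rho y -> `|g y - g x| <= 2^-1 * `|y - x|.
  move=> qx qy; apply: rV_norm_le => [|a]; first by rewrite mulr_ge0.
  have dfa z : ball q rho z -> differentiable (f a) z.
    by move=> /rU; exact: smooth_diff (sf a).
  have dco z : differentiable (fun z : 'rV[R]_N => z 0 a) z.
    exact: differentiable_coord.
  have := @ball_lipschitz R N (fun z => z 0 a - f a z) q x (y - x) rho m.
  rewrite addrC subrK !mxE => H; apply: le_trans (H _ _ qx qy) _ => {H}.
  - by move=> z qz; apply: differentiableB => //; exact: dfa.
  - move=> i z qz; rewrite partialB//; last exact: dfa.
    apply: le_trans (bd i a z qz); rewrite dfq.
    suff -> : partial i (fun z : 'rV[R]_N => z 0 a) z = (i == a)%:R by [].
    rewrite -(@partial_coord R N N id i a z)//.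
    by rewrite /partial derive_id mxE eqxx eq_sym.
  - rewrite ler_wpM2r// /m invfM mulrCA ler_piMr// ?invr_ge0//.
    by rewrite ler_pdivrMr// mul1r ler_nat.
have Flip x y : ball q rho x -> ball q rho y -> `|y - x| <= 2 * `|F y - F x|.
  move=> qx qy; have := glip x y qx qy.
  have : `|y - x| <= `|g y - g x| + `|F y - F x|.
    rewrite (_ : y - x = (g y - g x) + (F y - F x)) ?ler_normD// /g.
    by apply/rowP => i; rewrite !mxE; ring.
  by move: `|y - x| `|g y - g x| `|F y - F x| => *; lra.
pose r := rho / 2; have r0 : 0 < r by rewrite divr_gt0.
have rrho x : `|q - x| <= r -> ball q rho x.
  by move=> h; rewrite -ball_normE /= (le_lt_trans h)// /r; lra.
(* The contraction uses half of the radius [r] and the displacement of [w] from [F q] the other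
   half, so the closed ball of radius [r] is mapped into itself. *)
pose W := ball (F q) (r / 2).
have r20 : 0 < r / 2 by rewrite divr_gt0.
have exphi w : W w -> exists x, `|q - x| <= r /\ F x = w.
  move=> Ww.
  have [||x qx|x y qx qy|x qx xE] := @contraction_fixpoint [set x | `|q - x| <= r]
      (fun x => g x + w).
  - have := @closed_ball_closed R _ q r; rewrite closed_ballE//.
  - by exists q; rewrite /= subrr normr0 ltW.
  - have qq : ball q rho q by exact: ballxx.
    rewrite /= (_ : q - (g x + w) = (g q - g x) + (F q - w)); last first.
      by apply/rowP => i; rewrite !mxE; ring.
    rewrite (le_trans (ler_normD _ _))// [leRHS](splitr r) lerD//.
      apply: le_trans (glip x q (rrho x qx) qq) _.
      by rewrite mulrC ler_pM2r ?invr_gt0.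
    by move: Ww; rewrite /W -ball_normE => /ltW.
  - by rewrite opprD addrACA subrr addr0; apply: glip; exact: rrho.
  exists x; split=> //; rewrite -[RHS](addKr (g x)) xE /g opprB subrK //.
pose phi w := get [set x | `|q - x| <= r /\ F x = w].
have phiP w : W w -> `|q - phi w| <= r /\ F (phi w) = w.
  by move=> Ww; have H := exphi w Ww; exact: (getPex H).
have FW x : `|q - x| <= r -> W (F x) -> `|q - x| < r.
  move=> qx; rewrite /W -ball_normE /= => Wx.
  have qq : ball q rho q by exact: ballxx.
  apply: le_lt_trans (Flip _ _ (rrho x qx) qq) _.
  by rewrite mulrC -ltr_pdivlMr.
have phiF x : `|q - x| <= r -> W (F x) -> phi (F x) = x.
  move=> qx Wx; have [p1 p2] := phiP _ Wx.
  apply/eqP; rewrite -subr_eq0 -normr_le0.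
  by apply: le_trans (Flip _ _ (rrho x qx) (rrho _ p1)) _; rewrite p2 subrr normr0 mulr0.
have phiU w : W w -> U (phi w) by move=> /phiP[/rrho/rU].
pose J x := \matrix_(i, a) partial i (f a) x.
have dF x : ball q rho x -> differentiable F x.
  move=> qx; apply/differentiable_coordP => a.
  rewrite (_ : (fun y => F y 0 a) = f a); first by apply: smooth_diff (sf a) _; exact: rU.
  by apply/funext => y; rewrite mxE.
have oW : open W by exact: ball_open.
have phi_diff w : W w -> forall i, differentiable (fun w => phi w 0 i) w /\
    forall a, partial a (fun w => phi w 0 i) w = invmx (J (phi w)) a i.
  move=> Ww i; set x := phi w.
  have [qx xw] := phiP w Ww; have Bx := rrho x qx.
  have /nbhs_ballP[d /= d0 Hd] : nbhs w W by exact: open_nbhs_nbhs.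
  pose c := \sum_b `|invmx (J x) b i|.
  have cb b : `|invmx (J x) b i| <= c by rewrite /c (bigD1 b)//= lerDl sumr_ge0.
  have uJ : J x \in unitmx by apply: Ju; exact: phiU.
  apply: (@frechet_quadratic R N _ w _ (N%:R * c * (N%:R * (N%:R * B) * 4)) d d0).
  move=> k kd.
  have Wk : W (w + k) by apply: Hd; rewrite -ball_normE /= opprD addNKr normrN.
  have [qk kw] := phiP _ Wk; have Bk := rrho _ qk.
  pose D := phi (w + k) - x.
  have xD : x + D = phi (w + k) by rewrite addrC subrK.
  have Dk : `|D| <= 2 * `|k|.
    apply: le_trans (Flip x (phi (w + k)) Bx Bk) _.
    by rewrite kw xw [w + k]addrC addrK.
  (* This is the Taylor remainder of [F] for the displacement [D] of the inverse. Multiplied by the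
     inverse Jacobian it is, up to sign, the error of the expected derivative; it is quadratic in
     [k] because [|D| <= 2 * |k|]. *)
  pose t : 'rV[R]_N := k - D *m J x.
  have tb b : `|t 0 b| <= N%:R * (N%:R * B) * 4 * `|k| ^+ 2.
    have BxD : ball q rho (x + D) by rewrite xD.
    have := @ball_taylor2 R N (f b) q x D rho B B0 (Ck_sub rU (sf b 1%N))
      (fun i j => @bdd i j b) Bx BxD.
    have -> : t 0 b = f b (x + D) - f b x - \sum_i D 0 i * partial i (f b) x.
      rewrite !mxE xD; congr (_ - _).
        have /rowP/(_ b) := kw; have /rowP/(_ b) := xw.
        by rewrite !mxE => <- ->; rewrite addrC addrK.
      by apply: eq_bigr => j _; congr (_ * _); rewrite mxE.
    move=> H; apply: le_trans H _.
    rewrite -[leRHS]mulrA ler_wpM2l ?mulr_ge0//.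
    have -> : 4 * `|k| ^+ 2 = (2 * `|k|) ^+ 2 by rewrite exprMn; congr (_ * _); ring.
    by rewrite lerXn2r ?nnegrE ?mulr_ge0.
  have -> : phi (w + k) 0 i - phi w 0 i - \sum_a k 0 a * invmx (J (phi w)) a i =
     - \sum_b t 0 b * invmx (J x) b i.
    have -> : \sum_b t 0 b * invmx (J x) b i = (t *m invmx (J x)) 0 i by rewrite mxE.
    rewrite /t mulmxBl -mulmxA mulmxV// mulmx1 !mxE opprB /x.
    by ring.
  rewrite normrN; apply: le_trans (norm_sum_coord_le t cb) _.
  rewrite -[leRHS]mulrA ler_wpM2l ?mulr_ge0 ?sumr_ge0//.
  apply: rV_norm_le => [|b]; first by rewrite !mulr_ge0// exprn_ge0.
  exact: tb.
(* This description makes the image open. Preimages are strictly inside the closed ball by [FW],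
   where the strict radius of [W] is used. *)
have phi_image : phi @` W = ball q r `&` F @^-1` W.
  apply/seteqP; split=> [_ [w Ww <-]|x [qx Wx]] /=.
    have [qw ww] := phiP w Ww; split; last by rewrite ww.
    by rewrite -ball_normE /=; apply: FW => //; rewrite ww.
  exists (F x) => //; apply: phiF => //.
  by move: qx; rewrite -ball_normE => /ltW.
(* Bootstrapping: the derivative of [phi] is the inverse Jacobian composed with [phi], hence has the
   order of differentiability already known for [phi]. *)
have sphi j : smooth W (fun w => phi w 0 j).
  move=> k; elim: k j => [|k IH] j; split=> //;
    try (by move=> w Ww; have [] := phi_diff w Ww j); move=> a.
  apply: (@Ck_eq _ _ _ _ (fun w => invmx (J (phi w)) a j)) => // [w Ww|].
    by have [_ ->] := phi_diff w Ww j.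
  apply: Ck_invmx => // [w Ww|i b]; first by apply: Ju; exact: phiU.
  apply: (@Ck_eq _ _ _ _ (partial i (f b) \o phi)) => // [w Ww|].
    by rewrite mxE.
  by apply: (Ck_comp (V := U)) => //; exact: smooth_partial (sf b) k.
have WFq : W (F q) by exact: ballxx.
exists W, phi; split=> //.
- split=> //; first by apply/smooth_on_coordP.
    rewrite phi_image openE => x [qx Wx]; apply: filterI.
      exact: open_nbhs_nbhs (conj (ball_open q r) qx).
    have cF : {for x, continuous F}.
      by apply/differentiable_continuous/dF; apply: le_ball qx; rewrite /r; lra.
    by apply: cF; apply: open_nbhs_nbhs.
  by move=> _ [w Ww <-]; exact: phiU.
- by apply: phiF => //; rewrite subrr normr0 ltW.
- by move=> w /phiP[].
- by move=> w Ww i a; have [_ ->] := phi_diff w Ww i.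
Qed.

End InverseFunction.

(** * The Gauss, Codazzi and Ricci equations *)

Section BilinearForm.
Context {R : realType} {m : nat}.
Implicit Types (G : 'M[R]_m) (x y z : 'rV[R]_m).

Lemma bformE G x y : bform G x y = \sum_i \sum_j x 0 i * G i j * y 0 j.
Proof.
rewrite /bform mxE exchange_big /=; apply: eq_bigr => j _.
by rewrite mxE mulr_suml; apply: eq_bigr => i _; rewrite !mxE.
Qed.

Lemma bformDl G x y z : bform G (x + y) z = bform G x z + bform G y z.
Proof. by rewrite /bform !mulmxDl mxE. Qed.

Lemma bformZl G (a : R) x z : bform G (a *: x) z = a * bform G x z.
Proof. by rewrite /bform -!scalemxAl mxE. Qed.

Lemma bform0l G z : bform G 0 z = 0.
Proof. by rewrite /bform !mul0mx mxE. Qed.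

Lemma bformC G x y : G^T = G -> bform G x y = bform G y x.
Proof.
by move=> GT; rewrite /bform -[in RHS](trmxK (y *m G *m x^T)) [RHS]mxE !trmx_mul trmxK GT mulmxA.
Qed.

Lemma bform_suml G (I : Type) (s : seq I) (F : I -> 'rV[R]_m) z :
  bform G (\sum_(i <- s) F i) z = \sum_(i <- s) bform G (F i) z.
Proof.
elim: s => [|i s IH]; first by rewrite !big_nil bform0l.
by rewrite !big_cons bformDl IH.
Qed.

Lemma bform_sumr G (I : Type) (s : seq I) (F : I -> 'rV[R]_m) z : G^T = G ->
  bform G z (\sum_(i <- s) F i) = \sum_(i <- s) bform G z (F i).
Proof.
by move=> GT; rewrite bformC// bform_suml; apply: eq_bigr => i _; rewrite bformC.
Qed.

Lemma bformZr G (a : R) x z : G^T = G -> bform G x (a *: z) = a * bform G x z.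
Proof. by move=> GT; rewrite bformC// bformZl bformC. Qed.

Lemma mulmx_bform G k l (A : 'M[R]_(k, m)) (B : 'M[R]_(l, m)) i j :
  (A *m G *m B^T) i j = bform G (row i A) (row j B).
Proof.
rewrite /bform -row_mul [LHS]mxE [RHS]mxE; apply: eq_bigr => s _.
by congr (_ * _); rewrite ?mxE.
Qed.

Lemma partial_bform N G (x y : 'rV[R]_N -> 'rV[R]_m) i u :
  differentiable x u -> differentiable y u ->
  partial i (fun v => bform G (x v) (y v)) u =
  bform G (partial i x u) (y u) + bform G (x u) (partial i y u).
Proof.
move=> dx dy.
have dxi j : differentiable (fun v => x v 0 j) u by have /differentiable_coordP := dx.
have dyi j : differentiable (fun v => y v 0 j) u by have /differentiable_coordP := dy.
have dxG j l : differentiable (fun v => x v 0 j * G j l) u.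
  by apply: differentiableM => //; exact: differentiable_cst.
have dxGy j l : differentiable (fun v => x v 0 j * G j l * y v 0 l) u.
  exact: (@differentiableM _ _ (fun v => x v 0 j * G j l) (fun v => y v 0 l)).
rewrite (_ : (fun v => _) = (fun v => \sum_j \sum_l x v 0 j * G j l * y v 0 l)).
  rewrite partial_sum => [|j _]; last exact: differentiable_sum_fin.
  rewrite !bformE -big_split; apply: eq_bigr => j _ /=.
  rewrite partial_sum// -big_split; apply: eq_bigr => l _ /=.
  rewrite (@partialM _ _ (fun v => x v 0 j * G j l) (fun v => y v 0 l))//.
  by rewrite partialMr// -!partial_coord.
by apply/funext => v; rewrite bformE.
Qed.

Lemma smooth_bform N G U (x y : 'rV[R]_N -> 'rV[R]_m) : open U ->
  smooth_on U x -> smooth_on U y -> smooth U (fun v => bform G (x v) (y v)).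
Proof.
move=> oU sx sy k.
have {}sx := (smooth_on_coordP x oU).1 sx; have {}sy := (smooth_on_coordP y oU).1 sy.
apply: (@Ck_eq _ _ _ _ (fun v => \sum_j \sum_l x v 0 j * G j l * y v 0 l)) => //.
  by move=> v _; rewrite bformE.
apply: Ck_sum => // j _; apply: Ck_sum => // l _.
apply: (@CkM _ _ _ _ (fun v => x v 0 j * G j l) (fun v => y v 0 l)) => //; last exact: sy.
by apply: CkM => //; [exact: sx|exact: Ck_cst].
Qed.

End BilinearForm.

Section Frame.
Context {R : realType} {N L : nat}.
Variables (G : 'M[R]_(N + L)) (eta : 'M[R]_N) (mu : 'M[R]_L).
Variables (A : 'M[R]_(N, N + L)) (B : 'M[R]_(L, N + L)).
Hypotheses (Gsym : G^T = G) (eta_unit : eta \in unitmx) (mu_unit : mu \in unitmx).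
Hypothesis AA : A *m G *m A^T = eta.
Hypothesis AB : A *m G *m B^T = 0.
Hypothesis BB : B *m G *m B^T = mu.

Lemma frame_gram : col_mx A B *m G *m (col_mx A B)^T = block_mx eta 0 0 mu.
Proof.
have BA : B *m G *m A^T = 0.
  by apply: trmx_inj; rewrite !trmx_mul trmxK Gsym mulmxA AB trmx0.
by rewrite tr_col_mx mul_col_mx mul_col_row AA AB BA BB.
Qed.

Lemma block_diag_inv :
  block_mx eta 0 0 mu *m block_mx (invmx eta) 0 0 (invmx mu) = 1%:M.
Proof.
by rewrite mulmx_block !mulmx0 !mul0mx !addr0 !add0r !mulmxV// -scalar_mx_block.
Qed.

Lemma frame_unit : col_mx A B \in unitmx.
Proof.
have : col_mx A B *m (G *m (col_mx A B)^T *m block_mx (invmx eta) 0 0 (invmx mu)) = 1%:M.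
  by rewrite !mulmxA frame_gram block_diag_inv.
by move=> /mulmx1_unit[].
Qed.

(** With [F] the frame and [D] the inverse of its Gram matrix, [F *m (G *m F^T *m D) = 1]. The
    matrices are square, so the product in the other order is 1 too, and
    [G = G *m F^T *m D *m F *m G] splits into a tangential and a normal sum. *)
Lemma bform_frame x y : bform G x y =
  \sum_i \sum_j invmx eta i j * (bform G x (row i A) * bform G y (row j A)) +
  \sum_a \sum_b invmx mu a b * (bform G x (row a B) * bform G y (row b B)).
Proof.
pose F := col_mx A B; pose D := block_mx (invmx eta) 0 0 (invmx mu).
have E : G = G *m F^T *m D *m F *m G.
  have /mulmx1C H : F *m (G *m F^T *m D) = 1%:M.
    by rewrite !mulmxA frame_gram block_diag_inv.
  by rewrite H mul1mx.
have E2 : G = G *m A^T *m invmx eta *m A *m G + G *m B^T *m invmx mu *m B *m G.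
  have E3 : F^T *m D *m F = A^T *m invmx eta *m A + B^T *m invmx mu *m B.
    by rewrite tr_col_mx mul_row_block !mulmx0 addr0 add0r mul_row_col.
  rewrite {1}E -[G *m F^T *m D]mulmxA -[G *m _ *m F]mulmxA E3.
  by rewrite mulmxDr mulmxDl !mulmxA.
have half k (C : 'M[R]_k) (K : 'M[R]_(k, N + L)) :
    bform (G *m K^T *m C *m K *m G) x y =
    \sum_i \sum_j C i j * (bform G x (row i K) * bform G y (row j K)).
  rewrite /bform.
  have -> : x *m (G *m K^T *m C *m K *m G) *m y^T =
      (x *m G *m K^T) *m C *m (y *m G *m K^T)^T.
    by rewrite !trmx_mul trmxK Gsym !mulmxA.
  rewrite -/(bform C _ _) bformE; apply: eq_bigr => i _; apply: eq_bigr => j _.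
  rewrite !mulmx_bform.
  have row0 (z : 'rV[R]_(N + L)) : row 0 z = z by apply/rowP => s; rewrite mxE.
  by rewrite !row0; ring.
rewrite {1}E2 /bform mulmxDr mulmxDl mxE -!/(bform _ _ _).
by rewrite !half.
Qed.

End Frame.

Lemma sum2_mul0l (R : pzRingType) (m : nat) (c : 'I_m -> 'I_m -> R) (X Y : 'I_m -> R) :
  (forall i, X i = 0) -> \sum_i \sum_j c i j * (X i * Y j) = 0.
Proof. by move=> X0; rewrite big1// => i _; rewrite big1// => j _; rewrite X0 mul0r mulr0. Qed.

Lemma sum2_mul0r (R : pzRingType) (m : nat) (c : 'I_m -> 'I_m -> R) (X Y : 'I_m -> R) :
  (forall i, Y i = 0) -> \sum_i \sum_j c i j * (X i * Y j) = 0.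
Proof. by move=> Y0; rewrite big1// => i _; rewrite big1// => j _; rewrite Y0 !mulr0. Qed.

Lemma sum2_mulrB (R : pzRingType) (m : nat) (c X Y : 'I_m -> 'I_m -> R) :
  \sum_i \sum_j c i j * X i j = \sum_i \sum_j c i j * Y i j ->
  \sum_i \sum_j c i j * (X i j - Y i j) = 0.
Proof.
move=> XY; transitivity (\sum_i \sum_j c i j * X i j - \sum_i \sum_j c i j * Y i j).
  by rewrite -sumrB; apply: eq_bigr => i _; rewrite -sumrB; apply: eq_bigr => j _; rewrite mulrBr.
by rewrite XY subrr.
Qed.

Section FundamentalEquations.
Context {R : realType} {N L : nat}.

Lemma partial_comm_rV m (r : 'rV[R]_N -> 'rV[R]_m) U i j x : open U ->
  smooth_on U r -> U x -> partial i (partial j r) x = partial j (partial i r) x.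
Proof.
move=> oU sr Ux; apply/rowP => s.
have sd l y : U y -> differentiable (partial l r) y.
  by move=> Uy; exact: smooth_on_diff (smooth_on_partial l sr) Uy.
have E a b : (partial a (partial b r) x) 0 s =
    partial a (partial b (fun y => r y 0 s)) x.
  rewrite partial_coord; last exact: sd.
  apply: (eq_on_partial _ oU) => // y Uy.
  by apply: partial_coord; exact: smooth_on_diff sr Uy.
apply: (etrans (E i j)); apply: (etrans _ (esym (E j i))).
have C2 : Ck 2 U (fun y => r y 0 s) := (smooth_on_coordP r oU).1 sr s 2%N.
exact: (partial_comm i j oU C2 Ux).
Qed.

(** The Codazzi condition closes each row of [h] and gives functions [f (a, i)]; the symmetry of [h]
    then says that these are closed in [i]. *)
Lemma hessian_potential (I : finType) (U : set 'rV[R]_N) (q : 'rV[R]_N)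
    (h : I -> 'I_N -> 'I_N -> 'rV[R]_N -> R) : open U -> U q ->
  (forall a i j, smooth U (h a i j)) ->
  (forall a i j x, U x -> h a i j x = h a j i x) ->
  (forall a i j k x, U x -> partial k (h a i j) x = partial j (h a i k) x) ->
  exists (e : R) (psi : I -> 'rV[R]_N -> R),
    [/\ 0 < e, ball q e `<=` U, forall a, smooth (ball q e) (psi a) &
      forall a i j x, ball q e x -> partial j (partial i (psi a)) x = h a i j x].
Proof.
move=> oU Uq sh hC dh.
have [e1 [f [e10 eU sf _ df]]] := @poincare R N U (I * 'I_N)%type
  (fun p j => h p.1 p.2 j) q (fun=> 0) oU Uq (fun p => sh _ _)
  (fun p i j x Ux => dh _ _ _ _ x Ux).
have ob e : open (ball q e) by exact: ball_open.
have [e2 [psi [e20 e21 sp _ dp]]] := @poincare R N (ball q e1) I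
  (fun a i => f (a, i)) q (fun=> 0) (ob e1) (ballxx q e10) (fun a i => sf _)
  (fun a i j x qx => etrans (df (a, j) i x qx)
     (etrans (hC a j i x (eU x qx)) (esym (df (a, i) j x qx)))).
exists e2, psi; split=> //; first exact: subset_trans eU.
move=> a i j x qx; rewrite -(df (a, i) j x (e21 x qx)).
by apply: (eq_on_partial _ (ob e2)) => // y; exact: dp.
Qed.

Variables (G : 'M[R]_(N + L)) (W : set 'rV[R]_N) (r : 'rV[R]_N -> 'rV[R]_(N + L)).
Variables (n : 'I_L -> 'rV[R]_N -> 'rV[R]_(N + L)) (eta : 'M[R]_N) (mu : 'M[R]_L).
Hypotheses (Gsym : G^T = G) (oW : open W) (sr : smooth_on W r).
Hypotheses (sn : forall a, smooth_on W (n a)).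
Hypotheses (eta_unit : eta \in unitmx) (mu_unit : mu \in unitmx).
Hypothesis first_eta : forall w, W w -> first_form G r w = eta.
Hypothesis nr : forall a i u, W u -> bform G (n a u) (partial i r u) = 0.
Hypothesis nn : forall a b u, W u -> bform G (n a u) (n b u) = mu a b.
Hypothesis torsion0 : forall a b i u, W u -> torsion_form G n a b i u = 0.

Let sri i : smooth_on W (partial i r). Proof. exact: smooth_on_partial. Qed.
Let srij i j : smooth_on W (partial j (partial i r)).
Proof. exact: smooth_on_partial. Qed.
Let sni a i : smooth_on W (partial i (n a)). Proof. exact: smooth_on_partial. Qed.

Lemma first_formE i j u : W u ->
  bform G (partial i r u) (partial j r u) = eta i j.
Proof. by move=> Wu; rewrite -(first_eta Wu) mxE. Qed.

Let dbform (x y : 'rV[R]_N -> 'rV[R]_(N + L)) (c : R) i u :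
  smooth_on W x -> smooth_on W y -> (forall v, W v -> bform G (x v) (y v) = c) ->
  W u -> bform G (partial i x u) (y u) + bform G (x u) (partial i y u) = 0.
Proof.
move=> sx sy xy Wu; rewrite -partial_bform; try exact: smooth_on_diff Wu.
by rewrite (eq_on_partial _ oW Wu xy) partial_cst.
Qed.

(** The numbers [c a b d] are symmetric in the first two indices and, the metric being constant,
    antisymmetric in the first and third. Alternating the two rules gives [c = - c]. *)
Lemma second_derivative_normal i j k u : W u ->
  bform G (partial j (partial i r) u) (partial k r u) = 0.
Proof.
move=> Wu; pose c a b d := bform G (partial b (partial a r) u) (partial d r u).
have cS a b d : c a b d = c b a d by rewrite /c (partial_comm_rV _ _ oW).
have cA a b d : c a b d = - c d b a.
  apply/eqP; rewrite -addr_eq0 /c [X in _ + X]bformC//.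
  by apply/eqP; apply: dbform (@first_formE a d) Wu.
have E : c i j k = - c i j k.
  by rewrite {1}cA {1}cS {1}cA opprK {1}cS cA cS.
apply/eqP; move/eqP: E; rewrite -addr_eq0 -mulr2n mulrn_eq0 //=.
Qed.

Lemma normal_derivative_tangent a i j u : W u ->
  bform G (partial i (n a) u) (partial j r u) = - second_form G r n a u j i.
Proof.
move=> Wu; apply/eqP; rewrite -addr_eq0 mxE; apply/eqP.
by apply: dbform Wu => //; exact: nr.
Qed.

Lemma bform_expand x y u : W u -> bform G x y =
  \sum_i \sum_j invmx eta i j * (bform G x (partial i r u) * bform G y (partial j r u)) +
  \sum_a \sum_b invmx mu a b * (bform G x (n a u) * bform G y (n b u)).
Proof.
move=> Wu.
rewrite (@bform_frame _ _ _ G eta mu (\matrix_i partial i r u) (\matrix_a n a u))//.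
- by congr (_ + _); apply: eq_bigr => i _; apply: eq_bigr => j _; rewrite !rowK.
- by apply/matrixP => i j; rewrite mulmx_bform !rowK first_formE.
- by apply/matrixP => i j; rewrite mulmx_bform !rowK mxE bformC// nr.
- by apply/matrixP => i j; rewrite mulmx_bform !rowK nn.
Qed.

Lemma second_form_sym a i j u : W u ->
  second_form G r n a u i j = second_form G r n a u j i.
Proof. by move=> Wu; rewrite !mxE (partial_comm_rV _ _ oW). Qed.

Lemma second_form_smooth a i j : smooth W (fun u => second_form G r n a u i j).
Proof.
move=> k; apply: (@Ck_eq _ _ _ _ (fun u => bform G (n a u) (partial j (partial i r) u))) => //.
  by move=> u _; rewrite mxE.
exact: smooth_bform.
Qed.

Lemma codazzi a i j k u : W u ->
  partial k (fun u => second_form G r n a u i j) u =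
  partial j (fun u => second_form G r n a u i k) u.
Proof.
move=> Wu.
have E l s : partial s (fun u => second_form G r n a u i l) u =
    bform G (n a u) (partial s (partial l (partial i r)) u).
  rewrite (_ : (fun u => _) = (fun u => bform G (n a u) (partial l (partial i r) u))).
    rewrite partial_bform; try exact: smooth_on_diff Wu.
    (* In the frame expansion the tangential sum vanishes because second derivatives of [r] are
       normal, the normal sum because the torsion is zero. *)
    have -> : bform G (partial s (n a) u) (partial l (partial i r) u) = 0.
      rewrite (bform_expand _ _ Wu) sum2_mul0r ?sum2_mul0l ?addr0// => b.
        exact: torsion0.
      exact: second_derivative_normal.
    by rewrite add0r.
  by apply/funext => v; rewrite mxE.
apply: (etrans (E j k)); apply: (etrans _ (esym (E k j))).
exact: (congr1 (bform G (n a u)) (partial_comm_rV k j oW (sri i) Wu)).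
Qed.

(** Contraction with [invmx mu] is the frame expansion of the product of two second derivatives,
    whose tangential half vanishes. Its antisymmetrisation is a commutator of third derivatives. *)
Lemma gauss i j k l u : W u ->
  \sum_a \sum_b invmx mu a b *
    (second_form G r n a u i k * second_form G r n b u j l
     - second_form G r n a u i l * second_form G r n b u j k) = 0.
Proof.
move=> Wu.
have E s t : \sum_a \sum_b invmx mu a b *
    (second_form G r n a u i s * second_form G r n b u j t) =
    bform G (partial s (partial i r) u) (partial t (partial j r) u).
  rewrite (bform_expand _ _ Wu) [X in _ = X + _]sum2_mul0l ?add0r.
    apply: eq_bigr => a _; apply: eq_bigr => b _; rewrite !mxE.
    by congr (_ * (_ * _)); exact: bformC.
  by move=> a; exact: second_derivative_normal.
have F s t : bform G (partial s (partial i r) u) (partial t (partial j r) u) =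
    - bform G (partial t (partial s (partial i r)) u) (partial j r u).
  apply/eqP; rewrite -addr_eq0 addrC; apply/eqP.
  by apply: dbform Wu => // v Wv; exact: second_derivative_normal.
apply: sum2_mulrB.
apply: (etrans (E k l)); apply: (etrans _ (esym (E l k))).
apply: (etrans (F k l)); apply: (etrans _ (esym (F l k))).
exact: (congr1 (fun z => - bform G z (partial j r u)) (partial_comm_rV l k oW (sri i) Wu)).
Qed.

(** The counterpart of [gauss] for derivatives of normals: here the normal half of the frame
    expansion vanishes. *)
Lemma ricci k l a b u : W u ->
  \sum_i \sum_j invmx eta i j *
    (second_form G r n a u i k * second_form G r n b u j l
     - second_form G r n a u i l * second_form G r n b u j k) = 0.
Proof.
move=> Wu.
have E s t : \sum_i \sum_j invmx eta i j *
    (second_form G r n a u i s * second_form G r n b u j t) =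
    bform G (partial s (n a) u) (partial t (n b) u).
  rewrite (bform_expand _ _ Wu) [X in _ = _ + X]sum2_mul0l ?addr0.
    apply: eq_bigr => i _; apply: eq_bigr => j _; congr (_ * _).
    by rewrite !normal_derivative_tangent// mulrNN.
  by move=> c; exact: torsion0.
have F s t : bform G (partial s (n a) u) (partial t (n b) u) =
    - bform G (partial t (partial s (n a)) u) (n b u).
  apply/eqP; rewrite -addr_eq0 addrC; apply/eqP.
  by apply: dbform Wu => // v Wv; exact: torsion0.
apply: sum2_mulrB.
apply: (etrans (E k l)); apply: (etrans _ (esym (E l k))).
apply: (etrans (F k l)); apply: (etrans _ (esym (F l k))).
exact: (congr1 (fun z => - bform G z (n b u)) (partial_comm_rV l k oW (sn a) Wu)).
Qed.

End FundamentalEquations.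

(** * Signatures *)

Section Signature.
Context {R : realType}.

Definition sign_row (p m : nat) : 'rV[R]_m := \row_(i < m) (if (i < p)%N then 1 else -1).

Lemma sum_sign_row p q m (a : pred R) : (p + q)%N = m ->
  (\sum_(i < m) a (sign_row p m 0%R i) = p * a 1%R + q * a (-1)%R)%N.
Proof.
move=> <-; rewrite big_split_ord /=; congr (_ + _)%N.
  rewrite (eq_bigr (fun=> a 1 : nat)) ?sum_nat_const ?card_ord// => i _.
  by rewrite mxE /= ltn_ord.
rewrite (eq_bigr (fun=> a (-1) : nat)) ?sum_nat_const ?card_ord// => i _.
by rewrite mxE /= ltnNge leq_addr.
Qed.

(** Juxtaposed diagonals put the -1 entries of the first before the +1 entries of the second,
    whereas [has_signature] wants all +1 first. Both lists contain each value equally often, so a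
    permutation relates them. *)
Lemma sign_row_perm p1 q1 p2 q2 (N L : nat) :
  (p1 + q1)%N = N -> (p2 + q2)%N = L ->
  exists s : 'S_(N + L), forall i,
    sign_row (p1 + p2) (N + L) 0 i = (row_mx (sign_row p1 N) (sign_row p2 L)) 0 (s i).
Proof.
move=> NE LE; set d := row_mx _ _.
have count_tuple (v : 'rV[R]_(N + L)) a :
    count a [tuple v 0 i | i < N + L] = (\sum_i a (v 0%R i))%N.
  by rewrite count_map -sum1_count big_mkcond big_enum /=; apply: eq_bigr => i _; case: (a _).
have : perm_eq [tuple sign_row (p1 + p2) (N + L) 0 i | i < N + L] [tuple d 0 i | i < N + L].
  apply/seq.permP => a; rewrite !count_tuple (@sum_sign_row _ (q1 + q2)).
    rewrite big_split_ord /=.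
    have -> : (\sum_(i < N) a (d 0%R (lshift L i)) = \sum_(i < N) a (sign_row p1 N 0%R i))%N.
      by apply: eq_bigr => i _; rewrite /d row_mxEl.
    have -> : (\sum_(i < L) a (d 0%R (rshift N i)) = \sum_(i < L) a (sign_row p2 L 0%R i))%N.
      by apply: eq_bigr => i _; rewrite /d row_mxEr.
    by rewrite (sum_sign_row a NE) (sum_sign_row a LE) !mulnDl addnACA.
  by rewrite -NE -LE addnACA.
move=> /tuple_permP[s sE]; exists s => i.
have := congr1 (fun t : seq R => nth 0 t i) sE.
by rewrite -!tnth_nth !tnth_mktuple.
Qed.

(** Lower and upper indices give the same signature: the sign matrix is its own inverse, so a
    congruence of [invmx A] with it inverts to one of [A]. The two congruences form a block matrix,
    and a permutation sorts the signs. *)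
Lemma signature_congruence N L (eta : 'M[R]_N) (mu : 'M[R]_L) (G F : 'M[R]_(N + L)) :
  eta^T = eta -> mu^T = mu ->
  eta \in unitmx -> mu \in unitmx -> F \in unitmx ->
  F *m G *m F^T = block_mx eta 0 0 mu ->
  signature_is_sum (invmx eta) (invmx mu) G.
Proof.
move=> etaT muT ueta umu uF FGF p1 q1 p2 q2 [NE [P1 uP1 D1]] [LE [P2 uP2 D2]].
split; first by rewrite addnACA NE LE.
have inv_congr m p (A P : 'M[R]_m) : A \in unitmx -> P \in unitmx ->
    P *m invmx A *m P^T = diag_mx (sign_row p m) ->
    (invmx P)^T *m A *m invmx P = diag_mx (sign_row p m).
  move=> uA uP E; set D := diag_mx _ in E *.
  have DD : D *m D = 1%:M.
    rewrite /D mulmx_diag -diag_const_mx; congr diag_mx; apply/rowP => i.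
    by rewrite !mxE; case: ifP => _; rewrite ?mulr1 ?mulrNN ?mulr1.
  have uPT : P^T \in unitmx by rewrite unitmx_tr.
  have H : (invmx P)^T *m A *m invmx P *m D = 1%:M.
    rewrite -E trmx_inv !mulmxA mulmxKV// mulmxK//.
    by rewrite mulVmx.
  by rewrite -[LHS]mulmx1 -DD mulmxA H mul1mx.
have E1 := inv_congr _ p1 _ _ ueta uP1 D1.
have E2 := inv_congr _ p2 _ _ umu uP2 D2.
have [s sE] := sign_row_perm NE LE.
pose S := block_mx (invmx P1)^T 0 0 (invmx P2)^T.
exists (perm_mx s *m S *m F).
  rewrite !unitmx_mul unitmx_perm uF andbT /= unitmxE det_ublock.
  by rewrite unitrM -!unitmxE !unitmx_tr !unitmx_inv uP1.
have -> : perm_mx s *m S *m F *m G *m (perm_mx s *m S *m F)^T =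
    perm_mx s *m (S *m (F *m G *m F^T) *m S^T) *m (perm_mx s)^T.
  by rewrite !trmx_mul !mulmxA.
have -> : S *m (F *m G *m F^T) *m S^T =
    diag_mx (row_mx (sign_row p1 N) (sign_row p2 L)).
  rewrite FGF /S tr_block_mx !trmx0 !trmxK !mulmx_block.
  by rewrite !mulmx0 !mul0mx !addr0 !add0r !mul0mx E1 E2 diag_mx_row.
apply/matrixP => i j.
rewrite -row_permE tr_perm_mx -col_permE mxE mxE mxE (inj_eq perm_inj) -sE.
by rewrite !mxE.
Qed.

End Signature.

(** * Change of coordinates *)

Section ChartChange.
Context {R : realType} {N : nat}.

Lemma partial_comp_rV M m (r : 'rV[R]_M -> 'rV[R]_m) (phi : 'rV[R]_N -> 'rV[R]_M) i w :
  differentiable phi w -> differentiable r (phi w) ->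
  partial i (r \o phi) w =
  \sum_j partial i (fun v => phi v 0 j) w *: partial j r (phi w).
Proof.
move=> dphi dr; apply/rowP => s; rewrite summxE.
have drs : differentiable (fun y => r y 0 s) (phi w) by have /differentiable_coordP := dr.
rewrite partial_coord; last exact: differentiable_comp.
rewrite (partial_comp i dphi drs); apply: eq_bigr => j _.
by rewrite mxE partial_coord.
Qed.

Lemma smooth_on_comp M m (U : set 'rV[R]_M) (W : set 'rV[R]_N)
    (r : 'rV[R]_M -> 'rV[R]_m) (phi : 'rV[R]_N -> 'rV[R]_M) :
  open U -> open W -> (forall w, W w -> U (phi w)) ->
  smooth_on U r -> smooth_on W phi -> smooth_on W (r \o phi).
Proof.
move=> oU oW WU sr sphi; apply/smooth_on_coordP => // s k.
apply: (@Ck_comp _ _ _ k W U (fun y => r y 0 s)) => //.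
  exact: ((smooth_on_coordP r oU).1 sr s k).
by move=> j; exact: ((smooth_on_coordP phi oW).1 sphi j k).
Qed.

Definition chart_jacobian M (phi : 'rV[R]_N -> 'rV[R]_M) (w : 'rV[R]_N) : 'M[R]_(N, M) :=
  \matrix_(i, j) partial i (fun v => phi v 0 j) w.

Lemma chart_jacobian_unit (U W : set 'rV[R]_N) phi w :
  coordinate_change W U phi -> W w -> chart_jacobian phi w \in unitmx.
Proof.
move=> [oW sphi oI _ [chi schi chiK]] Ww.
have Iw : (phi @` W) (phi w) by exists w.
have dphi := smooth_on_diff sphi Ww; have dchi := smooth_on_diff schi Iw.
suff /mulmx1_unit[] : chart_jacobian phi w *m chart_jacobian chi (phi w) = 1%:M by [].
apply/matrixP => i k; rewrite !mxE.
have dk : differentiable (fun y => chi y 0 k) (phi w).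
  by have /differentiable_coordP := dchi.
under eq_bigr do rewrite !mxE.
rewrite -(partial_comp i dphi dk).
have E v : W v -> ((fun y => chi y 0 k) \o phi) v = (fun v : 'rV[R]_N => v 0 k) v.
  by move=> /chiK /= ->.
rewrite (eq_on_partial _ oW Ww E) -(@partial_coord _ _ _ id i k w)//.
by rewrite /partial derive_id mxE eqxx eq_sym.
Qed.

Lemma first_form_comp (L : nat) (G : 'M[R]_(N + L)) (r : 'rV[R]_N -> 'rV[R]_(N + L))
    (phi : 'rV[R]_N -> 'rV[R]_N) w : G^T = G ->
  differentiable phi w -> differentiable r (phi w) ->
  first_form G (r \o phi) w =
  chart_jacobian phi w *m first_form G r (phi w) *m (chart_jacobian phi w)^T.
Proof.
move=> GT dphi dr; apply/matrixP => i j; rewrite mxE !partial_comp_rV//.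
transitivity (\sum_k \sum_l chart_jacobian phi w i k *
  first_form G r (phi w) k l * chart_jacobian phi w j l).
  rewrite bform_suml; apply: eq_bigr => k _.
  rewrite bformZl bform_sumr// mulr_sumr; apply: eq_bigr => l _.
  by rewrite bformZr// !mxE mulrA [RHS]mulrAC.
rewrite [RHS]mxE exchange_big /=; apply: eq_bigr => l _.
by rewrite [in RHS]mxE mulr_suml [_^T l j]mxE.
Qed.

Lemma torsionless_frame_comp L (G : 'M[R]_(N + L)) (U W : set 'rV[R]_N)
    (r : 'rV[R]_N -> 'rV[R]_(N + L)) (mu : 'M[R]_L)
    (n : 'I_L -> 'rV[R]_N -> 'rV[R]_(N + L)) (phi : 'rV[R]_N -> 'rV[R]_N) :
  G^T = G -> open U -> open W -> (forall w, W w -> U (phi w)) ->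
  smooth_on U r -> smooth_on W phi ->
  torsionless_frame G U r mu n ->
  torsionless_frame G W (r \o phi) mu (fun a => n a \o phi).
Proof.
move=> GT oU oW WU sr sphi [[umu sn nr nn] tn].
have dphi w : W w -> differentiable phi w by exact: smooth_on_diff.
split; first split=> //.
- by move=> a; exact: smooth_on_comp WU (sn a) sphi.
- move=> a i w Ww; have Uw := WU w Ww.
  rewrite partial_comp_rV//; try exact: dphi; try exact: smooth_on_diff sr Uw.
  by rewrite bform_sumr// big1// => j _; rewrite bformZr// [X in _ * X]nr// mulr0.
- by move=> a b w /WU Uw; exact: nn.
move=> a b i w Ww; have Uw := WU w Ww.
rewrite /torsion_form partial_comp_rV//; try exact: dphi;
  try exact: smooth_on_diff (sn a) Uw.
rewrite bform_suml big1// => j _; rewrite bformZl.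
by rewrite [X in _ * X](tn a b j _ Uw) mulr0.
Qed.

End ChartChange.

(** * From flat torsionless submanifolds to potentials *)

Section Potentials.
Context {R : realType} {N L : nat}.

Lemma nondeg_sym_inv m (A : 'M[R]_m) : nondeg_sym A -> nondeg_sym (invmx A).
Proof. by move=> [AT uA]; split; rewrite ?unitmx_inv// trmx_inv AT. Qed.

Lemma potentials_exist (G : 'M[R]_(N + L)) (W : set 'rV[R]_N)
    (r : 'rV[R]_N -> 'rV[R]_(N + L)) (mu : 'M[R]_L) (eta : 'M[R]_N)
    (n : 'I_L -> 'rV[R]_N -> 'rV[R]_(N + L)) q :
  G^T = G -> open W -> W q -> smooth_on W r -> eta \in unitmx ->
  (forall w, W w -> first_form G r w = eta) -> torsionless_frame G W r mu n ->
  exists (V : set 'rV[R]_N) (psi : 'I_L -> 'rV[R]_N -> R),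
    [/\ [/\ open V, V q & V `<=` W], forall a : 'I_L, smooth_on V (psi a),
      psi_system (invmx eta) (invmx mu) V psi &
      forall (a : 'I_L) (u : 'rV[R]_N), V u -> second_form G r n a u = hessian (psi a) u].
Proof.
move=> GT oW Wq sr ueta first_eta [[umu sn nr nn] tn].
have [e [psi [e0 eW spsi hpsi]]] := @hessian_potential R N 'I_L W q
  (fun a i j u => second_form G r n a u i j) oW Wq
  (second_form_smooth G oW sr sn)
  (second_form_sym G n oW sr)
  (codazzi GT oW sr sn ueta umu first_eta nr nn tn).
have E a u : ball q e u -> second_form G r n a u = hessian (psi a) u.
  by move=> qu; apply/matrixP => i j; rewrite [RHS]mxE hpsi.
exists (ball q e), psi; split=> //.
- by split=> //; [exact: ball_open|exact: ballxx].
- by move=> a; apply/smooth_onP.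
- move=> u qu; have Wu := eW u qu; split=> [i j k l|k l a b].
    rewrite -[RHS](gauss GT oW sr ueta umu first_eta nr nn i j k l Wu).
    by apply: eq_bigr => a _; apply: eq_bigr => b _; rewrite !E.
  rewrite -[RHS](ricci GT oW sr sn ueta umu first_eta nr nn tn k l a b Wu).
  by apply: eq_bigr => i _; apply: eq_bigr => j _; rewrite !E.
Qed.

Lemma flat_chart_potentials (G : 'M[R]_(N + L)) (U : set 'rV[R]_N)
    (r : 'rV[R]_N -> 'rV[R]_(N + L)) (mu : 'M[R]_L)
    (n : 'I_L -> 'rV[R]_N -> 'rV[R]_(N + L))
    (W : set 'rV[R]_N) (phi : 'rV[R]_N -> 'rV[R]_N) (eta : 'M[R]_N) (q : 'rV[R]_N) :
  nondeg_sym G -> nonisotropic_submanifold G U r -> torsionless_frame G U r mu n ->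
  flat_coordinates G U r W phi eta -> W q ->
  [/\ nondeg_sym (invmx eta), nondeg_sym (invmx mu),
      signature_is_sum (invmx eta) (invmx mu) G &
      exists (V : set 'rV[R]_N) (psi : 'I_L -> 'rV[R]_N -> R),
        [/\ [/\ open V, V q & V `<=` W],
            forall a : 'I_L, smooth_on V (psi a),
            psi_system (invmx eta) (invmx mu) V psi &
            forall (a : 'I_L) (u : 'rV[R]_N), V u ->
              second_form G (r \o phi) (fun b => n b \o phi) a u = hessian (psi a) u]].
Proof.
move=> [GT uG] [oU sr ug] tf [cc ff] Wq.
have uJ := chart_jacobian_unit cc Wq.
have [oW sphi _ IU _] := cc.
have WU w : W w -> U (phi w) by move=> Ww; apply: IU; exists w.
have sr' := smooth_on_comp oU oW WU sr sphi.
have tf' := torsionless_frame_comp GT oU oW WU sr sphi tf.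
have dphi := smooth_on_diff sphi Wq; have dr := smooth_on_diff sr (WU q Wq).
have ueta : eta \in unitmx.
  rewrite -(ff q Wq) (first_form_comp GT)//.
  by rewrite !unitmx_mul uJ unitmx_tr uJ (ug _ (WU q Wq)).
have etaT : eta^T = eta.
  by rewrite -(ff q Wq); apply/matrixP => i j; rewrite !mxE bformC.
have [[umu sn nr nn] tn] := tf'.
have muT : mu^T = mu.
  by apply/matrixP => a b; rewrite mxE -!(nn _ _ q Wq) bformC.
split.
- exact: nondeg_sym_inv.
- exact: nondeg_sym_inv.
(* The signature is read off at the single point [q], where tangent vectors and normals form a basis
   with block diagonal Gram matrix. *)
- pose A := \matrix_i partial i (r \o phi) q; pose B := \matrix_a (n a \o phi) q.
  have AA : A *m G *m A^T = eta.
    by apply/matrixP => i j; rewrite mulmx_bform !rowK -(ff q Wq) mxE.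
  have AB : A *m G *m B^T = 0.
    by apply/matrixP => i j; rewrite mulmx_bform !rowK mxE bformC// [LHS]nr.
  have BB : B *m G *m B^T = mu.
    by apply/matrixP => i j; rewrite mulmx_bform !rowK [LHS]nn.
  apply: (signature_congruence etaT muT ueta umu (frame_unit GT ueta umu AA AB BB)).
  exact: frame_gram.
- exact: (potentials_exist GT oW Wq sr' ueta ff tf').
Qed.

End Potentials.

(** * Reconstruction of the submanifold *)

Section TensorSolutions.
Context {R : realType} {N : nat} {T : finType}.

(* Covariant 2-tensors that are parallel for the connection with coefficients c. *)
Definition tensor_solution (V : set 'rV[R]_N) (c : 'I_N -> T -> T -> 'rV[R]_N -> R)
    (K : T -> T -> 'rV[R]_N -> R) :=
  forall x, V x -> forall s t, differentiable (K s t) x /\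
    forall j, partial j (K s t) x =
      \sum_u (c j s u x * K u t x + c j t u x * K s u x).

(** A 2-tensor is a vector indexed by pairs, and parallelism is a linear system with coefficients
    [c] tensor 1 plus 1 tensor [c]. *)
Lemma tensor_solution_unique (U : set 'rV[R]_N) c (q : 'rV[R]_N) : open U -> U q ->
  (forall i a b, smooth U (c i a b)) ->
  exists2 e0 : R, 0 < e0 & forall e, 0 < e -> e <= e0 ->
    forall K K', tensor_solution (ball q e) c K -> tensor_solution (ball q e) c K' ->
      (forall s t, K s t q = K' s t q) ->
      forall x, ball q e x -> forall s t, K s t x = K' s t x.
Proof.
move=> oU Uq sc.
pose d (j : 'I_N) (p p' : T * T) : 'rV[R]_N -> R := fun x =>
  c j p.1 p'.1 x * (p.2 == p'.2)%:R + c j p.2 p'.2 x * (p.1 == p'.1)%:R.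
have sd j p p' : smooth U (d j p p').
  by move=> k; apply: CkD => //; apply: CkM => //; try exact: Ck_cst; exact: sc.
have [e0 e00 H] := linear_frobenius oU Uq sd.
exists e0 => // e e_gt0 ee0 K K' HK HK' KK' x qx s t.
have sol L : tensor_solution (ball q e) c L ->
    linear_solution (ball q e) d (fun p => L p.1 p.2).
  move=> HL y qy [a b]; have [dL pL] := HL y qy a b; split=> // j; rewrite pL.
  rewrite -(pair_bigA _ (fun u v => d j (a, b) (u, v) y * L u v y)) /=.
  rewrite big_split /=; apply/esym.
  rewrite (eq_bigr (fun u => c j a u y * L u b y +
    (a == u)%:R * \sum_v c j b v y * L u v y)); last first.
    move=> u _; rewrite /d /=.
    rewrite (eq_bigr (fun v => c j a u y * L u v y * (b == v)%:R +
      (a == u)%:R * (c j b v y * L u v y))); last by move=> v _; ring.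
    rewrite big_split /= -mulr_sumr; congr (_ + _).
    rewrite (bigD1 b)//= eqxx mulr1 big1 ?addr0// => v vb.
    by rewrite eq_sym (negbTE vb) mulr0.
  rewrite big_split /=; congr (_ + _).
  rewrite (bigD1 a)//= eqxx mul1r [X in _ + X]big1 ?addr0// => u ua.
  by rewrite eq_sym (negbTE ua) mul0r.
have [_ _ uniq] := H e e_gt0 ee0.
exact: (uniq _ _ (sol _ HK) (sol _ HK') (fun p => KK' p.1 p.2) x qx (s, t)).
Qed.

End TensorSolutions.

(** The common shape of the diagonal curvature blocks of the Gauss-Weingarten system: [A = muU]
    brings in the first family of equations, [A = etaU] the second. *)
Lemma sum_contract (R : comPzRingType) (I J : finType) (A : I -> I -> R)
    (X Z : I -> R) (Y W : I -> J -> R) (E : J -> R) :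
  (forall s, \sum_a \sum_b A a b * (X a * Y b s - Z a * W b s) = 0) ->
  \sum_b ((\sum_a A a b * X a) * (- \sum_s Y b s * E s)
          - (\sum_a A a b * Z a) * (- \sum_s W b s * E s)) = 0.
Proof.
move=> H.
transitivity (\sum_s - ((\sum_a \sum_b A a b * (X a * Y b s - Z a * W b s)) * E s)).
  rewrite (eq_bigr (fun b => \sum_s \sum_a
      - (A a b * (X a * Y b s - Z a * W b s) * E s))); last first.
    move=> b _; rewrite !mulrN opprK !big_distrlr /= [RHS]exchange_big -sumrN -big_split.
    apply: eq_bigr => a _; rewrite -sumrN -big_split /=.
    by apply: eq_bigr => s _; ring.
  rewrite exchange_big; apply: eq_bigr => s _ /=.
  rewrite exchange_big mulr_suml -sumrN; apply: eq_bigr => a _ /=.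
  by rewrite mulr_suml -sumrN.
by rewrite big1// => s _; rewrite H mul0r oppr0.
Qed.

Lemma sum_mul0l (R : pzRingType) (I : finType) (f g : I -> R) :
  \sum_m (0 * f m - 0 * g m) = 0.
Proof. by rewrite big1// => m _; rewrite !mul0r subrr. Qed.

Lemma sum_mul0r (R : pzRingType) (I : finType) (f g : I -> R) :
  \sum_m (f m * 0 - g m * 0) = 0.
Proof. by rewrite big1// => m _; rewrite !mulr0 subrr. Qed.

Lemma sum_swap (R : comPzRingType) (I J : finType) (e : I -> R) (u : J -> R)
    (X Z : I -> R) (Y W : J -> R) :
  (- \sum_s X s * e s) * (\sum_d u d * Y d) - (- \sum_s Z s * e s) * (\sum_d u d * W d) =
  (\sum_s e s * X s) * (- \sum_d Y d * u d) - (\sum_s e s * Z s) * (- \sum_d W d * u d).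
Proof.
have E (K : finType) (f g : K -> R) : \sum_s f s * g s = \sum_s g s * f s.
  by apply: eq_bigr => s _; rewrite mulrC.
by rewrite (E _ X) (E _ Z) (E _ u Y) (E _ u W) !mulNr !mulrN.
Qed.

Lemma contract_inv (R : comPzRingType) m (A B : 'M[R]_m) (f g : 'I_m -> R) i :
  A *m B = 1%:M -> (forall k, g k = B k i) ->
  \sum_k (\sum_s f s * A s k) * g k = f i.
Proof.
move=> AB gB; transitivity (\sum_s f s * (A *m B) s i).
  under eq_bigr do rewrite gB mulr_suml.
  rewrite exchange_big; apply: eq_bigr => s _; rewrite mxE mulr_sumr.
  by apply: eq_bigr => k _; rewrite mulrA.
rewrite AB (bigD1 i)//= mxE eqxx mulr1 big1 ?addr0// => s si.
by rewrite mxE (negbTE si) mulr0.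
Qed.

Lemma sum_add0l (R : pzRingType) (I : finType) (f g : I -> R) :
  \sum_m (0 * f m + 0 * g m) = 0.
Proof. by rewrite big1// => m _; rewrite !mul0r addr0. Qed.

Lemma sum_add0r (R : pzRingType) (I : finType) (f g : I -> R) :
  \sum_m (f m * 0 + g m * 0) = 0.
Proof. by rewrite big1// => m _; rewrite !mulr0 addr0. Qed.

Lemma sum_addDl (R : pzRingType) (I : finType) (f g : I -> R) :
  \sum_m (0 * 0 + f m * g m) = \sum_m f m * g m.
Proof. by apply: eq_bigr => m _; rewrite mul0r add0r. Qed.

Lemma sum_addDr (R : pzRingType) (I : finType) (f g : I -> R) :
  \sum_m (f m * g m + 0 * 0) = \sum_m f m * g m.
Proof. by apply: eq_bigr => m _; rewrite mul0r addr0. Qed.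

Lemma constant_metric_flat (R : realType) N (V : set 'rV[R]_N) (g : 'rV[R]_N -> 'M[R]_N)
    (eta : 'M[R]_N) : open V -> (forall u, V u -> g u = eta) -> flat_metric V g.
Proof.
move=> oV gE.
have dg i a b u : V u -> partial i (fun v => g v a b) u = 0.
  move=> Vu; have E v : V v -> (fun v => g v a b) v = cst (eta a b) v by move=> /gE /= ->.
  by rewrite (eq_on_partial _ oV Vu E) partial_cst.
have ch k i j u : V u -> christoffel g k i j u = 0.
  move=> Vu; rewrite /christoffel big1 ?mulr0// => l _.
  by rewrite !dg// subr0 addr0 mulr0.
have dch l k i j u : V u -> partial l (christoffel g k i j) u = 0.
  move=> Vu; have E v : V v -> christoffel g k i j v = cst 0 v by exact: ch.
  by rewrite (eq_on_partial _ oV Vu E) partial_cst.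
move=> k l i j u Vu; rewrite /riemann !dch// subrr add0r big1// => m _.
by rewrite !ch// !mul0r subrr.
Qed.

(** * Integration of the Gauss-Weingarten system *)

Section Bonnet.
Context {R : realType} {N L : nat}.
Variables (etaU : 'M[R]_N) (muU : 'M[R]_L) (U : set 'rV[R]_N).
Variables (psi : 'I_L -> 'rV[R]_N -> R) (q : 'rV[R]_N).
Hypotheses (eta_sym : nondeg_sym etaU) (mu_sym : nondeg_sym muU) (oU : open U).
Hypotheses (psi_smooth : forall a, smooth U (psi a)) (Uq : U q).
Hypothesis psi_eq : psi_system etaU muU U psi.

(** For this ambient form the standard basis already has the Gram matrix required of the frame, so
    it serves as initial value at [q]. *)
Let G : 'M[R]_(N + L) := block_mx (invmx etaU) 0 0 (invmx muU).
Let h a i j : 'rV[R]_N -> R := partial j (partial i (psi a)).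

(* The Gauss-Weingarten equations
   d_j r_i = mu^{ab} psi_{a,ij} n_b,  d_j n_a = - psi_{a,ij} eta^{ik} r_k. *)
Let c (j : 'I_N) (s t : 'I_N + 'I_L) : 'rV[R]_N -> R :=
  match s, t with
  | inl i, inr b => fun x => \sum_a muU a b * h a i j x
  | inr a, inl k => fun x => - \sum_i h a i j x * etaU i k
  | _, _ => fun=> 0
  end.

Let h_smooth a i j : smooth U (h a i j).
Proof. exact: smooth_partial (smooth_partial _ (psi_smooth a)). Qed.

Let h_sym a i j x : U x -> h a i j x = h a j i x.
Proof. by move=> Ux; apply: (partial_comm j i oU (psi_smooth a 2%N) Ux). Qed.

Let h_codazzi a i j k x : U x -> partial k (h a i j) x = partial j (h a i k) x.
Proof.
by move=> Ux; apply: (partial_comm k j oU (smooth_partial i (psi_smooth a) 2%N) Ux).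
Qed.

Let c_smooth j s t : smooth U (c j s t).
Proof.
case: s t => [i|a] [k|b] m; rewrite /c; try exact: Ck_cst.
- by apply: Ck_sum => // a _; apply: CkM => //; [exact: Ck_cst|exact: h_smooth].
- apply: CkN => //; apply: Ck_sum => // i _.
  by apply: CkM => //; [exact: h_smooth|exact: Ck_cst].
Qed.

Let dh a i j x : U x -> differentiable (h a i j) x.
Proof. by move=> Ux; exact: smooth_diff (h_smooth a i j) Ux. Qed.

(** Third derivatives of [psi] are symmetric, so the derivative part of the curvature vanishes and
    only its quadratic part is left to the system for [psi]. *)
Let c_closed i j s t x : U x -> partial i (c j s t) x = partial j (c i s t) x.
Proof.
move=> Ux; case: s t => [l|a] [k|b]; rewrite /c; try by rewrite !partial_cst.
- rewrite !partial_sum; try (by move=> a _; apply: differentiableM;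
    [exact: differentiable_cst|exact: dh]).
  apply: eq_bigr => a _; rewrite !partialMl; try exact: dh.
  exact: (congr1 (fun z => muU a b * z) (h_codazzi a l j i Ux)).
- have D m : forall i0 : 'I_N, true -> differentiable (fun y => h a i0 m y * etaU i0 k) x.
    by move=> i0 _; apply: differentiableM; [exact: dh|exact: differentiable_cst].
  rewrite !partialN; [|by apply: differentiable_sum_fin; exact: D..].
  rewrite !partial_sum; try exact: D.
  apply: congr1; apply: eq_bigr => l _; rewrite !partialMr; try exact: dh.
  exact: (congr1 (fun z => z * etaU l k) (h_codazzi a l j i Ux)).
Qed.

Let system_ext (f : 'I_L -> 'I_N -> 'I_N -> R) x : U x ->
  (forall a i j, f a i j = hessian (psi a) x i j) ->
  (forall i j k l : 'I_N, \sum_a \sum_b muU a b *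
     (f a i k * f b j l - f a i l * f b j k) = 0) /\
  (forall (k l : 'I_N) (a b : 'I_L), \sum_i \sum_j etaU i j *
     (f a i k * f b j l - f a i l * f b j k) = 0).
Proof.
move=> Ux fE; have -> : f = (fun a i j => hessian (psi a) x i j).
  by apply/funext => a; apply/funext => i; apply/funext => j.
exact: psi_eq.
Qed.

Let h_system x : U x ->
  (forall i j k l : 'I_N, \sum_a \sum_b muU a b *
     (h a i k x * h b j l x - h a i l x * h b j k x) = 0) /\
  (forall (k l : 'I_N) (a b : 'I_L), \sum_i \sum_j etaU i j *
     (h a i k x * h b j l x - h a i l x * h b j k x) = 0).
Proof.
move=> Ux; apply: (@system_ext (fun a i j => h a i j x) x Ux) => a i j.
by rewrite mxE.
Qed.

(** Since [c] exchanges tangent and normal indices, products of two coefficients are block diagonal: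
    the mixed blocks vanish identically and the diagonal blocks are contractions of the two families
    of equations. *)
Let c_flat : flat_coefficients U c.
Proof.
move=> i j s t x Ux; rewrite c_closed// subrr add0r big_sumType /=.
have [gauss_eq ricci_eq] := h_system Ux.
case: s t => [l|a] [k|b] /=.
- apply: (etrans (congr2 +%R (sum_mul0l _ _) _) (addr0 _)).
  apply: (@sum_contract _ _ _ muU (fun a => h a l j x) (fun a => h a l i x)
    (fun b s => h b s i x) (fun b s => h b s j x) (fun s => etaU s k)) => s.
  exact: gauss_eq.
- exact: (etrans (congr2 +%R (sum_mul0l _ _) (sum_mul0r _ _)) (addr0 _)).
- exact: (etrans (congr2 +%R (sum_mul0r _ _) (sum_mul0l _ _)) (addr0 _)).
- apply: (etrans (congr2 +%R _ (sum_mul0l _ _)) (addr0 _)).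
  have := @sum_contract _ _ _ etaU (fun s => h a s j x) (fun s => h a s i x)
    (fun s d => h d s i x) (fun s d => h d s j x) (fun d => muU d b)
    (fun d => ricci_eq j i a d).
  apply: etrans; apply: eq_bigr => m _.
  exact: sum_swap.
Qed.

Let D (s t : 'I_N + 'I_L) : R :=
  match s, t with
  | inl i, inl j => invmx etaU i j
  | inr a, inr b => invmx muU a b
  | _, _ => 0
  end.

(** Once [etaU] and [muU] cancel against their inverses, the Weingarten term is [- h a i j] and the
    Gauss term [h a i j]: tangents and normals remain orthogonal. *)
Let D_mixed x j i a (g1 : 'I_N -> R) (g2 : 'I_L -> R) :
  (forall m, g1 m = invmx etaU m i) -> (forall b, g2 b = invmx muU b a) ->
  \sum_m (- \sum_s h a s j x * etaU s m) * g1 m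
  + \sum_b (\sum_d muU d b * h d i j x) * g2 b = 0.
Proof.
have [etaT ueta] := eta_sym; have [muT umu] := mu_sym => E1 E2.
under eq_bigr do rewrite mulNr.
rewrite sumrN (@contract_inv _ _ etaU (invmx etaU) (fun s => h a s j x) g1 i)//;
  last exact: mulmxV.
under [X in _ + X]eq_bigr do under eq_bigr do rewrite mulrC.
rewrite (@contract_inv _ _ muU (invmx muU) (fun d => h d i j x) g2 a)//; last exact: mulmxV.
exact: addNr.
Qed.

Let inv_sym m (A : 'M[R]_m) i j : A^T = A -> invmx A i j = invmx A j i.
Proof. by move=> AT; rewrite -[in LHS]AT -trmx_inv mxE. Qed.

Let D_parallel x j s t : \sum_u (c j s u x * D u t + c j t u x * D s u) = 0.
Proof.
have [etaT _] := eta_sym; have [muT _] := mu_sym.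
rewrite big_sumType /=; case: s t => [i|a] [k|b] /=.
- exact: (etrans (congr2 +%R (sum_add0l _ _) (sum_add0r _ _)) (addr0 _)).
- apply: (etrans (congr2 +%R (sum_addDl _ _) (sum_addDr _ _))).
  by apply: D_mixed => // m; exact: inv_sym.
- apply: (etrans (congr2 +%R (sum_addDr _ _) (sum_addDl _ _))).
  by apply: D_mixed => // m; exact: inv_sym.
- exact: (etrans (congr2 +%R (sum_add0r _ _) (sum_add0l _ _)) (addr0 _)).
Qed.

Let idx (s : 'I_N + 'I_L) : 'I_(N + L) :=
  match s with inl i => lshift L i | inr a => rshift N a end.

Let G_sym : G^T = G.
Proof.
by rewrite tr_block_mx !trmx0 !trmx_inv eta_sym.1 mu_sym.1.
Qed.

Let bform_delta s t : bform G (delta_mx 0 (idx s)) (delta_mx 0 (idx t)) = D s t.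
Proof.
have E i j : bform G (delta_mx 0 i) (delta_mx 0 j) = G i j.
  by rewrite /bform -rowE trmx_delta -colE !mxE.
by rewrite E; case: s t => [i|a] [j|b];
  rewrite /= ?block_mxEul ?block_mxEur ?block_mxEdl ?block_mxEdr ?mxE.
Qed.

(* The Gram matrix of a solution of the Gauss-Weingarten equations and the constant
   matrix D are parallel tensors that agree at q. *)
Lemma moving_frame : exists (e : R) (E : 'I_N + 'I_L -> 'rV[R]_N -> 'rV[R]_(N + L)),
  [/\ 0 < e, ball q e `<=` U, forall s, smooth_on (ball q e) (E s),
    forall s j x, ball q e x -> partial j (E s) x = \sum_t c j s t x *: E t x &
    forall s t x, ball q e x -> bform G (E s x) (E t x) = D s t].
Proof.
have [e1 e10 H1] := linear_frobenius oU Uq c_smooth.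
have [e2 e20 H2] := tensor_solution_unique oU Uq c_smooth.
pose e := Num.min e1 e2.
have e0 : 0 < e by rewrite lt_min e10.
have [|eU ex _] := H1 e e0; first by rewrite ge_min lexx.
pose E0 s : 'rV[R]_(N + L) := delta_mx 0 (idx s).
(* The system is linear with scalar coefficients, so each ambient coordinate [k] of the frame is
   solved separately. *)
have Yex k := ex c_flat (fun s => E0 s 0 k).
pose Y k := s2val (cid2 (Yex k)).
have Ysol k : linear_solution (ball q e) c (Y k) := s2valP (cid2 (Yex k)).
have Yq k s : Y k s q = E0 s 0 k := s2valP' (cid2 (Yex k)) s.
pose E s x : 'rV[R]_(N + L) := \row_k Y k s x.
have oV : open (ball q e) by exact: ball_open.
have cV i s t : smooth (ball q e) (c i s t) by move=> k; exact: Ck_sub eU (c_smooth i s t k).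
have Ecoord s k : (fun x => E s x 0 k) = Y k s by apply/funext => x; rewrite mxE.
have sE s : smooth_on (ball q e) (E s).
  apply/smooth_on_coordP => // k; rewrite Ecoord.
  exact: linear_solution_smooth (Ysol k) s.
have dE s j x : ball q e x -> partial j (E s) x = \sum_t c j s t x *: E t x.
  move=> qx; apply/rowP => k; rewrite partial_coord; last exact: smooth_on_diff (sE s) qx.
  rewrite Ecoord; have [_ ->] := Ysol k x qx s; rewrite summxE.
  by apply: eq_bigr => t _; rewrite !mxE.
exists e, E; split=> // s0 t0 x0 qx0.
have e2e : e <= e2 by rewrite ge_min lexx orbT.
apply: (H2 e e0 e2e (fun s t x => bform G (E s x) (E t x)) (fun s t => cst (D s t))
  _ _ _ x0 qx0 s0 t0).
- move=> x qx s t; have dx u := smooth_on_diff (sE u) qx; split.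
    exact: smooth_diff (smooth_bform G oV (sE s) (sE t)) qx.
  move=> j; rewrite partial_bform// big_split; congr (_ + _).
    rewrite dE// bform_suml; apply: eq_bigr => u _; exact: bformZl.
  rewrite dE// bform_sumr//; apply: eq_bigr => u _; exact: bformZr.
- move=> x qx s t; split; first exact: differentiable_cst.
  by move=> j; rewrite (partial_cst (D s t)) D_parallel.
- move=> s t.
  have Eq u : E u q = E0 u by apply/rowP => k; rewrite mxE Yq.
  by rewrite !Eq bform_delta.
Qed.

Lemma bonnet : exists (G : 'M[R]_(N + L)) (V : set 'rV[R]_N)
    (r : 'rV[R]_N -> 'rV[R]_(N + L)) (n : 'I_L -> 'rV[R]_N -> 'rV[R]_(N + L)),
  [/\ nondeg_sym G /\ signature_is_sum etaU muU G,
      [/\ open V, V q & V `<=` U],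
      flat_submanifold G V r /\ torsionless_frame G V r (invmx muU) n,
      forall u : 'rV[R]_N, V u -> first_form G r u = invmx etaU &
      forall (a : 'I_L) (u : 'rV[R]_N), V u ->
        second_form G r n a u = hessian (psi a) u].
Proof.
have [etaT ueta] := eta_sym; have [muT umu] := mu_sym.
have [etaT' ueta'] := nondeg_sym_inv eta_sym; have [muT' umu'] := nondeg_sym_inv mu_sym.
have [e [E [e0 eU sE dE gramE]]] := moving_frame.
have oe : open (ball q e) by exact: ball_open.
have qe : ball q e q by exact: ballxx.
have dEx s x : ball q e x -> differentiable (E s) x.
  by move=> qx; exact: smooth_on_diff (sE s) qx.
(* Symmetry of the Hessians makes the tangent fields closed, so that they are the partials of a map
   [r]. *)
have dE_sym i j x : ball q e x -> partial i (E (inl j)) x = partial j (E (inl i)) x.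
  move=> qx; apply: (etrans (dE _ _ _ qx)); apply: (etrans _ (esym (dE _ _ _ qx))).
  apply: eq_bigr => -[k|b] _ /=; first by [].
  apply: (congr1 (fun z => z *: _)); apply: eq_bigr => a _.
  exact: (congr1 (fun z => _ * z) (h_sym a j i (eU x qx))).
have [e' [f [e'0 e'e sf _ df]]] := @poincare R N (ball q e) 'I_(N + L)
  (fun k i x => E (inl i) x 0 k) q (fun=> 0) oe qe
  (fun k i => (smooth_on_coordP (E (inl i)) oe).1 (sE (inl i)) k)
  (fun k i j x qx => etrans (esym (partial_coord i k (dEx (inl j) x qx)))
    (etrans (congr1 (fun v : 'rV[R]_(N + L) => v 0 k) (dE_sym i j x qx))
      (partial_coord j k (dEx (inl i) x qx)))).
pose V := ball q e'; have oV : open V by exact: ball_open.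
pose r x : 'rV[R]_(N + L) := \row_k f k x.
pose n a := E (inr a).
have rcoord k : (fun x => r x 0 k) = f k by apply/funext => x; rewrite mxE.
have sr : smooth_on V r by apply/smooth_on_coordP => // k; rewrite rcoord.
have dr i x : V x -> partial i r x = E (inl i) x.
  move=> Vx; apply/rowP => k; rewrite partial_coord; last exact: smooth_on_diff sr Vx.
  by rewrite rcoord df.
have Dfirst u : V u -> first_form G r u = invmx etaU.
  move=> Vu; apply/matrixP => i j; rewrite mxE (dr i u Vu) (dr j u Vu).
  exact: (gramE (inl i) (inl j) u (e'e u Vu)).
have sn a : smooth_on V (n a) by move=> s x /e'e; exact: sE.
have gram1 : 1%:M *m G *m 1%:M^T = G by rewrite trmx1 mulmx1 mul1mx.
exists G, V, r, n; split.
- split; last first.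
    rewrite -(invmxK etaU) -(invmxK muU).
    by apply: (signature_congruence etaT' muT' ueta' umu' (unitmx1 _ _)).
  split; first exact: G_sym.
  by rewrite unitmxE det_ublock unitrM -!unitmxE ueta' umu'.
- by split=> //; [exact: ballxx|exact: subset_trans eU].
- split; first split.
  + by split=> // u Vu; rewrite Dfirst.
  + exact: constant_metric_flat Dfirst.
  split; first split=> //.
  + move=> a i u Vu; rewrite (dr i u Vu).
    exact: (gramE (inr a) (inl i) u (e'e u Vu)).
  + move=> a b u Vu; exact: (gramE (inr a) (inr b) u (e'e u Vu)).
  + move=> a b i u Vu; rewrite /torsion_form (dE (inr a) i u (e'e u Vu)) bform_suml.
    apply: big1 => -[k|d] _; rewrite bformZl.
      by rewrite [X in _ * X](gramE (inl k) (inr b) u (e'e u Vu)) mulr0.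
    exact: mul0r.
- exact: Dfirst.
- move=> a u Vu; apply/matrixP => i j; rewrite [LHS]mxE [RHS]mxE.
  rewrite (eq_on_partial j oV Vu (dr i)) (dE (inl i) j u (e'e u Vu)).
  rewrite bform_sumr ?G_sym// big_sumType /= [X in X + _]big1 ?add0r; last first.
    by move=> k _; rewrite bformZr ?G_sym//; exact: mul0r.
  have gr b : bform G (n a u) (E (inr b) u) = invmx muU b a.
    apply: etrans (gramE (inr a) (inr b) u (e'e u Vu)) _; exact: inv_sym.
  (* Pairing with [n a] lowers the index that the Gauss equation raised, which returns the Hessian
     of [psi a]. *)
  transitivity (\sum_b (\sum_d h d i j u * muU d b) * invmx muU b a).
    apply: eq_bigr => b _; rewrite bformZr ?G_sym// gr.
    apply: (congr1 (fun z => z * _)); apply: eq_bigr => d _; exact: mulrC.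
  by apply: (@contract_inv _ _ muU (invmx muU) (fun d => h d i j u)) => //; exact: mulmxV.
Qed.

End Bonnet.

(** * Flat coordinates *)

Lemma lower_index (R : realType) m (A : 'M[R]_m) (F : 'I_m -> R) j :
  A^T = A -> A \in unitmx ->
  \sum_k (2^-1 * \sum_l invmx A k l * F l) * A k j = 2^-1 * F j.
Proof.
move=> AT uA; rewrite -(@contract_inv _ _ (invmx A) A F (fun k => A k j) j)//; last exact: mulVmx.
rewrite mulr_sumr; apply: eq_bigr => k _; rewrite mulrA; congr (_ * _ * _).
by apply: eq_bigr => l _; rewrite mulrC -[in LHS]AT -trmx_inv mxE.
Qed.

Section LeviCivita.
Context {R : realType} {N : nat}.
Variables (U : set 'rV[R]_N) (g : 'rV[R]_N -> 'M[R]_N).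
Hypotheses (oU : open U) (g_smooth : forall i j, smooth U (fun u => g u i j)).
Hypotheses (g_sym : forall u i j, g u i j = g u j i).
Hypothesis g_unit : forall u, U u -> g u \in unitmx.

Let dg i j l := partial i (fun v => g v j l).

Let dg_sym i j l u : dg i j l u = dg i l j u.
Proof.
rewrite /dg (_ : (fun v => g v j l) = (fun v => g v l j))//.
by apply/funext => v; exact: g_sym.
Qed.

Lemma christoffel_smooth k i j : smooth U (christoffel g k i j).
Proof.
have sdg a b d : smooth U (dg a b d) by exact: smooth_partial.
move=> m; apply: CkM => //; first exact: Ck_cst.
apply: Ck_sum => // l _; apply: CkM => //.
  by apply: Ck_invmx => // a b; exact: g_smooth.
by apply: CkB => //; [apply: CkD => //; exact: sdg|exact: sdg].
Qed.

Lemma christoffel_sym k i j u : christoffel g k i j u = christoffel g k j i u.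
Proof.
apply: (congr1 (fun z => 2^-1 * z)); apply: eq_bigr => l _.
apply: (congr1 (fun z => _ * z)); apply: congr2; first exact: addrC.
apply: congr1; exact: dg_sym.
Qed.

Let gT u : (g u)^T = g u.
Proof. by apply/matrixP => i j; rewrite mxE. Qed.

Lemma christoffel_lower i j l u : U u ->
  \sum_k christoffel g k l i u * g u k j = 2^-1 * (dg l i j u + dg i l j u - dg j l i u).
Proof.
move=> Uu; exact: (@lower_index R N (g u)
  (fun m => dg l i m u + dg i l m u - dg m l i u) j (gT u) (g_unit Uu)).
Qed.

Let half_sum (a b d : R) : 2^-1 * (a + b - d) + 2^-1 * (a + d - b) = a.
Proof. by field. Qed.

(** Adding the lowered Christoffel symbols for [i, j] and for [j, i] cancels everything except the
    derivative of the metric. *)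
Lemma metric_parallel :
  tensor_solution U (fun l i k => christoffel g k l i) (fun i j u => g u i j).
Proof.
move=> u Uu i j; split=> [|l]; first exact: smooth_diff (g_smooth i j) Uu.
rewrite big_split /=.
have -> : \sum_k christoffel g k l j u * g u i k = \sum_k christoffel g k l j u * g u k i.
  by apply: eq_bigr => k _; apply: (congr1 (fun z => _ * z)); exact: g_sym.
rewrite (christoffel_lower i j l Uu) (christoffel_lower j i l Uu).
rewrite -[LHS](half_sum _ (dg i l j u) (dg j l i u)).
apply: (congr1 (fun z => _ + 2^-1 * (z + _ - _))).
exact: (dg_sym l i j u).
Qed.

(** The coefficients are those of parallel covectors; their curvature is [riemann] with upper index
    [b] and lower index [a], up to the order of the factors. *)
Lemma flat_connection : flat_metric U g ->
  flat_coefficients U (fun j i k => christoffel g k j i).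
Proof.
move=> fl i j a b u Uu; apply: etrans (fl b a i j u Uu).
apply: (congr1 (fun z => _ + z)); apply: eq_bigr => d _.
by apply: congr2; [exact: mulrC|apply: congr1; exact: mulrC].
Qed.

End LeviCivita.

(** The product rule in algebraic form: a combination of products of parallel covectors with
    constant coefficients is a parallel 2-tensor. *)
Lemma tensor_leibniz (R : comPzRingType) (I : finType) (G u v : I -> I -> R)
    (c d : I -> R) i j :
  \sum_a \sum_b G a b * ((\sum_k c k * u a k) * v b j + u a i * (\sum_k d k * v b k)) =
  \sum_k (c k * (\sum_a \sum_b G a b * (u a k * v b j)) +
          d k * (\sum_a \sum_b G a b * (u a i * v b k))).
Proof.
rewrite big_split /=.
have E (w : I -> R) (F : I -> I -> I -> R) :
    \sum_k w k * (\sum_a \sum_b G a b * F k a b) =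
    \sum_a \sum_b G a b * (\sum_k w k * F k a b).
  under eq_bigr do rewrite mulr_sumr.
  rewrite exchange_big; apply: eq_bigr => a _ /=.
  under eq_bigr do rewrite mulr_sumr.
  rewrite exchange_big; apply: eq_bigr => b _ /=.
  by rewrite mulr_sumr; apply: eq_bigr => k _; rewrite mulrCA.
rewrite !E -big_split; apply: eq_bigr => a _ /=; rewrite -big_split; apply: eq_bigr => b _ /=.
rewrite -mulrDr; congr (_ * (_ + _)).
  by rewrite mulr_suml; apply: eq_bigr => k _; rewrite mulrA.
by rewrite mulr_sumr; apply: eq_bigr => k _; rewrite mulrCA.
Qed.

Section FlatCoordinates.
Context {R : realType} {N L : nat}.

(* A parallel coframe theta = df gives coordinates f in which the metric is
   constant, because f^* g(p) and g are parallel tensors that agree at p. *)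
Lemma flat_functions (U : set 'rV[R]_N) (g : 'rV[R]_N -> 'M[R]_N) (p : 'rV[R]_N) :
  open U -> U p -> (forall i j, smooth U (fun u => g u i j)) ->
  (forall u i j, g u i j = g u j i) -> (forall u, U u -> g u \in unitmx) ->
  flat_metric U g ->
  exists (V : set 'rV[R]_N) (f : 'I_N -> 'rV[R]_N -> R),
    [/\ [/\ open V, V p & V `<=` U], forall a, smooth V (f a),
      forall a i, partial i (f a) p = (i == a)%:R &
      forall x, V x -> let J := \matrix_(i, a) partial i (f a) x in
        g x = J *m g p *m J^T].
Proof.
move=> oU Up sg gC ug fl.
pose c (j i k : 'I_N) := christoffel g k j i.
have sc i a b : smooth U (c i a b) by exact: (christoffel_smooth oU sg ug).
have fc : flat_coefficients U c := flat_connection fl.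
have [e1 e10 H1] := linear_frobenius oU Up sc.
have [e2 e20 H2] := tensor_solution_unique oU Up sc.
pose e := Num.min e1 e2.
have e0 : 0 < e by rewrite lt_min e10.
have [|eU ex _] := H1 e e0; first by rewrite ge_min lexx.
(* The identity as initial value serves twice: it makes the two tensors agree at [p], and it
   normalises the Jacobian for [inverse_function]. *)
have exf a := ex fc (fun i => (i == a)%:R).
pose th a := s2val (cid2 (exf a)).
have thsol a : linear_solution (ball p e) c (th a) := s2valP (cid2 (exf a)).
have thp a i : th a i p = (i == a)%:R := s2valP' (cid2 (exf a)) i.
have oe : open (ball p e) by exact: ball_open.
have pe : ball p e p by exact: ballxx.
have ce i a b : smooth (ball p e) (c i a b) by move=> k; exact: Ck_sub eU (sc i a b k).
have sth a i : smooth (ball p e) (th a i) := linear_solution_smooth oe ce (thsol a) i.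
have dth a i j x : ball p e x -> partial j (th a i) x = \sum_k c j i k x * th a k x.
  by move=> qx; have [_ ->] := thsol a x qx i.
(* The Christoffel symbols are symmetric in their lower indices, so parallel covector fields are
   closed. *)
have closed_th a i j x : ball p e x -> partial i (th a j) x = partial j (th a i) x.
  move=> qx; apply: (etrans (dth a j i x qx)); apply: (etrans _ (esym (dth a i j x qx))).
  apply: eq_bigr => k _; apply: (congr1 (fun z => z * _)).
  exact: (christoffel_sym gC).
have [e' [f [e'0 e'e sf _ df]]] := @poincare R N (ball p e) 'I_N th p (fun=> 0) oe pe sth closed_th.
have gK x : ball p e x -> forall i j,
    g x i j = \sum_a \sum_b g p a b * (th a i x * th b j x).
  have e2e : e <= e2 by rewrite ge_min lexx orbT.
  apply: (H2 e e0 e2e (fun i j x => g x i j)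
    (fun i j x => \sum_a \sum_b g p a b * (th a i x * th b j x))).
  - by move=> y qy; exact: (metric_parallel sg gC ug (eU y qy)).
  - move=> y qy i j.
    have dt a k : differentiable (th a k) y by exact: smooth_diff (sth a k) qy.
    have dtt a b : differentiable (fun x => th a i x * th b j x) y.
      exact: differentiableM.
    have dgtt a b : differentiable (fun x => g p a b * (th a i x * th b j x)) y.
      by apply: differentiableM => //; exact: differentiable_cst.
    split=> [|l]; first by apply: differentiable_sum_fin => a _; exact: differentiable_sum_fin.
    rewrite partial_sum => [|a _]; last exact: differentiable_sum_fin.
    transitivity (\sum_a \sum_b g p a b * ((\sum_k c l i k y * th a k y) * th b j y +
        th a i y * (\sum_k c l j k y * th b k y))).
      apply: eq_bigr => a _; rewrite partial_sum//; apply: eq_bigr => b _.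
      rewrite partialMl//; apply: (congr1 (fun z => _ * z)); rewrite partialM//.
      by apply: congr2; [rewrite dth|rewrite (dth b j l)].
    exact: tensor_leibniz.
  - move=> i j; rewrite (bigD1 i)//= [X in _ + X]big1 ?addr0; last first.
      by move=> a ai; rewrite big1// => b _; rewrite !thp eq_sym (negbTE ai) mul0r mulr0.
    rewrite (bigD1 j)//= big1 ?addr0; last first.
      by move=> b bj; rewrite !thp [j == b]eq_sym (negbTE bj) !mulr0.
    by rewrite !thp !eqxx !mulr1.
exists (ball p e'), f; split=> //.
- by split; [exact: ball_open|exact: ballxx|exact: subset_trans eU].
- by move=> a i; rewrite df ?thp//; exact: ballxx.
- move=> x Vx /=; apply/matrixP => i j; rewrite gK; last exact: e'e.
  rewrite [RHS]mxE exchange_big; apply: eq_bigr => b _.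
  rewrite [in RHS]mxE mulr_suml; apply: eq_bigr => a _; rewrite !mxE !df//.
  by rewrite mulrCA mulrA.
Qed.

Lemma flat_coordinates_exist (G : 'M[R]_(N + L)) (U : set 'rV[R]_N)
    (r : 'rV[R]_N -> 'rV[R]_(N + L)) (p : 'rV[R]_N) :
  G^T = G -> flat_submanifold G U r -> U p ->
  exists (W : set 'rV[R]_N) (phi : 'rV[R]_N -> 'rV[R]_N) (eta : 'M[R]_N),
    flat_coordinates G U r W phi eta /\ (phi @` W) p.
Proof.
move=> GT [[oU sr ug] fl] Up.
have sg i j : smooth U (fun u => first_form G r u i j).
  move=> k; apply: (@Ck_eq _ _ _ _ (fun u => bform G (partial i r u) (partial j r u))) => //.
    by move=> u _; rewrite mxE.
  by apply: smooth_bform => //; exact: smooth_on_partial.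
have gC u i j : first_form G r u i j = first_form G r u j i by rewrite !mxE; exact: bformC.
have [V [f [[oV Vp VU] sf dfp gJ]]] := flat_functions oU Up sg gC ug fl.
(* The Jacobian is a factor of the invertible metric [g x = J *m g p *m J^T], hence invertible
   throughout [V]. *)
have uJ x : V x -> (\matrix_(i, a) partial i (f a) x) \in unitmx.
  by move=> Vx; have := ug x (VU x Vx); rewrite (gJ x Vx) !unitmx_mul => /andP[/andP[]].
have [W [phi [[oW sphi oI IV] Wp phip phiK dphi]]] := inverse_function oV Vp sf dfp uJ.
have WV w : W w -> V (phi w) by move=> Ww; apply: IV; exists w.
exists W, phi, (first_form G r p); split; last by exists (\row_a f a p).
split; first split=> //.
- exact: subset_trans VU.
- exists (fun x => \row_a f a x); last exact: phiK.
  apply/smooth_on_coordP => // a k.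
  apply: (@Ck_eq _ _ _ _ (f a)) => // [y _|]; first by rewrite mxE.
  exact: Ck_sub IV (sf a k).
- move=> w Ww; have Uw := VU _ (WV w Ww).
  rewrite (first_form_comp GT (smooth_on_diff sphi Ww) (smooth_on_diff sr Uw)).
  rewrite (gJ _ (WV w Ww)); set J := \matrix_(i, a) _.
  have -> : chart_jacobian phi w = invmx J by apply/matrixP => a i; rewrite mxE dphi.
  have JU : J \in unitmx by exact: uJ (WV w Ww).
  by rewrite !mulmxA mulVmx// mul1mx -mulmxA -trmx_mul mulVmx// trmx1 mulmx1.
Qed.

End FlatCoordinates.

Theorem theorem4p1 (R : realType) (N L : nat) :
  (* flat torsionless submanifolds give solutions *)
  (forall (G : 'M[R]_(N + L)) (U : set 'rV[R]_N)
      (r : 'rV[R]_N -> 'rV[R]_(N + L))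
      (mu : 'M[R]_L) (n : 'I_L -> 'rV[R]_N -> 'rV[R]_(N + L)),
    nondeg_sym G ->
    flat_submanifold G U r ->
    torsionless_frame G U r mu n ->
    (forall p : 'rV[R]_N, U p ->
       exists (W : set 'rV[R]_N) (phi : 'rV[R]_N -> 'rV[R]_N) (eta : 'M[R]_N),
         flat_coordinates G U r W phi eta /\ (phi @` W) p) /\
    (forall (W : set 'rV[R]_N) (phi : 'rV[R]_N -> 'rV[R]_N) (eta : 'M[R]_N)
        (q : 'rV[R]_N),
       flat_coordinates G U r W phi eta -> W q ->
       [/\ nondeg_sym (invmx eta), nondeg_sym (invmx mu),
           signature_is_sum (invmx eta) (invmx mu) G &
           exists (V : set 'rV[R]_N) (psi : 'I_L -> 'rV[R]_N -> R),
             [/\ [/\ open V, V q & V `<=` W],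
                 forall a : 'I_L, smooth_on V (psi a),
                 psi_system (invmx eta) (invmx mu) V psi &
                 forall (a : 'I_L) (u : 'rV[R]_N), V u ->
                   second_form G (r \o phi) (fun b => n b \o phi) a u
                   = hessian (psi a) u]]))
  /\
  (* every solution arises in this way *)
  (forall (etaU : 'M[R]_N) (muU : 'M[R]_L) (U : set 'rV[R]_N)
      (psi : 'I_L -> 'rV[R]_N -> R) (q : 'rV[R]_N),
    nondeg_sym etaU -> nondeg_sym muU ->
    open U -> (forall a : 'I_L, smooth_on U (psi a)) ->
    psi_system etaU muU U psi ->
    U q ->
    exists (G : 'M[R]_(N + L)) (V : set 'rV[R]_N)
        (r : 'rV[R]_N -> 'rV[R]_(N + L))
        (n : 'I_L -> 'rV[R]_N -> 'rV[R]_(N + L)),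
      [/\ nondeg_sym G /\ signature_is_sum etaU muU G,
          [/\ open V, V q & V `<=` U],
          flat_submanifold G V r /\ torsionless_frame G V r (invmx muU) n,
          forall u : 'rV[R]_N, V u -> first_form G r u = invmx etaU &
          forall (a : 'I_L) (u : 'rV[R]_N), V u ->
            second_form G r n a u = hessian (psi a) u]).
Proof.
split=> [G U r mu n nG flat_r torsionless_n|etaU muU U psi q neta nmu oU spsi psi_eq Uq].
  split=> [p Up|W phi eta q coords Wq].
    exact: flat_coordinates_exist nG.1 flat_r Up.
  exact: flat_chart_potentials nG flat_r.1 torsionless_n coords Wq.
have spsi' a : smooth U (psi a) by exact/smooth_onP.
exact: bonnet neta nmu oU spsi' Uq psi_eq.
Qed.
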